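(* Let $f=f^{(0)}+\dots+f^{(m)}$ be a polynomial vector field of degree $m$ on $\mathbb{C}^3$ ($f^{(i)}$ homogeneous of degree $i$, $f^{(m)}\ne0$), and assume that (i) the reduction of $f^{(m)}$ (with respect to some nonzero linear form $\alpha$) admits no stationary points at infinity, i.e. there is no $v\ne0$ with $\alpha(v)=0$ and $f^{(m)}(v)\in\mathbb{C}v$; (ii) $f$ has property E. Then: (a) Every irreducible homogeneous semi-invariant of $f^{(m)}$ has degree $\le m+1$. (b) There exist, up to scalar multiples, only finitely many irreducible homogeneous semi-invariants $\psi_1,\dots,\psi_\ell$ of $f^{(m)}$, and if $\ell\ge2$ then $\sum_{1\le i<j\le\ell}\deg\psi_i\cdot\deg\psi_j\le m^2+m+1$; in particular $\ell(\ell-1)/2\le m^2+m+1$. (c) $f$ admits only finitely many irreducible, pairwise relatively prime semi-invariants.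
   Context: A semi-invariant of a polynomial vector field $h$ is a nonconstant polynomial $\psi$ with $X_h(\psi)=\lambda\psi$ for some polynomial $\lambda$, $X_h=\sum h_i\partial/\partial x_i$. Reduction: for a homogeneous $p$ of degree $m$ and a nonzero linear form $\alpha$, the map $x\mapsto x/\alpha(x)$ sends orbits of $\dot x=p(x)$ to orbits of $\dot x=\alpha(x)p(x)-\alpha(p(x))x$, which preserves the affine plane $\{\alpha=1\}$; the restriction to this plane is the reduction $q$ of $p$. Its stationary points at infinity (after removing the common factor of the Poincaré transform vanishing on the line at infinity) correspond exactly to lines $\mathbb{C}v$ with $\alpha(v)=0$ and $p(v)\in\mathbb{C}v$. Poincaré transform: for $v\ne0$ choose regular $T$ with $Tv=e_1$, put $F=T\circ f\circ T^{-1}$, $G_i(x_1,\dots,x_4)=\sum_{j=0}^mF_i^{(j)}(x_1,x_2,x_3)x_4^{m-j}$, and let $f_v^*(x_2,x_3,x_4)$ have components $-G_1x_2+G_2$, $-G_1x_3+G_3$, $-G_1x_4$, evaluated at $(1,x_2,x_3,x_4)$. Property E: for every $v\ne0$ with $f^{(m)}(v)\in\mathbb{C}v$, the eigenvalues $\lambda_1,\lambda_2,\lambda_3$ of $Df_v^*(0)$ are linearly independent over $\mathbb{Q}$, or satisfy $\dim_{\mathbb{Q}}(\sum\mathbb{Q}\lambda_i)=2$ together with $\sum m_i\lambda_i=0$ for some positive integers $m_i$. *)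

(* Defs.v *)
From HB Require Import structures.
From mathcomp Require Import all_boot all_algebra.
From mathcomp Require Import mpoly.
From mathcomp Require Import complex.
From mathcomp Require Import reals.

Set Implicit Arguments.
Unset Strict Implicit.
Unset Printing Implicit Defensive.

Import GRing.Theory Num.Theory.
Local Open Scope ring_scope.

Section Defs.
Variable C : fieldType.

Definition vfield := 'I_3 -> {mpoly C[3]}.

(* total degree of a polynomial (msize p = 1 + total degree, msize 0 = 0) *)
Definition tdeg (p : {mpoly C[3]}) : nat := (msize p).-1.

Definition hpart (d : nat) (p : {mpoly C[3]}) : {mpoly C[3]} :=
  \sum_(mm <- msupp p | mdeg mm == d) p@_mm *: 'X_[mm].

Definition vhpart (d : nat) (f : vfield) : vfield := fun i => hpart d (f i).

Definition vf_degree (f : vfield) (m : nat) : Prop :=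
  (forall i, msize (f i) <= m.+1)%N /\ (exists i, hpart m (f i) != 0).

Definition Xder (h : vfield) (psi : {mpoly C[3]}) : {mpoly C[3]} :=
  \sum_(i < 3) h i * psi^`M(i).

Definition semi_invariant (h : vfield) (psi : {mpoly C[3]}) : Prop :=
  (1 < msize psi)%N /\ exists lam : {mpoly C[3]}, Xder h psi = lam * psi.

Definition mirreducible (p : {mpoly C[3]}) : Prop :=
  (1 < msize p)%N /\
  forall q r : {mpoly C[3]}, p = q * r -> (msize q <= 1)%N \/ (msize r <= 1)%N.

Definition mhomogeneous (p : {mpoly C[3]}) : Prop :=
  exists d : nat, p \is d.-homog.

Definition mdvd (d p : {mpoly C[3]}) : Prop := exists q, p = d * q.

Definition mcoprime (p q : {mpoly C[3]}) : Prop :=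
  forall d, mdvd d p -> mdvd d q -> (msize d <= 1)%N.

Definition vfeval (f : vfield) (v : 'cV[C]_3) : 'cV[C]_3 :=
  \col_i (f i).@[fun j => v j 0].

Definition no_stationary_at_infinity (h : vfield) : Prop :=
  exists alpha : 'rV[C]_3, alpha != 0 /\
    forall v : 'cV[C]_3, v != 0 -> alpha *m v = 0 ->
      ~ (exists c : C, vfeval h v = c *: v).

Definition linsubst (A : 'M[C]_3) : 3.-tuple {mpoly C[3]} :=
  [tuple \sum_(l < 3) A j l *: 'X_l | j < 3].

Definition conjvf (T : 'M[C]_3) (f : vfield) : vfield :=
  fun i => \sum_(k < 3) T i k *: (f k \mPo linsubst (invmx T)).

(* G_i(1, y1, y2, y3) = sum_j F_i^(j)(1, y1, y2) y3^(m-j), where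
   (y1, y2, y3) stand for (x2, x3, x4) *)
Definition Gdehom (m : nat) (F : vfield) (i : 'I_3) : {mpoly C[3]} :=
  \sum_(j < m.+1)
     (hpart j (F i) \mPo [tuple 1; 'X_0; 'X_1]) * 'X_2 ^+ (m - j).

(* Poincare transform f_v^* (for the chosen T with T v = e1) *)
Definition poincare (m : nat) (T : 'M[C]_3) (f : vfield) : vfield :=
  let G := Gdehom m (conjvf T f) in
  fun a => match nat_of_ord a with
           | 0 => - (G 0 * 'X_0) + G 1
           | 1 => - (G 0 * 'X_1) + G 2
           | _ => - (G 0 * 'X_2)
           end.

Definition jac0 (g : vfield) : 'M[C]_3 :=
  \matrix_(a, b) ((g a)^`M(b)).@[fun _ => 0].

Definition Qindep (k : nat) (x : 'I_k -> C) : Prop :=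
  forall q : 'I_k -> rat, \sum_(i < k) ratr (q i) * x i = 0 -> forall i, q i = 0.

(* dim_Q (sum_i Q x_i) >= k : some k of the x_i are Q-independent *)
Definition Qdim_ge (n : nat) (x : 'I_n -> C) (k : nat) : Prop :=
  exists s : 'I_k -> 'I_n, injective s /\ Qindep (fun i => x (s i)).

Definition Qdim_eq (n : nat) (x : 'I_n -> C) (k : nat) : Prop :=
  Qdim_ge x k /\ ~ Qdim_ge x k.+1.

Definition e1 : 'cV[C]_3 := delta_mx 0 0.

Definition propertyE (f : vfield) (m : nat) : Prop :=
  forall v : 'cV[C]_3, v != 0 ->
  (exists c : C, vfeval (vhpart m f) v = c *: v) ->
  forall T : 'M[C]_3, T \in unitmx -> T *m v = e1 ->
  forall lam : 'I_3 -> C,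
    char_poly (jac0 (poincare m T f)) = \prod_(i < 3) ('X - (lam i)%:P) ->
    Qindep lam \/
    (Qdim_eq lam 2 /\
     exists mi : 'I_3 -> nat, (forall i, 0 < mi i)%N /\
                              \sum_(i < 3) (mi i)%:R * lam i = 0).

End Defs.

(* Main.v *)
Require Import Defs.
From HB Require Import structures.
From mathcomp Require Import all_boot all_order all_algebra.
From mathcomp Require Import perm mpoly.
From mathcomp Require Import complex.
From mathcomp Require Import reals.
From mathcomp Require boolp.
From mathcomp Require Import zify ring.

(* Let p be the homogeneous part of degree m of f, seen as a foliation of the projective
   plane; its singular points are the lines C v with p(v) in C v.

   Property E forbids resonances at a singular point v. Comparing weights along the
   eigendirections q1, q2 of the Poincare transform and along its formal branches shows that
   an irreducible invariant curve of p through v is smooth and tangent to q1 or to q2, or has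
   an ordinary node with tangents q1 and q2; that coprime invariant curves use different
   branches; and that at most two pairwise coprime semi-invariants of f have a highest form
   vanishing at v.

   Intersection numbers are computed with norms from C[x][y]/(psi) to C[x], where psi is monic
   in y in a general chart, so that Bezout's theorem becomes a degree count. Put
   theta_w(x) = det(w, x, p(x)) and let psi_w be the derivative of psi along w. Two curves
   theta_w show that there are at most m^2 + m + 1 singular points. For an invariant curve psi
   of degree d, theta_w psi_w' = theta_w' psi_w mod psi, so theta_w / psi_w does not depend on w
   along psi. Comparing norms of theta_w and psi_w gives d <= m + 1, and then also a
   singular point on psi. Coprime invariant curves are transversal at all common points, which
   are singular, so psi_i and psi_j share deg psi_i deg psi_j of them, and no singular point
   lies on three curves; this gives (b). In (c) each highest form vanishes at one of the finitely
   many singular points, and three of them at the same one. *)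

Set Implicit Arguments.
Unset Strict Implicit.
Unset Printing Implicit Defensive.

Import Order.TTheory GRing.Theory Num.Theory.
Local Open Scope ring_scope.

(** Convergence of the local branches never has to be discussed: a branch is an invariant graph
    computed to order N, for every N. Elimination makes this enough. Two coprime polynomials have a
    nonzero combination that is constant along a chosen direction; along the eigendirection
    transversal to the graph, such a combination restricts to the graph as itself, so it cannot
    vanish there to every order. The same device replaces uniqueness of solutions at nonsingular
    points.

    Property E enters only through the signs of integer relations between the three eigenvalues: a
    relation of mixed sign is impossible, and every resonance that would obstruct a branch has mixed
    sign.

    The delicate points of an invariant curve are its nodes, where theta_w and psi_w vanish
    together. For general w the curve psi_w meets psi at a node with multiplicity exactly 2, while
    any curve through the node meets psi there with multiplicity at least 2; so the comparison of
    norms survives. To attribute the order of a norm to one point, charts are chosen with at most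
    one singular point over each x. *)

Lemma ex_minimal (P : nat -> Prop) :
  (exists n, P n) -> exists n, P n /\ forall k, (k < n)%N -> ~ P k.
Proof.
move=> [n]; have [N] := ubnP n; elim: N n => // N IH n le_n Pn.
have [[k [lt_kn Pk]]|no] := boolp.EM (exists k, (k < n)%N /\ P k).
  by apply: (IH k) => //; apply: leq_trans lt_kn _.
by exists n; split=> // k lt_kn Pk; apply: no; exists k.
Qed.

(** * Factorization and elimination *)

Section Factorial.
Variable R : idomainType.
Implicit Types a b c p : R.

Definition divides a b := exists c, b = a * c.

Definition prime_elt p :=
  [/\ p != 0, p \isn't a GRing.unit &
      forall a b, divides p (a * b) -> divides p a \/ divides p b].

(** Factors are required to be prime, not merely irreducible. Uniqueness is then automatic, and
    Gauss's lemma only has to show that primes stay prime. *)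
Definition factorial_domain :=
  forall a, a != 0 -> exists (s : seq R) (u : R),
    [/\ u \is a GRing.unit, forall p, p \in s -> prime_elt p
      & a = u * \prod_(p <- s) p].

Lemma divides_sum p (I : eqType) (r : seq I) (P : pred I) (F : I -> R) :
  (forall i, i \in r -> P i -> divides p (F i)) ->
  divides p (\sum_(i <- r | P i) F i).
Proof.
move=> dF; rewrite big_seq_cond; apply: big_ind.
- by exists 0; rewrite mulr0.
- by move=> x y [a ->] [b ->]; exists (a + b); rewrite mulrDr.
- by move=> i /andP[ir Pi]; apply: dF.
Qed.

Lemma divides_prod_prime p (s : seq R) :
  prime_elt p -> divides p (\prod_(x <- s) x) ->
  exists2 x, x \in s & divides p x.
Proof.
move=> [p0 pu pr]; elim: s => [|x s IH].
  rewrite big_nil => -[c pc]; exfalso; move/negP: pu; apply.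
  by apply/unitrPr; exists c.
rewrite big_cons => /pr[dx|/IH[y ys dy]]; first by exists x; rewrite ?mem_head.
by exists y; rewrite ?inE ?ys ?orbT.
Qed.

End Factorial.

Section FactorialPoly.
Variable R : idomainType.
Implicit Types (p c : R) (f g : {poly R}).

Lemma divides_polyC p f : divides p%:P f <-> forall i, divides p f`_i.
Proof.
split=> [[c ->] i|df]; first by exists c`_i; rewrite coefCM.
have /boolp.choice[h hP] : forall i, exists c, f`_i = p * c by [].
exists (\poly_(i < size f) h i); apply/polyP=> i; rewrite coefCM coef_poly.
by case: ltnP => [_|/(nth_default 0)->]; rewrite ?hP ?mulr0.
Qed.

(** Gauss's lemma: if [i] and [j] are the lowest indices of coefficients of [f] and [g] not
    divisible by [p], then every other term of the coefficient of degree i + j in [f * g] is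
    divisible by [p]. *)
Lemma prime_polyC p : prime_elt p -> prime_elt p%:P.
Proof.
move=> [p0 pu pr]; split; rewrite ?polyC_eq0 //.
  by rewrite poly_unitE size_polyC p0 coefC eqxx.
move=> f g dfg; apply: boolp.contrapT => /boolp.not_orP[ndf ndg].
have min h : ~ divides p%:P h ->
    exists i, ~ divides p h`_i /\ forall k, (k < i)%N -> divides p h`_k.
  move=> /divides_polyC /boolp.existsNP ex.
  have [i [Pi mini]] := ex_minimal ex.
  by exists i; split=> // k /mini /boolp.contrapT.
have [i [ndi mini]] := min _ ndf; have [j [ndj minj]] := min _ ndg.
have /divides_polyC/(_ (i + j)%N) := dfg; rewrite coefM.
have lt_i : (i < (i + j).+1)%N by rewrite ltnS leq_addr.
rewrite (bigD1 (Ordinal lt_i)) //= addKn => -[c dc].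
have [d dd] : divides p (\sum_(k < (i + j).+1 | k != Ordinal lt_i)
                           f`_k * g`_(i + j - k)).
  apply: divides_sum => k _ nki.
  have [lt_ki|lt_ik|eq_ki] := ltngtP k i.
  - by have [d ->] := mini _ lt_ki; exists (d * g`_(i + j - k)); rewrite mulrA.
  - have lt_j : (i + j - k < j)%N by have := ltn_ord k; lia.
    by have [d ->] := minj _ lt_j; exists (f`_k * d); rewrite mulrCA.
  - by case/negP: nki; apply/eqP/val_inj.
have /pr[|] : divides p (f`_i * g`_j); last by [].
  by exists (c - d); rewrite mulrBr -dc dd addrK.
by [].
Qed.

Definition primitive_poly f := forall p, prime_elt p -> ~ divides p%:P f.

Lemma primitive_divl f g : primitive_poly (f * g) -> primitive_poly f.
Proof. by move=> pfg p pp [c fc]; apply: (pfg p pp); exists (c * g); rewrite fc mulrA. Qed.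

Hypothesis UR : factorial_domain R.

(** The prime factors of [c] are removed one at a time: each divides [f * h] and, [f] being
    primitive, divides [h]. *)
Lemma cancel_primitive c f g h : c != 0 -> primitive_poly f ->
  c%:P * g = f * h -> divides f g.
Proof.
move=> c0 pf; have [s [u [uu ps ->]]] := UR c0; rewrite mulrC.
elim: s ps g h => [|p s IH] ps g h.
  rewrite big_nil mulr1 => e; exists (u^-1%:P * h).
  by rewrite mulrCA -e mulrCA -polyCM mulVr // mulr1.
rewrite big_cons => e.
have pp : prime_elt p by apply: ps; rewrite mem_head.
have [_ _ /(_ f h)] := prime_polyC pp.
case=> [|/(pf p pp)//|[h' eh]].
  by exists (g * (u * \prod_(j <- s) j)%:P); rewrite -e mulrCA polyCM !(polyCM, mulrA); ring.
have ps' q : q \in s -> prime_elt q by move=> qs; apply: ps; rewrite in_cons qs orbT.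
apply: (IH ps' g h').
have p0 : p%:P != 0 by rewrite polyC_eq0; case: pp.
apply: (mulfI p0); rewrite [RHS]mulrCA -eh -e !polyCM; ring.
Qed.

(** The induction is on the prime factors of the leading coefficient: a prime pulled out of [f] also
    leaves the leading coefficient, so the process stops, and no gcd of coefficients has to be
    formed. *)
Lemma primitive_part f : f != 0 ->
  exists c g, [/\ c != 0, primitive_poly g & f = c%:P * g].
Proof.
move=> f0; have lc0 : lead_coef f != 0 by rewrite lead_coef_eq0.
have [s [u [uu ps lcE]]] := UR lc0.
have [n] := ubnP (size s); elim: n => // n IH in s u f f0 {lc0} ps uu lcE * => lts.
have [pf|/boolp.existsNP[p /boolp.not_implyP[pp /boolp.contrapT[g fg]]]] :=
  boolp.EM (primitive_poly f).
  by exists 1, f; rewrite oner_eq0 mul1r.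
have [p0 pu pr] := pp.
have g0 : g != 0 by apply: contraNneq f0 => g0; rewrite fg g0 mulr0.
have lcf : lead_coef f = p * lead_coef g by rewrite fg lead_coefM lead_coefC.
have : divides p (u * \prod_(q <- s) q) by exists (lead_coef g); rewrite -lcE.
case/pr=> [[w uw]|/(divides_prod_prime pp)[q qs [w qw]]].
  case/negP: pu; apply/unitrPr; exists (w / u).
  by rewrite mulrA -uw divrr.
have [q0 qu qr] := ps _ qs.
have wu : w \is a GRing.unit.
  have : divides q (p * w) by exists 1; rewrite mulr1.
  case/qr=> [[z pz]|[z wz]].
    apply/unitrPr; exists z; apply: (mulfI q0).
    by rewrite mulr1 [RHS]qw -[p]mulr1 pz; ring.
  case/negP: pu; apply/unitrPr; exists z; apply: (mulfI q0).
  by rewrite mulr1 [RHS]qw wz; ring.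
have perm_s := perm_to_rem qs.
have [] := IH (rem q s) (u * w) g g0.
- by move=> x /mem_rem; apply: ps.
- by rewrite unitrM uu.
- apply: (mulfI p0); rewrite -lcf lcE (perm_big _ perm_s) big_cons /= {1}qw; ring.
- by rewrite size_rem // -ltnS prednK //; case: (s) qs.
move=> c [h [c0 ph gE]]; exists (p * c), h; split=> //; first by rewrite mulf_neq0.
by rewrite fg gE polyCM mulrA.
Qed.

Lemma divp_primitive d f g c : d != 0 -> primitive_poly d -> c != 0 ->
  c *: f = g * d -> divides d f.
Proof.
move=> d0 pd c0 e; apply: (@cancel_primitive c d f g) => //.
by rewrite mul_polyC e mulrC.
Qed.

(** Over a domain [gcdp] is the gcd over the fraction field, up to constants. Its primitive part is
    a genuine divisor; if it is constant, Bezout's identity with denominators cleared leaves a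
    nonzero constant [c], which plays the part of the resultant. *)
Lemma common_factor_or_bezout f g : f != 0 ->
  (exists d : {poly R}, [/\ (1 < size d)%N, primitive_poly d, divides d f & divides d g]) \/
  (exists u v c, c != 0 /\ u * f + v * g = c%:P).
Proof.
move=> f0; have d0 : gcdp f g != 0 by rewrite gcdp_eq0 negb_and f0.
have [lt1|le1] := ltnP 1 (size (gcdp f g)).
  left; have [c [d [c0 pd dE]]] := primitive_part d0.
  have dn0 : d != 0 by apply: contraNneq d0 => d0; rewrite dE d0 mulr0.
  exists d; split=> //.
  - by move: lt1; rewrite dE size_Cmul.
  - have /Pdiv.WeakIdomain.dvdpP[[k q] /= k0 e] := dvdp_gcdl f g.
    by apply: (@divp_primitive d f (q * c%:P) k) => //; rewrite e dE mulrA.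
  - have /Pdiv.WeakIdomain.dvdpP[[k q] /= k0 e] := dvdp_gcdr f g.
    by apply: (@divp_primitive d g (q * c%:P) k) => //; rewrite e dE mulrA.
right; have [[u v] /= /eqpP[[a b] /= /andP[a0 b0] e]] := Bezoutp f g.
have /size_poly1P[c c0 gc] : size (gcdp f g) == 1%N.
  by rewrite eqn_leq le1 lt0n size_poly_eq0.
exists (a%:P * u), (a%:P * v), (b * c); split; first by rewrite mulf_neq0.
by rewrite -!mulrA -mulrDr mul_polyC e gc -mul_polyC polyCM.
Qed.

Lemma primitive_size1 f : f != 0 -> primitive_poly f -> (size f <= 1)%N ->
  f \is a GRing.unit.
Proof.
move=> f0 pf /size1_polyC fE; have c0 : f`_0 != 0 by rewrite -polyC_eq0 -fE.
have [s [u [uu ps e]]] := UR c0; case: s ps e => [|p s] ps.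
  by rewrite big_nil mulr1 => e; rewrite fE e; apply: rmorph_unit.
rewrite big_cons => e; exfalso; apply: (pf p); first by apply: ps; rewrite mem_head.
by rewrite fE e; exists (u * \prod_(q <- s) q)%:P; rewrite -polyCM; congr polyC; ring.
Qed.

(** Euclid's lemma: Bezout's identity holds up to a constant [k], which is then cancelled against
    the primitive [f]. *)
Lemma prime_of_indecomposable f : f != 0 -> primitive_poly f -> (1 < size f)%N ->
  (forall g h, f = g * h -> (size g <= 1)%N \/ (size h <= 1)%N) -> prime_elt f.
Proof.
move=> f0 pf lt1 irr; split=> //; first by rewrite poly_unitE eqn_leq leqNgt lt1.
move=> a b [c abE]; apply: boolp.contrapT => /boolp.not_orP[nda ndb].
have [[d [lt1d pd df da]]|[u [v [k [k0 uv]]]]] := common_factor_or_bezout a f0.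
  case: df => e fde; apply: nda.
  have e0 : e != 0 by apply: contraNneq f0 => e0; rewrite fde e0 mulr0.
  have [|sz1] := irr _ _ fde; first by rewrite leqNgt lt1d.
  have ue : e \is a GRing.unit.
    by apply: primitive_size1 => //; apply: (@primitive_divl e d); rewrite mulrC -fde.
  by case: da => w ->; exists (e^-1 * w); rewrite fde mulrA mulrK.
apply: ndb; apply: (@cancel_primitive k f b (u * b + v * c)) => //.
by rewrite -uv mulrDl mulrDr -[v * a * b]mulrA abE; ring.
Qed.

Lemma factorial_poly : factorial_domain {poly R}.
Proof.
have prim f : f != 0 -> primitive_poly f -> exists (s : seq {poly R}) (u : {poly R}),
    [/\ u \is a GRing.unit, forall q, q \in s -> prime_elt q
      & f = u * \prod_(q <- s) q].
  have [n] := ubnP (size f); elim: n f => // n IH f lt_n f0 pf.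
  have [le1|lt1] := leqP (size f) 1.
    exists [::], f; split=> //; first exact: primitive_size1.
    by rewrite big_nil mulr1.
  have [irr|] := boolp.EM (forall g h, f = g * h ->
                             (size g <= 1)%N \/ (size h <= 1)%N).
    exists [:: f], 1; split; rewrite ?unitr1 ?big_seq1 ?mul1r // => p.
    by rewrite inE => /eqP->; apply: prime_of_indecomposable.
  move=> /boolp.existsNP[g /boolp.existsNP[h /boolp.not_implyP[fgh]]].
  move=> /boolp.not_orP[/negP]; rewrite -ltnNge => ltg /negP; rewrite -ltnNge => lth.
  have g0 : g != 0 by rewrite -size_poly_gt0 (ltn_trans _ ltg).
  have h0 : h != 0 by rewrite -size_poly_gt0 (ltn_trans _ lth).
  have szf : size f = (size g + size h).-1 by rewrite fgh size_mul.
  have [||s [u [uu ps gE]]] := IH g _ g0.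
  - by move: lt_n ltg lth; rewrite szf; lia.
  - by apply: (@primitive_divl g h); rewrite -fgh.
  have [||t [v [vu pt hE]]] := IH h _ h0.
  - by move: lt_n ltg lth; rewrite szf; lia.
  - by apply: (@primitive_divl h g); rewrite mulrC -fgh.
  exists (s ++ t), (u * v); split; first by rewrite unitrM uu.
    by move=> p; rewrite mem_cat => /orP[/ps|/pt].
  by rewrite big_cat /= fgh {1}gE {1}hE; ring.
move=> f f0; have [c [g [c0 pg fE]]] := primitive_part f0.
have g0 : g != 0 by apply: contraNneq f0 => g0; rewrite fE g0 mulr0.
have [s [u [uu ps cE]]] := UR c0; have [t [v [vu pt gE]]] := prim g g0 pg.
exists (map polyC s ++ t), (u%:P * v); split.
- by rewrite unitrM vu rmorph_unit.
- by move=> p; rewrite mem_cat => /orP[/mapP[q /ps qs ->]|/pt//]; apply: prime_polyC.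
- by rewrite big_cat big_map /= fE cE {1}gE polyCM rmorph_prod /=; ring.
Qed.

End FactorialPoly.

(** * Factoriality in several variables and elimination of one variable *)

Section MpolyFactorial.
Variable C : fieldType.

(** The inverse of [muni], which makes the last variable the outer one; through this isomorphism
    factoriality passes from one variable to several. *)
Definition of_muni n (p : {poly {mpoly C[n]}}) : {mpoly C[n.+1]} :=
  (map_poly (@mwiden n C) p).['X_ord_max].

Lemma of_muniZX n (c : {mpoly C[n]}) k :
  of_muni (c *: 'X^k) = mwiden c * 'X_ord_max ^+ k.
Proof. by rewrite /of_muni map_polyZ map_polyXn hornerZ hornerXn. Qed.

Lemma of_muni_zmod n : zmod_morphism (@of_muni n).
Proof. by move=> p q; rewrite /of_muni rmorphB hornerD hornerN. Qed.
HB.instance Definition _ n := GRing.isZmodMorphism.Build _ _ (@of_muni n) (@of_muni_zmod n).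

Lemma of_muni_monoid n : monoid_morphism (@of_muni n).
Proof.
split; first by rewrite /of_muni rmorph1 hornerC.
by move=> p q; rewrite /of_muni rmorphM hornerM.
Qed.
HB.instance Definition _ n := GRing.isMonoidMorphism.Build _ _ (@of_muni n) (@of_muni_monoid n).

Lemma muni_scaledX n c (m : 'X_{1..n.+1}) : muni (c *: 'X_[m] : {mpoly C[n.+1]}) =
  (c *: 'X_[[multinom m (widen_ord (leqnSn n) i) | i < n]]) *: 'X^(m ord_max).
Proof.
by rewrite muniZ muniE msuppX big_seq1 mcoeffX eqxx scale1r scalerA mul_mpolyC.
Qed.

Lemma mnm_split n (m : 'X_{1..n.+1}) :
  (mnmwiden [multinom m (widen_ord (leqnSn n) i) | i < n] + U_(ord_max) *+ m ord_max)%MM = m.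
Proof.
apply/mnmP=> i; rewrite mnmDE mulmnE mnm1E.
have [j ->|->] := unliftP ord_max i.
  have -> : lift ord_max j = widen_ord (leqnSn n) j by apply/val_inj; rewrite /= /bump leqNgt ltn_ord.
  by rewrite mnmwiden_widen mnmE -val_eqE /= gtn_eqF // addn0.
by rewrite mnmwiden_ordmax eqxx mul1n.
Qed.

Lemma muniK n : cancel (@muni n C) (@of_muni n).
Proof.
elim/mpolyind=> [|c m p _ _ IH]; first by rewrite !raddf0.
rewrite muniD raddfD /=; congr (_ + _); last exact: IH.
rewrite muni_scaledX of_muniZX.
by rewrite mwidenZ mwidenX -scalerAl mpolyXn -mpolyXD mnm_split.
Qed.

Lemma of_muniK n : cancel (@of_muni n) (@muni n C).
Proof.
elim/poly_ind => [|p c IH]; first by rewrite !raddf0.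
have E k (a : {mpoly C[n]}) : muni (of_muni (a *: 'X^k)) = a *: 'X^k.
  rewrite of_muniZX; elim/mpolyind: a => [|b m a _ _ IHa].
    by rewrite raddf0 mul0r scale0r raddf0.
  rewrite mwidenD mulrDl raddfD /= IHa scalerDl; congr (_ + _).
  rewrite mwidenZ mwidenX -scalerAl mpolyXn -mpolyXD muni_scaledX.
  rewrite mnmDE mulmnE mnm1E eqxx mnmwiden_ordmax mul1n; congr (_ *: 'X_[_] *: _).
  apply/mnmP=> i; rewrite mnmE mnmDE mulmnE mnmwiden_widen mnm1E.
  by rewrite -val_eqE /= gtn_eqF // addn0.
have := E 0%N c; have := E 1%N 1; rewrite expr0 expr1 scale1r alg_polyC => EX Ec.
by rewrite !raddfD /= Ec !rmorphM /= IH EX.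
Qed.

Lemma factorial_transport (R S : idomainType) (f : {rmorphism R -> S})
    (g : {rmorphism S -> R}) :
  cancel f g -> cancel g f -> factorial_domain R -> factorial_domain S.
Proof.
move=> fK gK UR a a0.
have ga0 : g a != 0 by rewrite -(rmorph0 g) (can_eq gK).
have [s [u [uu ps gaE]]] := UR _ ga0; exists (map f s), (f u); split.
- exact: rmorph_unit.
- move=> _ /mapP[p /ps[p0 pu pr] ->]; split.
  + by rewrite -(rmorph0 f) (can_eq fK).
  + by apply: contraNN pu => /(rmorph_unit g); rewrite fK.
  + move=> x y [c xy]; have /pr : divides p (g x * g y).
      by exists (g c); rewrite -rmorphM xy rmorphM fK.
    case=> -[d dE]; [left|right]; exists (f d); by rewrite -rmorphM -dE gK.
- by rewrite big_map -rmorph_prod -rmorphM -gaE gK.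
Qed.

Lemma factorial_mpoly n : factorial_domain {mpoly C[n]}.
Proof.
elim: n => [|n IH].
  move=> a a0; exists [::], a; split=> //; last by rewrite big_nil mulr1.
  have e := nvar0_mpolyC a; move: a0; rewrite e mpolyC_eq0 => a0.
  by rewrite rmorph_unit ?unitfE.
exact: (@factorial_transport {poly {mpoly C[n]}} {mpoly C[n.+1]} (@of_muni n) (@muni n C) (@of_muniK n) (@muniK n) (factorial_poly IH)).
Qed.

Lemma mderiv_mwiden n (p : {mpoly C[n]}) : (mwiden p)^`M(ord_max) = 0.
Proof.
elim/mpolyind: p => [|c m p _ _ IH]; first by rewrite raddf0 mderiv0.
by rewrite mwidenD mderivD IH addr0 mwidenZ mwidenX mderivZ mderivX mnmwiden_ordmax scale0r scaler0.
Qed.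

Lemma msize_le1P n (p : {mpoly C[n]}) : (msize p <= 1)%N <-> exists c, p = c%:MP.
Proof.
split=> [/msize1_polyC->|[c ->]]; first by eexists.
by rewrite msizeC; case: eqP.
Qed.

(** Serves as the resultant of [g] and [h] in the last variable. Freedom from that variable is
    expressed by a vanishing derivative, the form that carries over to an arbitrary direction. *)
Lemma eliminate_last (g h : {mpoly C[3]}) : g != 0 -> mcoprime g h ->
  exists A B, A * g + B * h != 0 /\ (A * g + B * h)^`M(ord_max) = 0.
Proof.
move=> g0 cop.
have mg0 : muni g != 0 by rewrite -(raddf0 (@muni 2 C)) (can_eq (@muniK 2)).
have [] := common_factor_or_bezout (@factorial_mpoly 2) (muni h) mg0.
  move=> [d [lt1 _ [a ga] [b hb]]].
  have /msize_le1P[c dE] : (msize (of_muni d) <= 1)%N.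
    apply: cop; [exists (of_muni a)|exists (of_muni b)].
      by rewrite -[LHS](@muniK 2) ga rmorphM.
    by rewrite -[LHS](@muniK 2) hb rmorphM.
  by move: lt1; rewrite -(of_muniK d) dE muniC size_polyC; case: eqP.
move=> [u [v [c [c0 uv]]]]; exists (of_muni u), (of_muni v).
have -> : of_muni u * g + of_muni v * h = mwiden c.
  rewrite -{1}[g](@muniK 2) -{1}[h](@muniK 2) -!rmorphM -rmorphD uv.
  have -> : c%:P = c *: 'X^0 by rewrite expr0 alg_polyC.
  by rewrite [LHS]of_muniZX expr0 mulr1.
split; last exact: mderiv_mwiden.
by rewrite -(raddf0 (@mwiden 2 C)) (inj_eq (@inj_mwiden 2 C)).
Qed.

End MpolyFactorial.

(** * Linear substitutions and directional derivatives *)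

Section Substitution.
Variable C : fieldType.

Lemma mpoly_morph_ext n (S : comNzRingType) (f g : {rmorphism {mpoly C[n]} -> S}) :
  (forall c, f c%:MP = g c%:MP) -> (forall i, f 'X_i = g 'X_i) -> f =1 g.
Proof.
move=> eC eX p; rewrite (mpolyE p) !raddf_sum; apply: eq_bigr => m _ /=.
rewrite -mul_mpolyC (mpolyXE_id C m) [LHS]rmorphM [RHS]rmorphM eC; congr (_ * _).
rewrite [LHS]rmorph_prod [RHS]rmorph_prod; apply: eq_bigr => i _.
by rewrite [LHS]rmorphXn [RHS]rmorphXn eX.
Qed.

Lemma comp_mpolyM n k (t : n.-tuple {mpoly C[k]}) p q :
  (p * q) \mPo t = (p \mPo t) * (q \mPo t).
Proof. exact: rmorphM. Qed.

Lemma comp_mpoly_sum n k (t : n.-tuple {mpoly C[k]}) (I : Type) (r : seq I) (P : pred I) F :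
  (\sum_(i <- r | P i) F i) \mPo t = \sum_(i <- r | P i) (F i \mPo t).
Proof. exact: raddf_sum. Qed.

Lemma comp_mpolyXt n k (t : n.-tuple {mpoly C[k]}) i : 'X_i \mPo t = tnth t i.
Proof. by rewrite comp_mpolyXU (tnth_nth 0). Qed.

Lemma mderiv_comp n k (p : {mpoly C[n]}) (t : n.-tuple {mpoly C[k]}) i :
  (p \mPo t)^`M(i) = \sum_j (p^`M(j) \mPo t) * (tnth t j)^`M(i).
Proof.
have Dmul (a b : {mpoly C[n]}) :
    (a \mPo t)^`M(i) = \sum_j (a^`M(j) \mPo t) * (tnth t j)^`M(i) ->
    (b \mPo t)^`M(i) = \sum_j (b^`M(j) \mPo t) * (tnth t j)^`M(i) ->
    ((a * b) \mPo t)^`M(i) = \sum_j ((a * b)^`M(j) \mPo t) * (tnth t j)^`M(i).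
  move=> Da Db; rewrite rmorphM mderivM Da Db mulr_suml mulr_sumr -big_split.
  by apply: eq_bigr => j _; rewrite /= mderivM rmorphD !rmorphM /=; ring.
have DX j : ('X_j \mPo t)^`M(i) = \sum_l ('X_j^`M(l) \mPo t) * (tnth t l)^`M(i).
  rewrite comp_mpolyXt (bigD1 j) //= big1 => [|l nlj]; last first.
    by rewrite mderivX mnm1E eq_sym (negPf nlj) scale0r rmorph0 mul0r.
  rewrite mderivX mnm1E eqxx scale1r addr0.
  have -> : (U_(j) - U_(j))%MM = 0%MM :> 'X_{1..n} by apply/mnmP=> l; rewrite mnmBE mnm0E subnn.
  by rewrite mpolyX0 rmorph1 mul1r.
have D1 : ((1 : {mpoly C[n]}) \mPo t)^`M(i) = \sum_j ((1 : {mpoly C[n]})^`M(j) \mPo t) * (tnth t j)^`M(i).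
  rewrite rmorph1 -mpolyC1 mderivC big1 // => j _.
  by rewrite -mpolyC1 mderivC rmorph0 mul0r.
elim/mpolyind: p => [|c m p _ _ IH].
  rewrite rmorph0 mderiv0 big1 // => j _; by rewrite mderiv0 rmorph0 mul0r.
rewrite rmorphD /= mderivD IH.
have -> : (c *: 'X_[m] \mPo t)^`M(i) = \sum_j ((c *: 'X_[m])^`M(j) \mPo t) * (tnth t j)^`M(i).
  rewrite comp_mpolyZ mderivZ.
  have -> : ('X_[m] \mPo t)^`M(i) = \sum_j ('X_[m]^`M(j) \mPo t) * (tnth t j)^`M(i).
    pose P (q : {mpoly C[n]}) := (q \mPo t)^`M(i) = \sum_j (q^`M(j) \mPo t) * (tnth t j)^`M(i).
    rewrite -/(P _) mpolyXE_id; apply: big_ind => [||l _]; [exact: D1|exact: Dmul|].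
    elim: (m l) => [|e IHe]; first by rewrite expr0.
    by rewrite exprS; apply: Dmul.
  rewrite scaler_sumr; apply: eq_bigr => j _.
  by rewrite mderivZ comp_mpolyZ scalerAl.
rewrite -big_split; apply: eq_bigr => j _ /=.
by rewrite mderivD rmorphD mulrDl.
Qed.

Definition ev n (p : {mpoly C[n]}) (v : 'cV[C]_n) : C := p.@[fun i => v i 0].

Definition mdir (u : 'cV[C]_3) (p : {mpoly C[3]}) := \sum_(i < 3) u i 0 *: p^`M(i).

Lemma tnth_linsubst (A : 'M[C]_3) j :
  tnth (linsubst A) j = \sum_(l < 3) A j l *: 'X_l.
Proof. by rewrite tnth_mktuple. Qed.

Lemma mderivXU n (i j : 'I_n) : 'X_j^`M(i) = (j == i)%:R :> {mpoly C[n]}.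
Proof.
rewrite mderivX mnm1E; case: eqP => [->|_]; last by rewrite scale0r.
have -> : (U_(i) - U_(i))%MM = 0%MM :> 'X_{1..n} by apply/mnmP=> l; rewrite mnmBE mnm0E subnn.
by rewrite mpolyX0 scale1r.
Qed.

Lemma comp_linsubst (A B : 'M[C]_3) p :
  (p \mPo linsubst A) \mPo linsubst B = p \mPo linsubst (A *m B).
Proof.
apply: (mpoly_morph_ext (f := (comp_mpoly (linsubst B) \o comp_mpoly (linsubst A))%FUN)) p => [c|i] /=.
  by rewrite !comp_mpolyC.
rewrite !comp_mpolyXt !tnth_linsubst raddf_sum /=.
under eq_bigr do rewrite comp_mpolyZ comp_mpolyXt tnth_linsubst scaler_sumr.
rewrite exchange_big /=; apply: eq_bigr => l _.
by rewrite mxE scaler_suml; apply: eq_bigr => k _; rewrite scalerA.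
Qed.

Lemma linsubst1 (p : {mpoly C[3]}) : p \mPo linsubst 1%:M = p.
Proof.
rewrite -[RHS](comp_mpoly_id (R := C) p); congr (_ \mPo _); apply: eq_from_tnth => i.
rewrite tnth_linsubst tnth_mktuple (bigD1 i) //= big1 ?addr0 => [|l nl].
  by rewrite mxE eqxx scale1r.
by rewrite mxE eq_sym (negPf nl) scale0r.
Qed.

Lemma linsubstK (A : 'M[C]_3) p : A \in unitmx ->
  (p \mPo linsubst A) \mPo linsubst (invmx A) = p.
Proof. by move=> uA; rewrite comp_linsubst mulmxV // linsubst1. Qed.

Lemma linsubstVK (A : 'M[C]_3) p : A \in unitmx ->
  (p \mPo linsubst (invmx A)) \mPo linsubst A = p.
Proof. by move=> uA; rewrite comp_linsubst mulVmx // linsubst1. Qed.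

Lemma ev_linsubst (A : 'M[C]_3) p v : ev (p \mPo linsubst A) v = ev p (A *m v).
Proof.
rewrite /ev comp_mpoly_meval; apply: meval_eq => i; rewrite tnth_linsubst mxE rmorph_sum /=.
by apply: eq_bigr => l _; rewrite mevalZ mevalXU.
Qed.

Lemma mderiv_linsubst (A : 'M[C]_3) p i :
  (p \mPo linsubst A)^`M(i) = \sum_j A j i *: (p^`M(j) \mPo linsubst A).
Proof.
rewrite mderiv_comp; apply: eq_bigr => j _; rewrite tnth_linsubst.
have -> : (\sum_(l < 3) A j l *: 'X_l)^`M(i) = A j i *: (1 : {mpoly C[3]}).
  rewrite (raddf_sum (mderiv i)) (bigD1 i) //= big1 => [|l nl].
    by rewrite mderivZ mderivXU eqxx addr0.
  by rewrite mderivZ mderivXU (negPf nl) scaler0.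
by rewrite -scalerAr mulr1.
Qed.

Lemma mdir_linsubst u (A : 'M[C]_3) p :
  mdir u (p \mPo linsubst A) = mdir (A *m u) p \mPo linsubst A.
Proof.
rewrite /mdir rmorph_sum /=; under eq_bigr do rewrite mderiv_linsubst scaler_sumr.
rewrite exchange_big; apply: eq_bigr => j _ /=.
rewrite comp_mpolyZ mxE scaler_suml; apply: eq_bigr => i _.
by rewrite scalerA mulrC.
Qed.

Lemma mdir_zmod u : zmod_morphism (mdir u).
Proof.
move=> p q; rewrite /mdir -sumrB; apply: eq_bigr => i _.
by rewrite mderivB scalerBr.
Qed.
HB.instance Definition _ u := GRing.isZmodMorphism.Build _ _ (mdir u) (mdir_zmod u).

Lemma mdirM u p q : mdir u (p * q) = mdir u p * q + p * mdir u q.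
Proof.
rewrite /mdir mulr_suml mulr_sumr -big_split; apply: eq_bigr => i _ /=.
by rewrite mderivM scalerDr scalerAl scalerAr.
Qed.

Lemma mdirC u c : mdir u c%:MP = 0.
Proof. by rewrite /mdir big1 // => i _; rewrite mderivC scaler0. Qed.

Lemma exists_frame (u : 'cV[C]_3) (i : 'I_3) : u != 0 ->
  exists2 A : 'M[C]_3, A \in unitmx & A *m delta_mx i 0 = u.
Proof.
move=> u0; pose c := (row_ebase u) 0 0.
have c0 : c != 0.
  have : row_ebase u \in unitmx := row_ebase_unit u.
  by rewrite [row_ebase u]mx11_scalar unitmxE det_scalar expr1 unitfE.
(* [u] has rank one, so it is the first column of [col_ebase] times the scalar [c]; the
   transposition moves that column to position [i]. *)
pose A := c *: (col_ebase u *m tperm_mx 0 i).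
exists A; first by rewrite unitmxZ ?unitfE // unitmx_mul col_ebase_unit unitmx_perm.
have rk : \rank u = 1%N.
  apply/eqP; rewrite eqn_leq rank_leq_col lt0n mxrank_eq0.
  exact: u0.
rewrite /A -scalemxAl -mulmxA -[RHS]mulmx_ebase rk [X in _ = _ *m X]mx11_scalar -/c mul_mx_scalar.
congr (_ *: (_ *m _)); apply/matrixP=> k l; rewrite !mxE (bigD1 i) //= big1.
  rewrite !mxE !ord1 !eqxx mulr1 addr0 (can2_eq (tpermK 0 i) (tpermK 0 i)) tpermR -val_eqE /=.
  by case: (k : nat).
by move=> j nj; rewrite !mxE (negPf nj) mulr0.
Qed.

End Substitution.

(** * Homogeneous components and degrees *)

Section Homogeneous.
Variable C : fieldType.
Variable n : nat.
Implicit Types p q : {mpoly C[n]}.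
Local Notation hom k := (pihomog mdeg k).

Lemma mcoeff_pihomog k p m : (hom k p)@_m = if mdeg m == k then p@_m else 0.
Proof.
elim/mpolyind: p => [|c m' p _ _ IH].
  by rewrite raddf0 !mcoeff0 if_same.
rewrite raddfD /= linearZ /= pihomogX !mcoeffD IH mcoeffZ.
rewrite [(c *: (if _ then _ else _))@_m]mcoeffZ.
case: (mdeg m' =P k) => [E|E]; rewrite ?mcoeffX ?mcoeff0.
  case: (m' =P m) => [<-|_]; first by rewrite E eqxx.
  by rewrite mulr0; case: ifP; rewrite !add0r.
case: (m' =P m) => [Em|_]; last by rewrite mulr0; case: ifP; rewrite !add0r.
by rewrite -Em; case: eqP E => //; rewrite mulr0 addr0.
Qed.

Lemma pihomogM_homog k e p q : q \is e.-homog ->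
  hom k (p * q) = if (e <= k)%N then hom (k - e) p * q else 0.
Proof.
move=> hq; elim/mpolyind: p => [|c m p _ _ IH].
  by rewrite !mul0r !raddf0 mul0r if_same.
rewrite mulrDl !raddfD /= IH.
have hm : c *: 'X_[m] * q \is (mdeg m + e).-homog.
  by apply: dhomogM => //; apply: rpredZ; rewrite dhomogX.
have -> : hom k (c *: 'X_[m] * q) = if (e <= k)%N then hom (k - e) (c *: 'X_[m]) * q else 0.
  case: (mdeg m + e =P k)%N => [<-|ne].
    rewrite pihomog_dE // leq_addl addnK pihomog_dE //.
    by apply: rpredZ; rewrite dhomogX.
  rewrite (pihomog_ne0 (introN eqP ne) hm); case: ifP => // le.
  rewrite linearZ /= pihomogX; case: eqP => [E|]; last by rewrite scaler0 mul0r.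
  by case: ne; rewrite E subnK.
by case: ifP; rewrite ?mulrDl ?addr0.
Qed.

Lemma mderiv_pihomog k i p : (hom k.+1 p)^`M(i) = hom k p^`M(i).
Proof.
apply/mpolyP=> m; rewrite !(mcoeff_deriv, mcoeff_pihomog). rewrite mdegD mdeg1 addn1 eqSS.
by case: ifP; rewrite ?mul0rn.
Qed.

Lemma mderiv_homog d i p : p \is d.-homog -> p^`M(i) \is d.-1.-homog.
Proof.
case: d => [|d] hp; last by rewrite -(pihomog_dE hp) mderiv_pihomog pihomogP.
apply/dhomogP=> m; rewrite mcoeff_msupp mcoeff_deriv.
have ne0 : mdeg (m + U_(i))%MM != 0%N by rewrite mdegD mdeg1 addn1.
by rewrite (dhomog_nemf_coeff hp ne0) mul0rn eqxx.
Qed.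

Lemma pihomog_eq0 p : (forall k, hom k p = 0) -> p = 0.
Proof.
by move=> h; apply/mpolyP=> m; have := congr1 (mcoeff m) (h (mdeg m));
  rewrite mcoeff_pihomog eqxx mcoeff0.
Qed.

End Homogeneous.

Section Degrees.
Variable C : fieldType.
Local Notation hom k := (pihomog mdeg k).

Lemma msize_leP n (p : {mpoly C[n]}) k :
  (msize p <= k)%N <-> forall j, (k <= j)%N -> hom j p = 0.
Proof.
split=> [le_pk j le_kj|h].
  apply/mpolyP=> m; rewrite mcoeff_pihomog mcoeff0; case: eqP => // E.
  by rewrite memN_msupp_eq0 //; apply: msize_mdeg_ge; rewrite E (leq_trans le_pk).
rewrite msizeE; apply/bigmax_leqP_seq => m ms _; rewrite ltnNge; apply/negP=> le_km.
have := congr1 (mcoeff m) (h _ le_km); rewrite mcoeff_pihomog eqxx mcoeff0.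
by move/eqP; rewrite mcoeff_eq0 ms.
Qed.

Lemma homog_sum n (p : {mpoly C[n]}) k : (msize p <= k)%N -> p = \sum_(d < k) hom d p.
Proof. by move=> le; apply: pihomog_partitionE. Qed.

Lemma pihomogM n (p q : {mpoly C[n]}) k :
  hom k (p * q) = \sum_(e < k.+1) hom (k - e) p * hom e q.
Proof.
pose N := maxn (msize q) k.+1.
rewrite {1}(@homog_sum _ q N) ?leq_maxl // mulr_sumr raddf_sum /=.
under eq_bigr do rewrite (pihomogM_homog _ _ (pihomogP _ _ _)).
rewrite (big_ord_widen_cond N xpredT (fun e => hom (k - e) p * hom e q)) ?leq_maxr //.
by rewrite [RHS]big_mkcond; apply: eq_bigr => e _ /=; rewrite ltnS.
Qed.

(** The lowest components of [p] and [q] multiply to a nonzero component of the product, and so do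
    the highest; both pairs of degrees add up to [d], hence lowest and highest degree agree. *)
Lemma homog_factor n (p q : {mpoly C[n]}) d : p * q != 0 -> p * q \is d.-homog ->
  exists e, p \is e.-homog.
Proof.
rewrite mulf_eq0 negb_or => /andP[p0 q0] hpq.
have lowest (r : {mpoly C[n]}) : r != 0 -> exists a, hom a r != 0 /\ forall k, (k < a)%N -> hom k r = 0.
  move=> r0; have [|a [/eqP ra mina]] := @ex_minimal (fun a => hom a r <> 0).
    apply/boolp.existsNP => h; move/eqP: r0; apply.
    by apply: pihomog_eq0.
  by exists a; split=> // k /mina /boolp.contrapT.
have highest (r : {mpoly C[n]}) : r != 0 -> hom (msize r).-1 r != 0 /\ forall k, ((msize r).-1 < k)%N -> hom k r = 0.
  move=> r0; have szr : msize r = (msize r).-1.+1 by rewrite mpolySpred.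
  split; last by move=> k lt; have /msize_leP := leqnn (msize r); apply; rewrite szr.
  apply: contraTneq (leqnn (msize r)) => h; rewrite -ltnNge {2}szr ltnS.
  apply/msize_leP=> j; rewrite leq_eqVlt => /orP[/eqP<-//|lt].
  by have /msize_leP := leqnn (msize r); apply; rewrite szr.
have [a [pa mina]] := lowest _ p0; have [b [qb minb]] := lowest _ q0.
have [pA maxa] := highest _ p0; have [qB maxb] := highest _ q0.
set A := (msize p).-1 in pA maxa; set B := (msize q).-1 in qB maxb.
have conv i j : (forall e, (e <= i + j)%N -> e != j -> hom (i + j - e) p * hom e q = 0) ->
    hom (i + j) (p * q) = hom i p * hom j q.
  move=> h; have lt : (j < (i + j).+1)%N by rewrite ltnS leq_addl.
  rewrite pihomogM (bigD1 (Ordinal lt)) //= addnK big1 ?addr0 // => e ne.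
  by apply: h => //; rewrite -ltnS.
have deg i j : hom i p != 0 -> hom j q != 0 ->
    (forall e, (e <= i + j)%N -> e != j -> hom (i + j - e) p * hom e q = 0) ->
    (i + j)%N = d.
  move=> pi qj h; have E := conv _ _ h; apply/eqP; apply: contraT; rewrite eq_sym => ne.
  by move/esym/eqP: E; rewrite (pihomog_ne0 ne hpq) mulf_eq0 (negPf pi) (negPf qj).
have dab : (a + b)%N = d.
  apply: deg => // e le neb; have [lt|le'] := ltnP e b; first by rewrite minb ?mulr0.
  by rewrite mina ?mul0r //; lia.
have dAB : (A + B)%N = d.
  apply: deg => // e le neb; have [lt|le'] := ltnP B e; first by rewrite maxb ?mulr0.
  by rewrite maxa ?mul0r //; lia.
have leaA : (a <= A)%N by rewrite leqNgt; apply: contra pA => /mina->.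
have lebB : (b <= B)%N by rewrite leqNgt; apply: contra qB => /minb->.
have aA : a = A by lia.
exists a; rewrite homog_piE; apply/eqP/mpolyP=> m; rewrite mcoeff_pihomog.
case: eqP => // /eqP; rewrite neq_ltn => /orP[lt|lt].
  by have := congr1 (mcoeff m) (mina _ lt); rewrite mcoeff_pihomog eqxx mcoeff0.
by have := congr1 (mcoeff m) (maxa _ (leq_ltn_trans (eq_leq (esym aA)) lt)); rewrite mcoeff_pihomog eqxx mcoeff0.
Qed.

Lemma dhomog_comp n k d (p : {mpoly C[n]}) (t : n.-tuple {mpoly C[k]}) :
  (forall i, tnth t i \is 1.-homog) -> p \is d.-homog -> p \mPo t \is d.-homog.
Proof.
move=> ht hp; rewrite comp_mpolyEX big_seq_cond; apply: rpred_sum => m /andP[ms _].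
apply: rpredZ; have E : mdeg m = d := dhomog_mf hp ms.
rewrite -E comp_mpolyX mdegE.
elim/big_ind2: _ => [|x1 x2 y1 y2|i _]; [exact: dhomog1|by move=> h1 h2; apply: dhomogM|].
by have := dhomogMn (m i) (ht i); rewrite mul1n.
Qed.

Lemma tnth_linsubst_homog (A : 'M[C]_3) i : tnth (linsubst A) i \is 1.-homog.
Proof.
rewrite tnth_linsubst; apply: rpred_sum => l _; apply: rpredZ.
by rewrite dhomogX; apply/eqP; exact: mdeg1.
Qed.

Lemma dhomog_linsubst (A : 'M[C]_3) d p : p \is d.-homog -> p \mPo linsubst A \is d.-homog.
Proof. exact/dhomog_comp/tnth_linsubst_homog. Qed.

Lemma pihomog_linsubst (A : 'M[C]_3) d p :
  hom d (p \mPo linsubst A) = hom d p \mPo linsubst A.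
Proof.
rewrite {1}(homog_sum (leqnn (msize p))) (raddf_sum (comp_mpoly (linsubst A))).
rewrite (raddf_sum (hom d)) /=.
have [lt|le] := ltnP d (msize p).
  rewrite (bigD1 (Ordinal lt)) //= big1 ?addr0 => [|k nk].
    by rewrite pihomog_dE // dhomog_linsubst ?pihomogP.
  by rewrite (@pihomog_ne0 _ _ _ k) ?dhomog_linsubst ?pihomogP.
have /msize_leP := leqnn (msize p) => -> //; rewrite raddf0 big1 // => k _.
rewrite (@pihomog_ne0 _ _ _ k) ?dhomog_linsubst ?pihomogP //.
by rewrite neq_ltn (leq_trans (ltn_ord k) le).
Qed.

Lemma msize_linsubst (A : 'M[C]_3) p : (msize (p \mPo linsubst A) <= msize p)%N.
Proof.
apply/msize_leP => j le; rewrite pihomog_linsubst.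
by have /msize_leP := leqnn (msize p) => -> //; rewrite raddf0.
Qed.

Lemma msize_linsubst_unit (A : 'M[C]_3) p : A \in unitmx ->
  msize (p \mPo linsubst A) = msize p.
Proof.
move=> uA; apply/eqP; rewrite eqn_leq msize_linsubst /=.
by rewrite -{1}(linsubstK p uA) msize_linsubst.
Qed.

Lemma linsubst_eq0 (A : 'M[C]_3) p : A \in unitmx -> (p \mPo linsubst A == 0) = (p == 0).
Proof. by move=> uA; rewrite -!msize_poly_eq0 msize_linsubst_unit. Qed.

Lemma mcoprime_linsubst (A : 'M[C]_3) p q : A \in unitmx -> mcoprime p q ->
  mcoprime (p \mPo linsubst A) (q \mPo linsubst A).
Proof.
move=> uA cop d [a pd] [b qd]; rewrite -(@msize_linsubst_unit (invmx A)) ?unitmx_inv //.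
apply: cop; [exists (a \mPo linsubst (invmx A))|exists (b \mPo linsubst (invmx A))].
  by rewrite -comp_mpolyM -pd linsubstK.
by rewrite -comp_mpolyM -qd linsubstK.
Qed.

Lemma mdir_delta i (p : {mpoly C[3]}) : mdir (delta_mx i 0) p = p^`M(i).
Proof.
rewrite /mdir (bigD1 i) //= big1 ?addr0 => [|j nj]; first by rewrite mxE !eqxx scale1r.
by rewrite mxE (negPf nj) scale0r.
Qed.

Lemma eliminate (u : 'cV[C]_3) (g h : {mpoly C[3]}) : u != 0 -> g != 0 -> mcoprime g h ->
  exists A B, A * g + B * h != 0 /\ mdir u (A * g + B * h) = 0.
Proof.
move=> u0 g0 cop; have [M uM Mu] := exists_frame ord_max u0.
have := @eliminate_last _ (g \mPo linsubst M) (h \mPo linsubst M).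
rewrite linsubst_eq0 // => /(_ g0 (mcoprime_linsubst uM cop)) [A [B [r0 dr]]].
set r := A * _ + _ in r0 dr.
have rE : (A \mPo linsubst (invmx M)) * g + (B \mPo linsubst (invmx M)) * h =
    r \mPo linsubst (invmx M) by rewrite comp_mpolyD !comp_mpolyM !linsubstK.
exists (A \mPo linsubst (invmx M)), (B \mPo linsubst (invmx M)); rewrite rE.
rewrite linsubst_eq0 ?unitmx_inv //; split=> //.
by rewrite mdir_linsubst -Mu mulmxA mulVmx // mul1mx mdir_delta dr raddf0.
Qed.

Lemma mdir_pihomog u k (p : {mpoly C[3]}) : mdir u (hom k.+1 p) = hom k (mdir u p).
Proof.
rewrite /mdir raddf_sum; apply: eq_bigr => i _ /=.
by rewrite linearZ /= mderiv_pihomog.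
Qed.

Lemma homog0_const n (p : {mpoly C[n]}) : p \is 0.-homog -> exists c, p = c%:MP.
Proof.
move=> h; apply/msize_le1P/msize_leP => j le; apply: (pihomog_ne0 _ h).
by rewrite neq_ltn (leq_trans _ le).
Qed.

(** Any nonzero homogeneous component of the combination is again a combination, because [g] and [h]
    are homogeneous, and it is still constant along [u]. *)
Lemma eliminate_homog (u : 'cV[C]_3) d e (g h : {mpoly C[3]}) : u != 0 -> g != 0 ->
  g \is d.-homog -> h \is e.-homog -> mcoprime g h ->
  exists A B k, [/\ A * g + B * h != 0, mdir u (A * g + B * h) = 0
                  & A * g + B * h \is k.-homog].
Proof.
move=> u0 g0 hg hh cop; have [A [B [r0 dr]]] := eliminate u0 g0 cop.
have [k rk] : exists k, hom k (A * g + B * h) != 0.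
  apply: boolp.contrapT => no; move/eqP: r0; apply; apply: pihomog_eq0 => k.
  by apply/eqP; apply: boolp.contrapT => /negP ?; apply: no; exists k.
have rkE : hom k (A * g + B * h) =
   (if (d <= k)%N then hom (k - d) A else 0) * g + (if (e <= k)%N then hom (k - e) B else 0) * h.
  rewrite raddfD /= (pihomogM_homog _ _ hg) (pihomogM_homog _ _ hh).
  by congr (_ + _); case: ifP => _; rewrite ?mul0r.
exists (if (d <= k)%N then hom (k - d) A else 0), (if (e <= k)%N then hom (k - e) B else 0), k.
rewrite -rkE; split=> //; last exact: pihomogP.
case: k {rk rkE} => [|k]; last by rewrite mdir_pihomog dr raddf0.
by have [c ->] := homog0_const (pihomogP mdeg 0%N (A * g + B * h)); rewrite mdirC.
Qed.

End Degrees.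

(** * Irreducible polynomials and coprimality *)

Section Irreducible.
Variable C : fieldType.
Implicit Types psi phi p q : {mpoly C[3]}.

Lemma mirreducible_neq0 psi : mirreducible psi -> psi != 0.
Proof. by move=> [lt _]; rewrite -msize_poly_eq0 -lt0n (ltn_trans _ lt). Qed.

Lemma mulCV_mpoly (c : C) p q : c != 0 -> p * c%:MP * (c^-1 *: q) = p * q.
Proof. by move=> c0; rewrite -mulrA mul_mpolyC scalerA mulfV // scale1r. Qed.

Lemma irreducible_coprime psi q : mirreducible psi -> ~ mdvd psi q -> mcoprime psi q.
Proof.
move=> irr nd d [a psid] [b qd]; have [//|/msize_le1P[c ac]] := irr.2 _ _ psid.
case: nd; exists (c^-1 *: b).
have c0 : c != 0.
  by apply: contraTneq (mirreducible_neq0 irr) => c0; rewrite negbK psid ac c0 mulr0.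
by rewrite psid ac mulCV_mpoly.
Qed.

(** An irreducible polynomial is a constant multiple of the first prime in its factorization, so it
    inherits primality. *)
Lemma irreducible_euclid psi p q : mirreducible psi -> mdvd psi (p * q) ->
  mdvd psi p \/ mdvd psi q.
Proof.
move=> irr; have [s [u [uu ps psiE]]] := factorial_mpoly (mirreducible_neq0 irr).
case: s ps psiE => [|a s] ps psiE.
  exfalso; move: irr.1; rewrite psiE big_nil mulr1.
  have /unitrP[v [vu _]] := uu.
  have : u * v != 0 by rewrite mulrC vu oner_eq0.
  rewrite mulf_eq0 negb_or => /andP[u0 v0].
  move: (msizeM u0 v0); rewrite mulrC vu msize1.
  move: u0 v0; rewrite -!msize_poly_eq0.
  by move: (msize u) (msize v) => x y; lia.
have [a0 nua pra] : prime_elt a by apply: ps; rewrite mem_head.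
rewrite big_cons in psiE.
have [t [psit tunit]] : exists t, psi = a * t /\ exists c, t = c%:MP.
  exists (u * \prod_(j <- s) j); split; first by rewrite psiE mulrCA.
  have [/msize_le1P[c aC]|/msize_le1P//] : (msize a <= 1)%N \/ (msize (u * \prod_(j <- s) j) <= 1)%N.
    by apply: irr.2; rewrite psiE mulrCA.
  case/negP: nua; rewrite aC rmorph_unit // unitfE.
  by apply: contraNneq a0 => c0; rewrite aC c0.
have [c tc] := tunit.
have c0 : c != 0.
  by apply: contraTneq (mirreducible_neq0 irr) => c0; rewrite negbK psit tc c0 mulr0.
have back x : divides a x -> mdvd psi x.
  move=> [y ->]; exists (c^-1 *: y); rewrite psit tc.
  by rewrite mulCV_mpoly.
move=> [w pq]; have /pra[/back|/back] : divides a (p * q); [|by left|by right].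
by exists (t * w); rewrite pq psit mulrA.
Qed.

Lemma irreducible_factor d p : p \is d.-homog -> (1 < msize p)%N ->
  exists psi q, [/\ mirreducible psi, mhomogeneous psi & p = psi * q].
Proof.
have [n] := ubnP (msize p); elim: n d p => // n IH d p lt_n hp lt1.
have [irr|] := boolp.EM (mirreducible p).
  by exists p, 1; rewrite mulr1; split=> //; exists d.
move=> /boolp.not_andP[//|/boolp.existsNP[q /boolp.existsNP[r /boolp.not_implyP[pqr]]]].
move=> /boolp.not_orP[/negP]; rewrite -ltnNge => ltq /negP; rewrite -ltnNge => ltr.
have p0 : q * r != 0 by rewrite -pqr -msize_poly_eq0 -lt0n (ltn_trans _ lt1).
have [e hq] : exists e, q \is e.-homog by apply: (@homog_factor _ _ _ r d) => //; rewrite -pqr.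
have ltqn : (msize q < n)%N.
  move: p0; rewrite mulf_eq0 negb_or => /andP[q0 r0].
  move: (msizeM q0 r0) lt_n ltq ltr; rewrite -pqr.
  by move: (msize p) (msize q) (msize r) => x y z; lia.
have [psi [s [irr hpsi qE]]] := IH e q ltqn hq ltq.
by exists psi, (s * r); rewrite pqr qE mulrA.
Qed.

End Irreducible.

Lemma exchange_sum (V : zmodType) (I J : finType) (G : I -> J -> V) :
  \sum_i \sum_j G i j = \sum_j \sum_i G i j.
Proof. exact: exchange_big. Qed.

(** * Semi-invariants and their highest forms *)

Section VectorFields.
Variable C : numFieldType.
Implicit Types (f : vfield C) (g p q psi : {mpoly C[3]}).
Local Notation hom k := (pihomog mdeg k).

Lemma hpartE d p : hpart d p = hom d p. Proof. by []. Qed.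

Lemma XderM f p q : Xder f (p * q) = Xder f p * q + p * Xder f q.
Proof.
rewrite /Xder mulr_suml mulr_sumr -big_split; apply: eq_bigr => i _ /=.
by rewrite mderivM; ring.
Qed.

Lemma Xder_zmod f : zmod_morphism (Xder f).
Proof.
by move=> p q; rewrite /Xder -sumrB; apply: eq_bigr => i _; rewrite mderivB mulrBr.
Qed.
HB.instance Definition _ f := GRing.isZmodMorphism.Build _ _ (Xder f) (Xder_zmod f).

Lemma XderX f p k : Xder f (p ^+ k.+1) = k.+1%:R * p ^+ k * Xder f p.
Proof.
elim: k => [|k IH]; first by rewrite expr1 expr0 !mul1r.
by rewrite exprS XderM IH exprS -[k.+2%:R]natr1; ring.
Qed.

Lemma Xder_conj (T : 'M[C]_3) f g : T \in unitmx ->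
  Xder (conjvf T f) (g \mPo linsubst (invmx T)) = Xder f g \mPo linsubst (invmx T).
Proof.
move=> uT; rewrite /Xder (raddf_sum (comp_mpoly (linsubst (invmx T)))) /=.
under eq_bigr do rewrite mderiv_linsubst mulr_sumr.
rewrite exchange_sum; apply: eq_bigr => j _; rewrite comp_mpolyM.
under eq_bigr do rewrite -scalerAr scalerAl.
rewrite -mulr_suml; congr (_ * _); rewrite /conjvf.
under eq_bigr do rewrite scaler_sumr.
rewrite exchange_sum.
have E k : \sum_i invmx T j i *: (T i k *: (f k \mPo linsubst (invmx T)))
    = (j == k)%:R *: (f k \mPo linsubst (invmx T)).
  under eq_bigr do rewrite scalerA.
  rewrite -scaler_suml; congr (_ *: _).
  have e := congr1 (fun A : 'M_3 => A j k) (mulVmx uT). by move: e; rewrite !mxE => e; exact: e.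
transitivity (\sum_k (j == k)%:R *: (f k \mPo linsubst (invmx T))); first by apply: eq_bigr => k _; exact: E.
rewrite (bigD1 j) //= big1 => [|k nk].
  by rewrite addr0 eqxx scale1r.
by rewrite eq_sym (negPf nk) scale0r.
Qed.

(** Write g = psi^(k+1) q with [psi] not dividing [q]. The equation for [g] then shows that [psi]
    divides (k+1) X(psi) q, and k + 1 is invertible in characteristic 0. *)
Lemma irreducible_Xder_factor f psi g : mirreducible psi -> mdvd psi g -> g != 0 ->
  (exists lam, Xder f g = lam * g) -> semi_invariant f psi.
Proof.
move=> irr [q0 gE] g0 [lam Xg]; split; first exact: irr.1.
have psi0 := mirreducible_neq0 irr.
have [k [q [gk ndq]]] : exists k q, g = psi ^+ k.+1 * q /\ ~ mdvd psi q.
  have : exists k, psi ^+ k.+1 * q0 = g /\ True by exists 0%N; rewrite expr1 gE.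
  have step k q : g = psi ^+ k.+1 * q -> exists k q, g = psi ^+ k.+1 * q /\ ~ mdvd psi q.
    have [n] := ubnP (msize q); elim: n k q => // n IH k q lt gk.
    have [[r qr]|nd] := boolp.EM (mdvd psi q); last by exists k, q.
    have r0 : r != 0 by apply: contraNneq g0 => r0; rewrite gk qr r0 !mulr0.
    apply: (IH k.+1 r); last by rewrite gk qr mulrA [in RHS]exprSr.
    move: (msizeM psi0 r0) (irr.1) lt; rewrite -qr.
    by move: (msize q) (msize psi) (msize r) => x y z; lia.
  by move=> _; apply: (step 0%N q0); rewrite expr1.
have : mdvd psi (Xder f psi * (k.+1%:R *: q)).
  exists (lam * q - Xder f q); apply: (@mulfI _ (psi ^+ k)); first exact: expf_neq0.
  have := Xg; rewrite gk XderM XderX => e.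
  have -> : psi ^+ k * (Xder f psi * (k.+1%:R *: q)) = k.+1%:R * psi ^+ k * Xder f psi * q.
    by rewrite -[_ *: q]mul_mpolyC mpolyC_nat; ring.
  by rewrite -[LHS](addrK (psi ^+ k.+1 * Xder f q)) e exprSr; ring.
case/(irreducible_euclid irr) => [[l e]|[l e]]; first by exists l; rewrite e mulrC.
case: ndq; exists (k.+1%:R^-1 *: l).
by rewrite -scalerAr -e scalerA mulVf ?scale1r // pnatr_eq0.
Qed.

Lemma msizeM_leS n (p q : {mpoly C[n]}) a b : (msize p <= a.+1)%N -> (msize q <= b.+1)%N ->
  (msize (p * q) <= (a + b).+1)%N.
Proof.
have [->|p0] := eqVneq p 0; first by rewrite mul0r msize0.
have [->|q0] := eqVneq q 0; first by rewrite mulr0 msize0.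
by rewrite msizeM //; move: (msize p) (msize q) => x y; lia.
Qed.

Lemma top_mul n (p q : {mpoly C[n]}) a b : (msize p <= a.+1)%N -> (msize q <= b.+1)%N ->
  hom (a + b) (p * q) = hom a p * hom b q.
Proof.
move=> /msize_leP hp /msize_leP hq; have lt : (b < (a + b).+1)%N by rewrite ltnS leq_addl.
rewrite pihomogM (bigD1 (Ordinal lt)) //= addnK big1 ?addr0 // => e ne.
have [ltbe|leeb] := ltnP b e; first by rewrite (hq e) ?mulr0.
rewrite hp ?mul0r //; move: ne; rewrite -val_eqE /=; lia.
Qed.

Lemma msize_mderiv n (p : {mpoly C[n]}) i d : (msize p <= d.+1)%N -> (msize p^`M(i) <= d)%N.
Proof.
by move=> /msize_leP h; apply/msize_leP => j le; rewrite -mderiv_pihomog h ?raddf0.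
Qed.

Lemma msize_sum_le n (I : Type) (r : seq I) (P : pred I) (F : I -> {mpoly C[n]}) k :
  (forall i, P i -> msize (F i) <= k)%N -> (msize (\sum_(i <- r | P i) F i) <= k)%N.
Proof.
move=> h; apply/msize_leP=> j le; rewrite raddf_sum big1 //= => i Pi.
by have /msize_leP -> := h i Pi.
Qed.

Lemma msize_Xder f g m D : (forall i, msize (f i) <= m.+1)%N -> (msize g <= D.+2)%N ->
  (msize (Xder f g) <= (m + D).+1)%N.
Proof. by move=> hf hg; apply: msize_sum_le => i _; apply: msizeM_leS => //; apply: msize_mderiv. Qed.

Lemma top_Xder f g m D : (forall i, msize (f i) <= m.+1)%N -> (msize g <= D.+2)%N ->
  hom (m + D) (Xder f g) = Xder (vhpart m f) (hom D.+1 g).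
Proof.
move=> hf hg; rewrite raddf_sum; apply: eq_bigr => i _ /=.
by rewrite top_mul ?msize_mderiv // mderiv_pihomog.
Qed.

Lemma msize_cofactor f g lam m : (forall i, msize (f i) <= m.+1)%N -> (1 < msize g)%N ->
  Xder f g = lam * g -> (msize lam <= m)%N.
Proof.
move=> hf lt1 e; have [->|l0] := eqVneq lam 0; first by rewrite msize0.
have g0 : g != 0 by rewrite -msize_poly_eq0 -lt0n (ltn_trans _ lt1).
have := @msize_Xder f g m (msize g).-2 hf; rewrite e msizeM //.
by move: lt1; move: (msize g) (msize lam) => x y; lia.
Qed.

Lemma msize_hom n (p : {mpoly C[n]}) d : p \is d.-homog -> p != 0 -> msize p = d.+1.
Proof.
move=> hp p0; have h := dhomog_msize hp; have := dhomog_uniq p0 hp h.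
by move=> ->; rewrite prednK // lt0n msize_poly_eq0.
Qed.

Lemma top_neq0 n (p : {mpoly C[n]}) : p != 0 -> hom (msize p).-1 p != 0.
Proof.
move=> r0; have szr : msize p = (msize p).-1.+1 by rewrite mpolySpred.
apply: contraTneq (leqnn (msize p)) => h; rewrite -ltnNge {2}szr ltnS.
apply/msize_leP=> j; rewrite leq_eqVlt => /orP[/eqP<-//|lt].
by have /msize_leP := leqnn (msize p); apply; rewrite szr.
Qed.

Lemma semi_invariant_top f g m : (forall i, msize (f i) <= m.+1)%N -> semi_invariant f g ->
  semi_invariant (vhpart m f) (hom (msize g).-1 g).
Proof.
move=> hf [lt1 [lam Xg]]; have g0 : g != 0 by rewrite -msize_poly_eq0 -lt0n (ltn_trans _ lt1).
have szl := msize_cofactor hf lt1 Xg.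
have [D szg] : exists D, msize g = D.+2 by move: lt1; case: (msize g) => [|[|D]] // _; exists D.
split; first by rewrite (msize_hom (pihomogP _ _ _)) ?top_neq0 // szg.
(* For m = 0 the cofactor is 0; otherwise the cofactor of the highest form is the component of [lam]
   of degree m - 1. *)
rewrite szg /= -top_Xder ?szg // Xg; case: m hf szl => [|m] hf szl.
  by exists 0; move: szl; rewrite leqn0 msize_poly_eq0 => /eqP->; rewrite !mul0r raddf0.
by exists (hom m lam); rewrite addSnnS top_mul ?szg.
Qed.

Lemma poly_nonroot (p : {poly C}) : p != 0 -> exists x, p.[x] != 0.
Proof.
move=> p0; apply: boolp.contrapT => no.
have := @max_poly_roots _ p [seq i%:R | i <- iota 0 (size p)] p0.
rewrite size_map size_iota ltnn map_inj_uniq ?iota_uniq => [h|i j /eqP]; last first.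
  by rewrite eqr_nat => /eqP.
suff /h/(_ isT) : all (root p) [seq i%:R | i <- iota 0 (size p)] by [].
apply/allP => x _; apply/eqP; apply: boolp.contrapT => px; apply: no; exists x; exact/eqP.
Qed.

Lemma mpoly_nonzero_point n (p : {mpoly C[n]}) : p != 0 -> exists v, p.@[v] != 0.
Proof.
elim: n p => [|n IH] p p0.
  have e := nvar0_mpolyC p; exists (fun=> 0); rewrite e mevalC.
  by apply: contraNneq p0 => e0; rewrite e e0.
have mp0 : muni p != 0 by rewrite -(raddf0 (@muni n C)) (can_eq (@muniK C n)).
have [v vk] := IH (lead_coef (muni p)) ltac:(by rewrite lead_coef_eq0).
have mv0 : map_poly (meval v) (muni p) != 0.
  by apply: contraNneq vk => e; rewrite lead_coefE -coef_map e coef0.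
have [x px] := poly_nonroot mv0.
exists (fun i => if unlift ord_max i is Some j then v j else x).
set w := fun i => _; suff -> : p.@[w] = (map_poly (meval v) (muni p)).[x] by [].
have wmax : w ord_max = x by rewrite /w unlift_none.
have ww i : w (widen_ord (leqnSn n) i) = v i.
  have -> : widen_ord (leqnSn n) i = lift ord_max i.
    by apply/val_inj; rewrite /= /bump leqNgt ltn_ord.
  by rewrite /w liftK.
have W (c : {mpoly C[n]}) : (mwiden c).@[w] = c.@[v].
  apply: (mpoly_morph_ext (f := (meval w \o @mwiden n C)%FUN) (g := meval v)) => [a|i] /=.
    by rewrite mwidenC !mevalC.
  by rewrite mwidenX mnmwiden1 !mevalXU ww.
rewrite -{1}[p](@muniK C n) /of_muni -wmax -(mevalXU w) -horner_map /=.
by rewrite -map_poly_comp mevalXU; congr (_.[_]); apply: eq_map_poly => c /=.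
Qed.

(** The source of the general-position choices below: finitely many conditions, each the
    nonvanishing of a nonzero polynomial, hold together at some point. *)
Lemma common_nonzero_point n (s : seq {mpoly C[n]}) : all (fun r => r != 0) s ->
  exists v : 'cV[C]_n, forall r, r \in s -> ev r v != 0.
Proof.
move=> /allP hs; have : \prod_(r <- s) r != 0.
  by rewrite prodf_seq_neq0; apply/allP => p /hs.
move=> /mpoly_nonzero_point[v]; rewrite rmorph_prod prodf_seq_neq0 => /allP hv.
exists (\col_i v i) => p /hv; rewrite /ev; congr (_ != _); apply: meval_eq => i.
by rewrite mxE.
Qed.

End VectorFields.

(** * Formal branches of a diagonal singularity *)

Section Order.
Variable C : fieldType.

(** Order of vanishing at the origin. Formal power series are replaced by polynomials known up to
    order [N], for each [N]. *)
Definition ordge n N (p : {mpoly C[n]}) := forall m, (mdeg m < N)%N -> p@_m = 0.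

Section Basic.
Variable n : nat.
Implicit Types p q : {mpoly C[n]}.

Lemma ordge_leq N M p : (N <= M)%N -> ordge M p -> ordge N p.
Proof. by move=> le h m lt; apply: h; apply: leq_trans le. Qed.

Lemma ordge0 N : ordge N (0 : {mpoly C[n]}).
Proof. by move=> m _; rewrite mcoeff0. Qed.

Lemma ordge_all p : ordge 0 p. Proof. by []. Qed.

Lemma ordgeD N p q : ordge N p -> ordge N q -> ordge N (p + q).
Proof. by move=> hp hq m lt; rewrite mcoeffD hp // hq // addr0. Qed.

Lemma ordgeN N p : ordge N p -> ordge N (- p).
Proof. by move=> hp m lt; rewrite mcoeffN hp // oppr0. Qed.

Lemma ordgeB N p q : ordge N p -> ordge N q -> ordge N (p - q).
Proof. by move=> hp hq; apply: ordgeD => //; apply: ordgeN. Qed.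

Lemma ordge_sum N (I : Type) (r : seq I) (P : pred I) (F : I -> {mpoly C[n]}) :
  (forall i, P i -> ordge N (F i)) -> ordge N (\sum_(i <- r | P i) F i).
Proof. by move=> h; apply: big_ind => //; [exact: ordge0|exact: ordgeD]. Qed.

Lemma ordgeM a b p q : ordge a p -> ordge b q -> ordge (a + b) (p * q).
Proof.
move=> hp hq m lt; rewrite mcoeffM big1 // => -[k1 k2] /= /eqP mE.
have := congr1 mdeg mE; rewrite mdegD => md.
have [lt1|le1] := ltnP (mdeg k1) a; first by rewrite hp // mul0r.
by rewrite (hq k2) ?mulr0 // -(ltn_add2l (mdeg k1)) -md (leq_trans lt) // leq_add2r.
Qed.

Lemma ordgeMl N p q : ordge N q -> ordge N (p * q).
Proof. by move=> hq; rewrite -[N]add0n; apply: ordgeM => //; apply: ordge_all. Qed.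

Lemma ordgeMr N p q : ordge N p -> ordge N (p * q).
Proof. by move=> hq; rewrite mulrC; apply: ordgeMl. Qed.

Lemma ordgeZ N c p : ordge N p -> ordge N (c *: p).
Proof. by rewrite -mul_mpolyC; apply: ordgeMl. Qed.

Lemma ordge_deriv N i p : ordge N.+1 p -> ordge N p^`M(i).
Proof. by move=> hp m lt; rewrite mcoeff_deriv hp ?mul0rn // mdegD mdeg1 addn1. Qed.

Lemma ordgeX m N : (N <= mdeg m)%N -> ordge N ('X_[m] : {mpoly C[n]}).
Proof.
by move=> le m' lt; rewrite mcoeffX; case: eqP => // e; move: lt; rewrite -e ltnNge le.
Qed.

Lemma ordgeXi i : ordge 1 ('X_i : {mpoly C[n]}).
Proof. by apply: ordgeX; rewrite mdeg1. Qed.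

Lemma ordge1P p : ordge 1 p <-> p@_0%MM = 0.
Proof.
split=> [h|h m]; first by apply: h; rewrite mdeg0.
by rewrite ltnS leqn0 mdeg_eq0 => /eqP->.
Qed.

Lemma ordge1_sub p : ordge 1 (p - (p@_0%MM)%:MP).
Proof. by apply/ordge1P; rewrite mcoeffB mcoeffC eqxx mulr1 subrr. Qed.

Lemma ordge_eq0 p : (forall N, ordge N p) -> p = 0.
Proof. by move=> h; apply/mpolyP => m; rewrite mcoeff0 (h (mdeg m).+1). Qed.

Lemma not_ordge N p : ~ ordge N p ->
  exists m, [/\ p@_m != 0, (mdeg m < N)%N & ordge (mdeg m) p].
Proof.
move=> /boolp.existsNP[m0 /boolp.not_implyP[lt0 /eqP pm0]].
have [|d [[m [md pm]] mind]] := @ex_minimal (fun d => exists m, mdeg m = d /\ p@_m != 0).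
  by exists (mdeg m0), m0.
have led : (d <= mdeg m0)%N.
  by rewrite leqNgt; apply/negP => /mind; apply; exists m0.
exists m; rewrite md; split=> //; first exact: leq_ltn_trans lt0.
by move=> k /mind no; apply/eqP/negPn/negP => pk; apply: no; exists k.
Qed.

Lemma mcoeff_low_mul p q m : ordge (mdeg m) q -> (p * q)@_m = p@_0%MM * q@_m.
Proof.
move=> hq; rewrite -{1}(subrK ((p@_0%MM)%:MP) p) mulrDl mcoeffD mcoeffCM.
rewrite (_ : ((p - _) * q)@_m = 0) ?add0r //.
by apply: (ordgeM (ordge1_sub p) hq); rewrite add1n.
Qed.

Lemma mcoeff_X_deriv i p m : ('X_i * p^`M(i))@_m = (m i)%:R * p@_m.
Proof.
elim/mpolyind: p => [|c k p _ _ IH]; first by rewrite mderiv0 mulr0 !mcoeff0 mulr0.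
rewrite mderivD mulrDr !mcoeffD IH mulrDr; congr (_ + _).
rewrite mderivZ mderivX -!scalerAr !mcoeffZ mcoeffX.
have [k0|k0] := posnP (k i).
  rewrite k0 mul0r mulr0; case: eqP => [<-|_]; last by rewrite !mulr0.
  by rewrite k0 mul0r.
rewrite -mpolyXD addmC submK; last by rewrite lep1mP -lt0n.
rewrite mcoeffX; case: eqP => [->|_]; last by rewrite !mulr0.
by rewrite mulrCA.
Qed.

End Basic.

Section Comp.
Variables (n k : nat).
Implicit Types p q : {mpoly C[n]}.

Lemma ordge_comp (t : n.-tuple {mpoly C[k]}) N p :
  (forall i, ordge 1 (tnth t i)) -> ordge N p -> ordge N (p \mPo t).
Proof.
move=> ht hp; rewrite comp_mpolyEX big_seq_cond; apply: ordge_sum => m /andP[ms _].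
have le : (N <= mdeg m)%N.
  by rewrite leqNgt; apply/negP => /hp/eqP; rewrite mcoeff_eq0 ms.
apply: ordgeZ; apply: (ordge_leq le); rewrite comp_mpolyX mdegE.
elim/big_ind2: _ => [|a x b y|i _]; [exact: ordge_all|exact: ordgeM|].
elim: (m i) => [|e IH]; first exact: ordge_all.
by rewrite exprS -add1n; apply: ordgeM.
Qed.

Lemma mcoeff0_comp (t : n.-tuple {mpoly C[k]}) p :
  (forall i, ordge 1 (tnth t i)) -> (p \mPo t)@_0%MM = p@_0%MM.
Proof.
move=> ht; have /ordge1P := ordge_comp ht (ordge1_sub p).
by rewrite comp_mpolyB comp_mpolyC mcoeffB mcoeffC eqxx mulr1 => /eqP; rewrite subr_eq0 => /eqP.
Qed.

Lemma ordge_comp_sub (t t' : n.-tuple {mpoly C[k]}) N d p : (0 < N)%N ->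
  (forall i, ordge 1 (tnth t i)) -> (forall i, ordge 1 (tnth t' i)) ->
  (forall i, ordge N (tnth t i - tnth t' i)) -> ordge d.+1 p ->
  ordge (N + d) ((p \mPo t) - (p \mPo t')).
Proof.
move=> N0 ht ht' htt hp.
pose P (q : {mpoly C[n]}) e := [/\ ordge e (q \mPo t), ordge e (q \mPo t') &
   ordge (N + e).-1 ((q \mPo t) - (q \mPo t'))].
have P1 : P 1 0%N.
  by split; [exact: ordge_all|exact: ordge_all|rewrite !rmorph1 subrr; exact: ordge0].
have PM q e q' e' : P q e -> P q' e' -> P (q * q') (e + e')%N.
  move=> [h1 h2 h3] [h4 h5 h6]; rewrite /P !comp_mpolyM; split; try exact: ordgeM.
  have -> : forall a b a' b' : {mpoly C[k]}, a * b - a' * b' = (a - a') * b + a' * (b - b').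
    by move=> *; ring.
  apply: ordgeD.
    by apply: ordge_leq (ordgeM h3 h4); lia.
  by apply: ordge_leq (ordgeM h2 h6); lia.
have PX i : P 'X_i 1%N.
  rewrite /P !comp_mpolyXt; split=> //.
  by apply: ordge_leq (htt i); lia.
have PXm m : P 'X_[m] (mdeg m).
  rewrite (mpolyXE_id C m) mdegE.
  apply: (@big_ind2 _ _ (fun q e => P q e)) => [//|a x b y|i _]; first exact: PM.
  elim: (m i) => [//|e IH]; rewrite exprS -add1n; exact: PM.
rewrite !comp_mpolyEX -sumrB big_seq_cond; apply: ordge_sum => m /andP[ms _].
have le : (d < mdeg m)%N by rewrite ltnNge; apply/negP => /hp/eqP; rewrite mcoeff_eq0 ms.
rewrite -scalerBr; apply: ordgeZ; have [_ _] := PXm m.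
by apply: ordge_leq; lia.
Qed.

End Comp.

(** On terms of lowest degree the field acts by its diagonal linear part, which multiplies X^m by
    its weight, and [M] acts by its constant term. All weight comparisons along branches come down
    to this. *)
Lemma weight_of_lowest n (Y : 'I_n -> {mpoly C[n]}) (w : 'I_n -> C) G M R N m :
  (forall i, ordge 2 (Y i - w i *: 'X_i)) ->
  \sum_i Y i * G^`M(i) = M * G + R -> ordge N R ->
  G@_m != 0 -> (mdeg m < N)%N -> ordge (mdeg m) G ->
  \sum_i (m i)%:R * w i = M@_0%MM.
Proof.
move=> hY e hR Gm lt hG; have := congr1 (mcoeff m) e.
rewrite mcoeffD (mcoeff_low_mul _ hG) hR // addr0 => e1.
apply: (mulIf Gm); rewrite -e1 raddf_sum mulr_suml; apply: eq_bigr => i _ /=.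
rewrite -(subrK (w i *: 'X_i) (Y i)) mulrDl mcoeffD -scalerAl mcoeffZ mcoeff_X_deriv.
rewrite (_ : ((_ - _) * _)@_m = 0) ?add0r; first by rewrite mulrAC mulrC.
case: (posnP (mdeg m)) hG => [m0|mpos] hG.
  have m00 : m = 0%MM by apply/eqP; rewrite -mdeg_eq0 m0.
  by apply: (ordgeMr _ (hY i)); rewrite m0.
apply: (ordgeM (hY i) (ordge_deriv (N := (mdeg m).-1) i _)); last by lia.
by rewrite prednK.
Qed.

End Order.

(** * Invariant graphs to finite order *)

Section Branch.
Variables (C : fieldType) (n : nat).
Implicit Types (h d : {mpoly C[n]}) (p q : {mpoly C[n.+1]}).
Variables (Z : 'I_n.+1 -> {mpoly C[n.+1]}) (lam : 'I_n.+1 -> C).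
Hypothesis linZ : forall i, ordge 2 (Z i - lam i *: 'X_i).

(** Substituting this tuple restricts a polynomial to the hypersurface x_0 = h(x_1, ..., x_n). *)
Definition graph h : n.+1.-tuple {mpoly C[n]} :=
  [tuple if unlift ord0 i is Some j then 'X_j else h | i < n.+1].

Lemma tnth_graph0 h : tnth (graph h) ord0 = h.
Proof. by rewrite tnth_mktuple unlift_none. Qed.

Lemma tnth_graphS h j : tnth (graph h) (lift ord0 j) = 'X_j.
Proof. by rewrite tnth_mktuple liftK. Qed.

Lemma graph_ordge h i : ordge 1 h -> ordge 1 (tnth (graph h) i).
Proof.
move=> h1; have [j ->|->] := unliftP ord0 i; rewrite ?tnth_graph0 ?tnth_graphS //.
exact: ordgeXi.
Qed.

Lemma mderiv_graph h p j :
  (p \mPo graph h)^`M(j) = (p^`M(ord0) \mPo graph h) * h^`M(j) + (p^`M(lift ord0 j) \mPo graph h).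
Proof.
rewrite mderiv_comp big_ord_recl tnth_graph0; congr (_ + _).
rewrite (bigD1 j) //= big1 => [|i ni]; first by rewrite tnth_graphS mderivXU eqxx addr0 mulr1.
by rewrite tnth_graphS mderivXU (negPf ni) mulr0.
Qed.

(** The derivative of h - x_0 along [Z], restricted to x_0 = h; it vanishes exactly when this
    hypersurface is invariant. *)
Definition graph_defect h :=
  \sum_(j < n) h^`M(j) * (Z (lift ord0 j) \mPo graph h) - (Z ord0 \mPo graph h).

Lemma linZ1 i : ordge 1 (Z i).
Proof.
rewrite -(subrK (lam i *: 'X_i) (Z i)); apply: ordgeD.
  exact: (ordge_leq _ (linZ i)).
by apply: ordgeZ; apply: ordgeXi.
Qed.

(** A correction [d] of order [N] changes the defect by the action of the linear part of the field,
    which is diagonal on monomials. All other contributions gain an order, because [h] and the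
    nonlinear part start in degree 2. *)
Lemma graph_defect_add N h d : (1 < N)%N -> ordge 2 h -> ordge N d ->
  ordge N.+1 (graph_defect (h + d) - graph_defect h -
    (\sum_(j < n) lam (lift ord0 j) *: ('X_j * d^`M(j)) - lam ord0 *: d)).
Proof.
move=> N1 h2 dN; have N0 : (0 < N)%N by apply: ltnW.
have h1 : ordge 1 h by apply: (ordge_leq _ h2).
have hd1 : ordge 1 (h + d) by apply: ordgeD => //; apply: (ordge_leq _ dN).
have close e p : ordge e.+1 p -> ordge (N + e) ((p \mPo graph (h + d)) - (p \mPo graph h)).
  apply: ordge_comp_sub => // i; try exact: graph_ordge.
  have [j ->|->] := unliftP ord0 i; rewrite ?tnth_graph0 ?tnth_graphS ?subrr.
    exact: ordge0.
  by rewrite addrAC subrr add0r.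
have aux1 (R : comPzRingType) (a b z z' l x : R) :
    (a + b) * z' - a * z - l * (x * b) = a * (z' - z) + b * (z' - l * x) by ring.
have aux2 (R : comPzRingType) (S' z' S z L lh ld : R) :
  S' - z' - (S - z) - (L - ld) = S' - S - L - (z' - (lh + ld) - (z - lh)) by ring.
pose e := \sum_(j < n) ((h^`M(j) * ((Z (lift ord0 j) \mPo graph (h + d)) - (Z (lift ord0 j) \mPo graph h)))
   + d^`M(j) * ((Z (lift ord0 j) - lam (lift ord0 j) *: 'X_(lift ord0 j)) \mPo graph (h + d)))
   - (((Z ord0 - lam ord0 *: 'X_ord0) \mPo graph (h + d)) - ((Z ord0 - lam ord0 *: 'X_ord0) \mPo graph h)).
have -> : graph_defect (h + d) - graph_defect h -
    (\sum_(j < n) lam (lift ord0 j) *: ('X_j * d^`M(j)) - lam ord0 *: d) = e.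
  rewrite /graph_defect /e !comp_mpolyB !comp_mpolyZ !comp_mpolyXt !tnth_graph0 scalerDr.
  have E : \sum_(j < n) (h + d)^`M(j) * (Z (lift ord0 j) \mPo graph (h + d))
        - \sum_(j < n) h^`M(j) * (Z (lift ord0 j) \mPo graph h)
        - \sum_(j < n) lam (lift ord0 j) *: ('X_j * d^`M(j)) =
     \sum_(j < n) ((h^`M(j) * ((Z (lift ord0 j) \mPo graph (h + d)) - (Z (lift ord0 j) \mPo graph h)))
   + d^`M(j) * ((Z (lift ord0 j) - lam (lift ord0 j) *: 'X_(lift ord0 j)) \mPo graph (h + d))).
    rewrite -!sumrB; apply: eq_bigr => j _.
    rewrite comp_mpolyB comp_mpolyZ comp_mpolyXt tnth_graphS mderivD -!mul_mpolyC.
    exact: aux1.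
  by rewrite -E; apply: aux2.
apply: ordgeB; last by rewrite -addn1; apply: close.
apply: ordge_sum => j _; apply: ordgeD.
  rewrite -addn1 addnC; apply: ordgeM; first exact: ordge_deriv.
  by rewrite -[N]addn0; apply: close; apply: linZ1.
have -> : N.+1 = (N.-1 + 2)%N by lia.
apply: ordgeM; first by apply: ordge_deriv; rewrite prednK.
by apply: ordge_comp => // i; apply: graph_ordge.
Qed.

Hypothesis nonres : forall m : 'X_{1..n},
  \sum_(j < n) (m j)%:R * lam (lift ord0 j) != lam ord0.

(** The correction in each degree is found coefficientwise: [ev m] is the eigenvalue of the
    linearized operator on X^m, and [nonres] says that it is not 0. *)
Lemma exists_graph N : exists2 h, ordge 2 h & ordge N (graph_defect h).
Proof.
suff H k : exists2 h, ordge 2 h & ordge k.+2 (graph_defect h).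
  by have [h h2 hk] := H N; exists h => //; apply: (ordge_leq _ hk); lia.
elim: k => [|k [h h2 hN]].
  exists 0; first exact: ordge0.
  rewrite /graph_defect big1 => [|j _]; last by rewrite mderiv0 mul0r.
  rewrite sub0r; apply: ordgeN.
  rewrite -(subrK (lam ord0 *: 'X_ord0) (Z ord0)) comp_mpolyD comp_mpolyZ comp_mpolyXt tnth_graph0.
  rewrite scaler0 addr0; apply: ordge_comp => // i; apply: graph_ordge; exact: ordge0.
clear N; set N := k.+2 in hN *.
pose ev m := \sum_(j < n) (m j)%:R * lam (lift ord0 j) - lam ord0 : C.
pose dc m := if mdeg m == N then - (graph_defect h)@_m / ev m else 0.
pose d := \sum_(m <- msupp (graph_defect h)) dc m *: 'X_[m] : {mpoly C[n]}.
have dE m : d@_m = dc m.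
  rewrite /d raddf_sum /=; under eq_bigr do rewrite mcoeffZ mcoeffX.
  have [ms|ms] := boolP (m \in msupp (graph_defect h)).
    rewrite (bigD1_seq m) ?msupp_uniq //= eqxx mulr1 big1 ?addr0 // => m' nm.
    by rewrite (negPf nm) mulr0.
  rewrite /dc (memN_msupp_eq0 ms) oppr0 mul0r if_same big_seq big1 // => m' ms'.
  by case: (m' =P m) => [e|]; rewrite ?mulr0 //; rewrite -e ms' in ms.
have dN : ordge N d by move=> m lt; rewrite dE /dc ltn_eqF.
have N1 : (1 < N)%N by [].
exists (h + d); first by apply: ordgeD => //; apply: (ordge_leq _ dN).
move=> m; rewrite ltnS => le.
have := @graph_defect_add N h d N1 h2 dN m; rewrite ltnS => /(_ le).
rewrite mcoeffB mcoeffB [X in _ - X = _]mcoeffB (raddf_sum (mcoeff m)).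
under eq_bigr do rewrite /= mcoeffZ mcoeff_X_deriv.
rewrite mcoeffZ => /eqP; rewrite subr_eq0 subr_eq => /eqP->.
have -> : \sum_(j < n) lam (lift ord0 j) * ((m j)%:R * d@_m) - lam ord0 * d@_m = ev m * d@_m.
  by rewrite /ev mulrBl mulr_suml; congr (_ - _); apply: eq_bigr => j _; ring.
rewrite dE /dc; case: eqP => [mN|/eqP nm].
  have ev0 : ev m != 0 by rewrite /ev subr_eq0 nonres.
  by rewrite mulrC divfK // addNr.
by rewrite mulr0 add0r hN // ltn_neqAle nm.
Qed.

(** The components of [Z] other than Z_0, restricted to the graph, form the induced field; on
    restrictions it agrees with [Z] up to a multiple of the defect. *)
Lemma Xder_graph h p : \sum_(j < n) (Z (lift ord0 j) \mPo graph h) * (p \mPo graph h)^`M(j) =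
  ((\sum_i Z i * p^`M(i)) \mPo graph h) + (p^`M(ord0) \mPo graph h) * graph_defect h.
Proof.
rewrite big_ord_recl comp_mpolyD comp_mpolyM [X in _ = _ + X + _]comp_mpoly_sum.
under eq_bigr do rewrite mderiv_graph.
under [X in _ = _ + X + _]eq_bigr do rewrite comp_mpolyM.
have aux (R : comPzRingType) (a x : R) (F G H : 'I_n -> R) :
    \sum_(j < n) F j * (x * H j + G j) =
    a * x + \sum_(j < n) F j * G j + x * (\sum_(j < n) H j * F j - a).
  rewrite mulrBr mulr_sumr; transitivity (\sum_(j < n) F j * G j + \sum_(j < n) x * (H j * F j)); last by ring.
  by rewrite -big_split; apply: eq_bigr => j _ /=; ring.
exact: aux.
Qed.

Lemma graph_linear h j : ordge 1 h ->
  ordge 2 ((Z (lift ord0 j) \mPo graph h) - lam (lift ord0 j) *: 'X_j).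
Proof.
move=> h1; rewrite -(tnth_graphS h) -comp_mpolyXt -comp_mpolyZ -comp_mpolyB.
by apply: ordge_comp => // i; apply: graph_ordge.
Qed.

Definition off_spectrum (c : C) := forall m : 'X_{1..n},
  \sum_(j < n) (m j)%:R * lam (lift ord0 j) != c.

(** The restriction of [g] to the graph satisfies a semi-invariant equation up to order [N]. A
    monomial of lowest degree below [N] would have the constant term of [mu] as its weight, which
    lies off the spectrum. *)
Lemma graph_annihilates N h g mu : ordge 1 h -> ordge N (graph_defect h) ->
  \sum_i Z i * g^`M(i) = mu * g -> off_spectrum mu@_0%MM -> ordge N (g \mPo graph h).
Proof.
move=> h1 hN eg off; apply: boolp.contrapT => /not_ordge[m [gm lt low]].
have e := Xder_graph h g; rewrite eg comp_mpolyM in e.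
have := weight_of_lowest (fun j => graph_linear j h1) e (ordgeMl _ hN) gm lt low.
rewrite mcoeff0_comp => [/eqP|i]; last exact: graph_ordge.
by apply/negP; apply: off.
Qed.

Lemma mcoeff0_deriv_lin i j : (Z i)^`M(j)@_0%MM = lam i * (i == j)%:R.
Proof.
have := ordge_deriv j (linZ i); move=> /ordge1P.
rewrite mderivB mderivZ mderivXU mcoeffB mcoeffZ => /eqP; rewrite subr_eq0 => /eqP->.
by case: eqP; rewrite ?mcoeff0 ?mcoeff1 ?eqxx.
Qed.

(** Differentiating the equation of [g] along x_0 gives one for the derivative of [g], with the
    constant term of the cofactor lowered by [lam ord0]. With [graph_annihilates] this says that [g]
    vanishes doubly on the graph. *)
Lemma graph_annihilates_deriv N h g mu : ordge 2 h -> ordge N.+1 (graph_defect h) ->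
  \sum_i Z i * g^`M(i) = mu * g -> off_spectrum mu@_0%MM ->
  off_spectrum (mu@_0%MM - lam ord0) -> ordge N (g^`M(ord0) \mPo graph h).
Proof.
move=> h2 hN eg off off'; have h1 : ordge 1 h by apply: (ordge_leq _ h2).
have gN := graph_annihilates h1 hN eg off.
have t1 i : ordge 1 (tnth (graph h) i) by apply: graph_ordge.
pose E p := p \mPo graph h; pose g' i := g^`M(i).
(* [M] is the new cofactor and [R] the error on the graph. The derivatives of [g] in the other
   directions are expressed through the x_0-derivative, which goes into [M], and derivatives of the
   restriction of [g], which have high order and go into [R]. *)
pose M := E mu - E (Z ord0)^`M(ord0) + \sum_(j < n) h^`M(j) * E (Z (lift ord0 j))^`M(ord0).
pose R := E mu^`M(ord0) * E g - \sum_(j < n) E (Z (lift ord0 j))^`M(ord0) * (E g)^`M(j)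
   + E (g^`M(ord0))^`M(ord0) * graph_defect h.
have dg : \sum_i Z i * (g^`M(ord0))^`M(i) = mu^`M(ord0) * g + mu * g^`M(ord0) -
    \sum_i (Z i)^`M(ord0) * g^`M(i).
  have := congr1 (mderiv ord0) eg; rewrite mderivM raddf_sum /= => <-.
  rewrite -sumrB; apply: eq_bigr => i _.
  by rewrite mderivM mderiv_comm; ring.
have e : \sum_(j < n) E (Z (lift ord0 j)) * (E g^`M(ord0))^`M(j) = M * E g^`M(ord0) + R.
  rewrite /E Xder_graph dg big_ord_recl comp_mpolyB comp_mpolyD !comp_mpolyM comp_mpolyD comp_mpolyM.
  rewrite [X in _ - (_ + X)]comp_mpoly_sum.
  under [X in _ - (_ + X)]eq_bigr do rewrite comp_mpolyM.
  rewrite /M /R /E.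
  under [X in _ = _ + (_ - X + _)]eq_bigr do rewrite mderiv_graph.
  have aux (A : comPzRingType) (a b c x s y : A) (F G H : 'I_n -> A) :
    a * b + c * x - (y * x + \sum_(j < n) F j * G j) + s =
    (c - y + \sum_(j < n) H j * F j) * x + (a * b - \sum_(j < n) F j * (x * H j + G j) + s).
    have -> : \sum_(j < n) F j * (x * H j + G j) = (\sum_(j < n) H j * F j) * x + \sum_(j < n) F j * G j.
      by rewrite mulr_suml -big_split; apply: eq_bigr => j _ /=; ring.
    ring.
  exact: aux.
have hR : ordge N R.
  apply: ordgeD; last by apply: ordgeMl; apply: (ordge_leq _ hN).
  apply: ordgeB; first by apply: ordgeMl; apply: (ordge_leq _ gN).
  by apply: ordge_sum => j _; apply: ordgeMl; apply: ordge_deriv.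
apply: boolp.contrapT => /not_ordge[m [gm lt low]].
have := weight_of_lowest (fun j => graph_linear j h1) e hR gm lt low.
have -> : M@_0%MM = mu@_0%MM - lam ord0.
  have s0 : ordge 1 (\sum_(j < n) h^`M(j) * E (Z (lift ord0 j))^`M(ord0)).
    by apply: ordge_sum => j _; apply: ordgeMr; apply: ordge_deriv.
  move/ordge1P: s0 => s0; rewrite /M mcoeffD s0 addr0 mcoeffB.
  by rewrite (mcoeff0_comp _ t1) (mcoeff0_comp _ t1) mcoeff0_deriv_lin eqxx mulr1.
by move/eqP; apply/negP; apply: off'.
Qed.

(** A polynomial without x_0 is unchanged by restriction to a graph, so unless it is 0 it cannot
    vanish there to every order. *)
Lemma graph_indep h p : p^`M(ord0) = 0 -> [pchar C] =i pred0 ->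
  (forall N, exists2 h, ordge 2 h & ordge N (p \mPo graph h)) -> p = 0.
Proof.
move=> dp ch hN.
pose up : n.-tuple {mpoly C[n.+1]} := [tuple 'X_(lift ord0 j) | j < n].
have indep h' : (p \mPo graph h') \mPo up = p.
  rewrite [in RHS](mpolyE p) [in LHS](mpolyE p) (raddf_sum (comp_mpoly (graph h'))).
  rewrite (raddf_sum (comp_mpoly up)) /= big_seq [RHS]big_seq; apply: eq_bigr => m ms.
  have m0 : m ord0 = 0%N.
    apply/eqP; rewrite -leqn0 leqNgt; apply/negP => m0.
    have := mcoeff_deriv ord0 (m - U_(ord0))%MM p; rewrite dp mcoeff0 submK ?lep1mP -?lt0n //.
    move/esym/eqP; rewrite -mulr_natr mulf_eq0 mcoeff_eq0 ms /=.
    by move/pcharf0P: ch => ->.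
  rewrite !comp_mpolyZ; congr (_ *: _); rewrite comp_mpolyX big_ord_recl m0 expr0 mul1r.
  rewrite (rmorph_prod (comp_mpoly up)) /= (mpolyXE_id C m) big_ord_recl m0 expr0 mul1r.
  by apply: eq_bigr => j _; rewrite tnth_graphS rmorphXn /= comp_mpolyXt tnth_mktuple.
have updown (q : {mpoly C[n]}) : (q \mPo up) \mPo graph 0 = q.
  apply: (mpoly_morph_ext (f := (comp_mpoly (graph 0) \o comp_mpoly up)%FUN) (g := idfun)) => [c|i] /=.
    by rewrite !comp_mpolyC.
  by rewrite !comp_mpolyXt tnth_mktuple comp_mpolyXt tnth_graphS.
rewrite -(indep 0) (_ : p \mPo graph 0 = 0) ?rmorph0 //.
apply: ordge_eq0 => N; have [h' _ ] := hN N.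
by rewrite -[X in _ -> ordge _ (X \mPo _)](indep h') updown.
Qed.

End Branch.

Section LinearExtension.
Variables (R : comNzRingType) (n : nat) (V : lmodType R) (F : 'X_{1..n} -> V).

Definition linext (p : {mpoly R[n]}) : V := \sum_(m <- msupp p) p@_m *: F m.

Lemma linext_sub p (r : seq 'X_{1..n}) : uniq r -> {subset msupp p <= r} ->
  linext p = \sum_(m <- r) p@_m *: F m.
Proof.
move=> ur sub; rewrite [RHS](bigID (mem (msupp p))) /= [X in _ + X]big1 ?addr0 => [|m nm].
  rewrite -big_filter; apply: perm_big; apply: uniq_perm; rewrite ?msupp_uniq ?filter_uniq //.
  by move=> m; rewrite mem_filter; case: (boolP (m \in msupp p)) => // /sub->.
by rewrite memN_msupp_eq0 // scale0r.
Qed.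

Lemma linext_linear : linear linext.
Proof.
move=> c p q; pose r := undup (msupp p ++ msupp q ++ msupp (c *: p + q)).
have ur : uniq r by apply: undup_uniq.
rewrite !(@linext_sub _ r) //; try by move=> m hm; rewrite mem_undup !mem_cat hm ?orbT.
rewrite scaler_sumr -big_split; apply: eq_bigr => m _ /=.
by rewrite mcoeffD mcoeffZ scalerDl scalerA.
Qed.
HB.instance Definition _ := GRing.isLinear.Build R {mpoly R[n]} V *:%R linext linext_linear.

Lemma linextX m : linext 'X_[m] = F m.
Proof. by rewrite /linext msuppX big_seq1 mcoeffX eqxx scale1r. Qed.

End LinearExtension.

(** Checking only monomials in the support of [p] brings in its degree bound; the identities for
    [dehom] hold only below such a bound. *)
Lemma linear_eq_supp (R : comNzRingType) n (V : lmodType R) (f g : {mpoly R[n]} -> V) :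
  linear f -> linear g -> forall p, (forall m, m \in msupp p -> f 'X_[m] = g 'X_[m]) -> f p = g p.
Proof.
move=> lf lg p h; have f0 : f 0 = 0.
  by have := lf (-1) 0 0; rewrite scaleN1r oppr0 addr0 scaleN1r addNr.
have g0 : g 0 = 0.
  by have := lg (-1) 0 0; rewrite scaleN1r oppr0 addr0 scaleN1r addNr.
rewrite (mpolyE p) big_seq; apply: (big_ind (fun q => f q = g q)); rewrite ?f0 ?g0 //.
  by move=> x y hx hy; rewrite -[x]scale1r lf lg hx hy.
by move=> m /h e; rewrite -[_ *: _]addr0 lf lg f0 g0 e.
Qed.

(** * The Poincare transform at a singular line *)

Section Dehomogenization.
Variable C : fieldType.
Local Notation S := {mpoly C[3]}.
Implicit Types (g h : S).

Definition chart_mnm D (m : 'X_{1..3}) : 'X_{1..3} :=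
  [multinom match nat_of_ord i with 0%N => m 1%R | 1%N => m 2%R | _ => (D - mdeg m)%N end | i < 3].

(* The coordinates of 'X_{1..3} are read off as (x2, x3, x4): a polynomial g
   of degree at most D becomes g(1, x2, x3) made homogeneous of degree D by x4. *)
Definition dehom D : S -> S := linext (fun m => 'X_[chart_mnm D m] : S).
HB.instance Definition _ D := GRing.Linear.on (dehom D).

Lemma dehomX D m : dehom D 'X_[m] = 'X_[chart_mnm D m].
Proof. exact: linextX. Qed.

Lemma mdeg3 (m : 'X_{1..3}) : mdeg m = (m 0%R + m 1%R + m 2%R)%N.
Proof.
rewrite mdegE !big_ord_recl big_ord0 addn0 addnA.
by congr (_ + _ + _)%N; congr (fun_of_multinom m _); apply/val_inj.
Qed.

Lemma chart_mnm0 D m : chart_mnm D m 0 = m 1. Proof. by rewrite mnmE. Qed.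
Lemma chart_mnm1 D m : chart_mnm D m 1 = m 2. Proof. by rewrite mnmE. Qed.
Lemma chart_mnm2 D m : chart_mnm D m 2 = (D - mdeg m)%N. Proof. by rewrite mnmE. Qed.

Lemma ord3P (P : 'I_3 -> Prop) : P 0 -> P 1 -> P 2 -> forall i, P i.
Proof.
move=> p0 p1 p2 [[|[|[|k]]] hk] //.
- by rewrite (_ : Ordinal hk = 0) //; apply/val_inj.
- by rewrite (_ : Ordinal hk = 1) //; apply/val_inj.
- by rewrite (_ : Ordinal hk = 2) //; apply/val_inj.
Qed.

Lemma mnm3P (a b : 'X_{1..3}) : a 0 = b 0 -> a 1 = b 1 -> a 2 = b 2 -> a = b.
Proof. by move=> *; apply/mnmP; apply: ord3P. Qed.

Lemma dehomM D E g h : (msize g <= D.+1)%N -> (msize h <= E.+1)%N ->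
  dehom (D + E) (g * h) = dehom D g * dehom E h.
Proof.
move=> hg hh; apply: (linear_eq_supp (f := fun p => dehom (D + E) (p * h)) (g := fun p => dehom D p * dehom E h)).
- by move=> c p q; rewrite mulrDl -scalerAl linearP.
- by move=> c p q; rewrite linearP mulrDl -scalerAl.
move=> m ms; apply: (linear_eq_supp (f := fun p => dehom (D + E) ('X_[m] * p)) (g := fun p => dehom D 'X_[m] * dehom E p)).
- by move=> c p q; rewrite mulrDr -scalerAr linearP.
- by move=> c p q; rewrite linearP mulrDr -scalerAr.
move=> m' ms'; rewrite -mpolyXD !dehomX -mpolyXD.
have := msize_mdeg_lt ms; have := msize_mdeg_lt ms'.
move: hg hh; move: (msize g) (msize h) => x y *; congr 'X_[_]; apply: mnm3P; rewrite mnmDE ?chart_mnm0 ?chart_mnm1 ?chart_mnm2 ?mnmDE //.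
rewrite mdegD; lia.
Qed.

Lemma dehom1 : dehom 0 1 = 1.
Proof.
rewrite -mpolyX0 dehomX; congr 'X_[_]; apply: mnm3P; rewrite ?chart_mnm0 ?chart_mnm1 ?chart_mnm2 !mnm0E //.
Qed.

Lemma mdeg_subU (m : 'X_{1..3}) i : (0 < m i)%N -> mdeg (m - U_(i))%MM = (mdeg m).-1.
Proof.
move=> mi; have := mdegD (m - U_(i))%MM U_(i); rewrite submK ?lep1mP -?lt0n //.
by rewrite mdeg1 addn1 => ->.
Qed.

Lemma mderiv_dehom D g (i : 'I_3) : (i < 2)%N ->
  (dehom D.+1 g)^`M(i) = dehom D g^`M(inord i.+1).
Proof.
move=> lt; apply: (linear_eq_supp (f := fun p => (dehom D.+1 p)^`M(i)) (g := fun p => dehom D p^`M(inord i.+1))).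
- by move=> c p q; rewrite linearP linearP.
- by move=> c p q; rewrite linearP linearP.
move=> m _; rewrite dehomX !mderivX linearZ /= dehomX.
have -> : chart_mnm D.+1 m i = m (inord i.+1).
  move: i lt; apply: ord3P => // _; rewrite ?chart_mnm0 ?chart_mnm1; congr (fun_of_multinom m _); apply/val_inj; rewrite /= inordK //.
have [->|mi] := posnP (m (inord i.+1)); first by rewrite !scale0r.
congr (_ *: 'X_[_]); have := mdeg_subU mi.
have : (0 < mdeg m)%N by rewrite mdegE (bigD1 (inord i.+1)) //= addn_gt0 mi.
move: i lt mi; apply: ord3P => // _.
  have -> : inord 1 = 1 :> 'I_3 by apply/val_inj; rewrite /= inordK.
  move=> mi m0 dm; apply: mnm3P; rewrite mnmBE ?chart_mnm0 ?chart_mnm1 ?chart_mnm2 ?mnmBE !mnm1E //=; lia.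
have -> : inord 2 = 2 :> 'I_3 by apply/val_inj; rewrite /= inordK.
move=> mi m0 dm; apply: mnm3P; rewrite mnmBE ?chart_mnm0 ?chart_mnm1 ?chart_mnm2 ?mnmBE !mnm1E //=; lia.
Qed.

Lemma euler_dehom D g : (msize g <= D.+2)%N ->
  D.+1%:R * dehom D.+1 g = dehom D g^`M(0) + \sum_(i < 3) 'X_i * (dehom D.+1 g)^`M(i).
Proof.
move=> hg.
apply: (linear_eq_supp (f := fun p => D.+1%:R * dehom D.+1 p) (g := fun p => dehom D p^`M(0) + \sum_(i < 3) 'X_i * (dehom D.+1 p)^`M(i))).
- by move=> c p q; rewrite linearP mulrDr scalerAr.
- move=> c p q; rewrite !linearP scalerDr addrACA; congr (_ + _).
  rewrite scaler_sumr -big_split; apply: eq_bigr => i _ /=.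
  by rewrite linearP mulrDr scalerAr.
move=> m ms; have := msize_mdeg_lt ms => /leq_trans/(_ hg); rewrite ltnS => le.
rewrite mderivX linearZ /= !dehomX.
have -> : \sum_(i < 3) 'X_i * ('X_[chart_mnm D.+1 m])^`M(i) = (mdeg (chart_mnm D.+1 m))%:R * 'X_[chart_mnm D.+1 m] :> S.
  rewrite mdegE natr_sum mulr_suml; apply: eq_bigr => i _.
  apply/mpolyP => k; rewrite mcoeff_X_deriv -mpolyC_nat mcoeffCM mcoeffX.
  by case: eqP => [->//|_]; rewrite !mulr0.
have -> : (m 0)%:R *: 'X_[chart_mnm D (m - U_(0))] = (m 0)%:R * 'X_[chart_mnm D.+1 m] :> S.
  rewrite -mpolyC_nat mul_mpolyC; have [->|m0] := posnP (m 0); first by rewrite !scale0r.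
  have := mdeg_subU m0; have : (0 < mdeg m)%N by rewrite mdeg3; lia.
  move=> p0 dm; congr (_ *: 'X_[_]); apply: mnm3P; rewrite ?chart_mnm0 ?chart_mnm1 ?chart_mnm2 ?mnmBE ?mnm1E //= ?subn0 //; lia.
rewrite -mulrDl -natrD; congr (_%:R * _).
rewrite [mdeg (chart_mnm _ _)]mdeg3 chart_mnm0 chart_mnm1 chart_mnm2; move: le; rewrite mdeg3; lia.
Qed.

Lemma Gdehom_dehom m (F : vfield C) i : (msize (F i) <= m.+1)%N -> Gdehom m F i = dehom m (F i).
Proof.
move=> hF.
apply: (linear_eq_supp (f := fun p => \sum_(j < m.+1) (pihomog mdeg j p \mPo [tuple 1; 'X_0; 'X_1]) * 'X_2 ^+ (m - j)) (g := dehom m)).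
- move=> c p q; rewrite scaler_sumr -big_split; apply: eq_bigr => j _ /=.
  by rewrite linearP comp_mpolyD comp_mpolyZ mulrDl scalerAl.
- by move=> c p q; rewrite linearP.
move=> k ks; have := msize_mdeg_lt ks => /leq_trans/(_ hF) lt.
rewrite (bigD1 (Ordinal lt)) //= big1 ?addr0 => [|j nj]; last first.
  rewrite pihomogX ifN ?rmorph0 ?mul0r //.
  by apply: contra nj => /eqP e; apply/eqP/val_inj.
rewrite pihomogX (eqxx (mdeg k)) dehomX comp_mpolyX !big_ord_recl big_ord0 !(tnth_nth 0) /=.
rewrite expr1n mul1r mulr1 (mpolyXE_id C (chart_mnm m k)) !big_ord_recl big_ord0 mulr1 -mulrA.
have e1 : lift ord0 ord0 = 1 :> 'I_3 by apply/val_inj.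
have e2 : lift ord0 (lift ord0 ord0) = 2 :> 'I_3 by apply/val_inj.
by rewrite e1 e2 chart_mnm1 chart_mnm2 -[ord0]/(0 : 'I_3) chart_mnm0.
Qed.

Lemma mcoeff_dehom D g m : (msize g <= D.+1)%N -> (mdeg m <= D)%N ->
  (dehom D g)@_(chart_mnm D m) = g@_m.
Proof.
move=> hg le; apply: (linear_eq_supp (V := C^o) (f := fun p => (dehom D p)@_(chart_mnm D m)) (g := fun p => p@_m)).
- by move=> c p q; rewrite linearP mcoeffD mcoeffZ.
- by move=> c p q; rewrite mcoeffD mcoeffZ.
move=> k ks; have := msize_mdeg_lt ks => /leq_trans/(_ hg); rewrite ltnS => lek.
rewrite dehomX !mcoeffX; congr (_ %:R); congr (nat_of_bool _); apply/eqP/eqP => [e|->//].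
have e0 := congr1 (fun a : 'X_{1..3} => a 0) e; have e1 := congr1 (fun a : 'X_{1..3} => a 1) e.
have e2 := congr1 (fun a : 'X_{1..3} => a 2) e.
move: e0 e1 e2; rewrite !chart_mnm0 !chart_mnm1 !chart_mnm2 => e1 e2 e3.
by apply: mnm3P => //; move: lek le e3; rewrite !mdeg3; lia.
Qed.

Lemma dehom_eq0 D g : (msize g <= D.+1)%N -> dehom D g = 0 -> g = 0.
Proof.
move=> hg e; apply/mpolyP => m; rewrite mcoeff0.
have [lt|le] := ltnP D (mdeg m).
  by rewrite memN_msupp_eq0 //; apply: msize_mdeg_ge; apply: leq_trans lt.
by rewrite -(mcoeff_dehom hg le) e mcoeff0.
Qed.

(** The origin of the chart is the point e_1 of the plane at infinity x4 = 0, where only the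
    component of degree [D] survives. *)
Lemma mcoeff0_dehom D g : (msize g <= D.+1)%N ->
  (dehom D g)@_0%MM = ev (pihomog mdeg D g) (e1 C).
Proof.
move=> hg.
apply: (linear_eq_supp (V := C^o) (f := fun p => (dehom D p)@_0%MM) (g := fun p => ev (pihomog mdeg D p) (e1 C))).
- by move=> c p q; rewrite linearP mcoeffD mcoeffZ.
- by move=> c p q; rewrite linearP /ev mevalD mevalZ.
move=> k ks; have := msize_mdeg_lt ks => /leq_trans/(_ hg); rewrite ltnS => lek.
rewrite dehomX mcoeffX pihomogX /ev.
have evX : 'X_[k].@[fun i => e1 C i 0] = ((k 1 == 0%N) && (k 2 == 0%N))%:R.
  rewrite mevalX !big_ord_recl big_ord0 mulr1 /e1 !mxE /= expr1n mul1r.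
  have -> : lift ord0 ord0 = 1 :> 'I_3 by apply/val_inj.
  have -> : lift ord0 (lift ord0 ord0) = 2 :> 'I_3 by apply/val_inj.
  rewrite !expr0n; by case: (k 1 == 0%N); case: (k 2 == 0%N); rewrite ?mulr0 ?mulr1.
case: (mdeg k =P D) => [dk|nd].
  rewrite evX; congr (_%:R); congr (nat_of_bool _); apply/eqP/andP => [e|[/eqP k1 /eqP k2]].
    have e0 := congr1 (fun a : 'X_{1..3} => a 0) e; have e1 := congr1 (fun a : 'X_{1..3} => a 1) e.
    by move: e0 e1; rewrite chart_mnm0 chart_mnm1 !mnm0E => -> ->.
  by apply: mnm3P; rewrite ?chart_mnm0 ?chart_mnm1 ?chart_mnm2 ?mnm0E // dk subnn.
rewrite meval0; case: eqP => // e; have := congr1 (fun a : 'X_{1..3} => a 2) e.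
by rewrite chart_mnm2 mnm0E; lia.
Qed.

End Dehomogenization.

Lemma meval_0 (C : fieldType) n (p : {mpoly C[n]}) : p.@[fun=> 0] = p@_0%MM.
Proof.
apply: (linear_eq_supp (V := C^o) (f := meval (fun=> 0)) (g := fun p => p@_0%MM)).
- by move=> c a b; rewrite mevalD mevalZ.
- by move=> c a b; rewrite mcoeffD mcoeffZ.
move=> m _; rewrite mevalX mcoeffX; case: eqP => [->|/eqP m0].
  by rewrite big1 // => i _; rewrite mnm0E.
have [i mi] : exists i, (0 < m i)%N.
  apply: boolp.contrapT => no; case/negP: m0; apply/eqP/mnmP => i; rewrite mnm0E.
  by apply/eqP; rewrite -leqn0 leqNgt; apply/negP => mi; apply: no; exists i.
by rewrite (bigD1 i) //= expr0n eqn0Ngt mi mul0r.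
Qed.

Section LocalChart.
Variable C : numFieldType.
Local Notation S := {mpoly C[3]}.
Local Notation hom k := (pihomog mdeg k).
Variables (f : vfield C) (m : nat) (v : 'cV[C]_3) (T : 'M[C]_3) (c : C).
Hypothesis sizef : forall i, (msize (f i) <= m.+1)%N.
Hypothesis unitT : T \in unitmx.
Hypothesis Tv : T *m v = e1 C.
Hypothesis pv : vfeval (vhpart m f) v = c *: v.

Local Notation F := (conjvf T f).
Local Notation X := (poincare m T f).
Local Notation pull g := (g \mPo linsubst (invmx T)).

Lemma size_conj i : (msize (F i) <= m.+1)%N.
Proof.
apply: msize_sum_le => k _; apply: leq_trans (msizeZ_le _ _) _.
exact: leq_trans (msize_linsubst _ _) _.
Qed.

Lemma e1E i : e1 C i 0 = (i == 0)%:R. Proof. by rewrite mxE andbT. Qed.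

Lemma invTe1 : invmx T *m e1 C = v. Proof. by rewrite -Tv mulKmx. Qed.

Lemma ev_pull (g : S) : ev (pull g) (e1 C) = ev g v.
Proof. by rewrite ev_linsubst invTe1. Qed.

Lemma conj_e1 i : ev (hom m (F i)) (e1 C) = c * (i == 0)%:R.
Proof.
have -> : ev (hom m (F i)) (e1 C) = (T *m vfeval (vhpart m f) v) i 0.
  rewrite /conjvf raddf_sum /ev rmorph_sum mxE; apply: eq_bigr => k _.
  by rewrite /= linearZ /= pihomog_linsubst mevalZ -/(ev _ _) ev_pull mxE.
by rewrite pv -scalemxAr Tv mxE e1E.
Qed.

Definition G i := dehom m (F i).

Lemma GdehomE i : Gdehom m F i = G i. Proof. by apply: Gdehom_dehom; apply: size_conj. Qed.

Lemma mcoeff0_G i : (G i)@_0%MM = c * (i == 0)%:R.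
Proof. by rewrite mcoeff0_dehom ?size_conj // conj_e1. Qed.

Lemma chart0 : X 0 = - (G 0 * 'X_0) + G 1. Proof. by rewrite /poincare /= !GdehomE. Qed.
Lemma chart1 : X 1 = - (G 0 * 'X_1) + G 2. Proof. by rewrite /poincare /= !GdehomE. Qed.
Lemma chart2 : X 2 = - (G 0 * 'X_2). Proof. by rewrite /poincare /= !GdehomE. Qed.

Lemma chart_ordge i : ordge 1 (X i).
Proof.
apply/ordge1P; move: i; apply: ord3P; rewrite ?chart0 ?chart1 ?chart2 ?mcoeffD mcoeffN.
- by rewrite mcoeff0_G mulr0 addr0 ((ordge1P _).1 (ordgeMl _ (ordgeXi _ _))) oppr0.
- by rewrite mcoeff0_G mulr0 addr0 ((ordge1P _).1 (ordgeMl _ (ordgeXi _ _))) oppr0.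
- by rewrite ((ordge1P _).1 (ordgeMl _ (ordgeXi _ _))) oppr0.
Qed.

Local Notation J := (jac0 X).

Lemma jac0E i j : J i j = ((X i)^`M(j))@_0%MM.
Proof. by rewrite mxE meval_0. Qed.

(** The plane at infinity x4 = 0 is invariant with cofactor - [G 0], whose value at the origin is
    -c. So the last unit row vector is a left eigenvector of the Jacobian. *)
Lemma jac0_row2 j : J 2 j = - c * (j == 2)%:R.
Proof.
rewrite jac0E chart2 mderivN mderivM mcoeffN mcoeffD.
rewrite ((ordge1P _).1 (ordgeMl _ (ordgeXi _ _))) add0r mderivXU eq_sym.
case: eqP => _; last by rewrite !mulr0 mcoeff0 oppr0.
by rewrite !mulr1 mcoeff0_G eqxx mulr1.
Qed.

Lemma ordge2_sub_linear n (p : {mpoly C[n]}) : ordge 1 p ->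
  ordge 2 (p - \sum_j (p^`M(j))@_0%MM *: 'X_j).
Proof.
move=> /ordge1P p0 k; rewrite ltnS leq_eqVlt => /orP[/mdeg1P[j /eqP->]|].
  rewrite mcoeffB (raddf_sum (mcoeff _)) (bigD1 j) //= big1 => [|l nl].
    by rewrite addr0 mcoeffZ mcoeffXU eqxx mulr1 mcoeff_deriv add0m mnm0E mulr1n subrr.
  by rewrite mcoeffZ mcoeffXU (negPf nl) mulr0.
rewrite ltnS leqn0 mdeg_eq0 => /eqP->; rewrite mcoeffB p0 (raddf_sum (mcoeff _)) big1 ?subr0 // => j _ /=.
by rewrite mcoeffZ mcoeffX mnm1_eq0 mulr0.
Qed.

(* Euler's identity turns the missing derivative along e1 into a multiple of G_1. *)
Lemma chart_semi_invariant g mu D : Xder f g = mu * g -> msize g = D.+2 ->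
  exists kappa, Xder X (dehom D.+1 (pull g)) = kappa * dehom D.+1 (pull g).
Proof.
move=> Xg szg; set h := pull g.
have szh : msize h = D.+2 by rewrite msize_linsubst_unit ?unitmx_inv.
have XF : Xder F h = pull mu * h by rewrite Xder_conj // Xg comp_mpolyM.
have szmu : (msize (pull mu) <= m)%N.
  by apply: leq_trans (msize_linsubst _ _) _; apply: (msize_cofactor sizef _ Xg); rewrite szg.
have XD : \sum_(i < 3) G i * dehom D h^`M(i) = dehom m.-1 (pull mu) * dehom D.+1 h.
  transitivity (dehom (m + D) (Xder F h)).
    rewrite /Xder linear_sum /=; apply: eq_bigr => i _.
    by rewrite dehomM ?size_conj // msize_mderiv // szh.
  rewrite XF; case: m sizef szmu => [|k] _ szk.
    by move: szk; rewrite leqn0 msize_poly_eq0 => /eqP->; rewrite mul0r !linear0 mul0r.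
  by rewrite addSnnS dehomM // szh.
exists (dehom m.-1 (pull mu) - D.+1%:R * G 0).
have eul := @euler_dehom C D h; rewrite szh in eul; move: (eul (leqnn _)) XD.
have i2 : lift ord0 (lift ord0 ord0) = 2 :> 'I_3 by apply/val_inj.
have i1 : lift ord0 ord0 = 1 :> 'I_3 by apply/val_inj.
rewrite /Xder !big_ord_recl !big_ord0 !addr0 i2 i1 -[ord0]/(0 : 'I_3).
rewrite chart0 chart1 chart2.
have -> : h^`M(1) = h^`M(inord 1) by congr mderiv; apply/val_inj; rewrite /= inordK.
have -> : h^`M(2) = h^`M(inord 2) by congr mderiv; apply/val_inj; rewrite /= inordK.
rewrite -(@mderiv_dehom C D h 0) // -(@mderiv_dehom C D h 1) //.
have aux (R : comPzRingType) (n H h0 a b d g0 g1 g2 x y z k : R) :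
   n * H = h0 + (x * a + (y * b + z * d)) -> g0 * h0 + (g1 * a + g2 * b) = k * H ->
   (- (g0 * x) + g1) * a + ((- (g0 * y) + g2) * b + (- (g0 * z)) * d) = (k - n * g0) * H.
  move=> e1 e2; rewrite mulrBl -e2.
  have -> : n * g0 * H = g0 * (n * H) by ring.
  rewrite e1; ring.
exact: aux.
Qed.

Section Frame.
Variables (P : 'M[C]_3) (lam : 'I_3 -> C).
Hypothesis unitP : P \in unitmx.
Hypothesis PJ : forall i b, \sum_k P i k * J k b = lam i * P i b.
Hypothesis P2 : forall b, P 2 b = (b == 2)%:R.

Local Notation Q := (invmx P).
(** The rows of [P] are left eigenvectors of the Jacobian, so in the coordinates y = P x the linear
    part is diagonal. [P2] keeps x4 as the last coordinate, and the plane at infinity stays a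
    coordinate plane. *)
Definition diag_field := conjvf P X.
Local Notation Z := diag_field.

Lemma diag_field_linear i : ordge 2 (Z i - lam i *: 'X_i).
Proof.
have E : \sum_k P i k *: ((\sum_j J k j *: 'X_j) \mPo linsubst Q) = lam i *: 'X_i :> S.
  transitivity ((lam i *: \sum_j P i j *: 'X_j) \mPo linsubst Q); last first.
    rewrite comp_mpolyZ; congr (_ *: _); rewrite -(tnth_linsubst P) -comp_mpolyXt.
    by rewrite linsubstK // unitP.
  rewrite scaler_sumr !comp_mpoly_sum.
  under eq_bigr do rewrite comp_mpoly_sum scaler_sumr.
  rewrite exchange_sum; apply: eq_bigr => j _.
  under eq_bigr do rewrite comp_mpolyZ scalerA.
  by rewrite -scaler_suml PJ scalerA comp_mpolyZ.
rewrite -E /diag_field /conjvf -sumrB; apply: ordge_sum => k _.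
rewrite -scalerBr -comp_mpolyB; apply: ordgeZ; apply: ordge_comp => [l|].
  by rewrite tnth_linsubst; apply: ordge_sum => j _; apply: ordgeZ; apply: ordgeXi.
have := ordge2_sub_linear (chart_ordge k).
by under eq_bigr do rewrite -jac0E.
Qed.

Lemma Q2 b : Q 2 b = (b == 2)%:R.
Proof.
have := congr1 (fun A : 'M_3 => A 2 b) (mulmxV unitP); rewrite !mxE [2 == b]eq_sym => <-.
by rewrite (bigD1 2) //= big1 => [|k nk]; rewrite P2 ?eqxx ?mul1r ?addr0 // (negPf nk) mul0r.
Qed.

(** The local equation of g = 0 at the point [v] at infinity, in the eigencoordinates y. *)
Definition hat D (g : S) := dehom D (pull g) \mPo linsubst Q.

Lemma linsubst_ordge (A : 'M[C]_3) i : ordge 1 (tnth (linsubst A) i).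
Proof. by rewrite tnth_linsubst; apply: ordge_sum => j _; apply: ordgeZ; apply: ordgeXi. Qed.

Lemma hat_semi_invariant D g kappa :
  Xder X (dehom D (pull g)) = kappa * dehom D (pull g) ->
  \sum_i Z i * (hat D g)^`M(i) = (kappa \mPo linsubst Q) * hat D g /\
  (kappa \mPo linsubst Q)@_0%MM = kappa@_0%MM.
Proof.
move=> e; split; last by apply: mcoeff0_comp => i; apply: linsubst_ordge.
by have := Xder_conj X (dehom D (pull g)) unitP; rewrite e comp_mpolyM.
Qed.

Lemma hatM D E g h : (msize g <= D.+1)%N -> (msize h <= E.+1)%N ->
  hat (D + E) (g * h) = hat D g * hat E h.
Proof.
move=> hg hh; rewrite /hat comp_mpolyM dehomM ?comp_mpolyM //.
  exact: leq_trans (msize_linsubst _ _) hg.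
exact: leq_trans (msize_linsubst _ _) hh.
Qed.

Lemma hat_linear D : linear (hat D).
Proof. by move=> a g h; rewrite /hat comp_mpolyD comp_mpolyZ linearP comp_mpolyD comp_mpolyZ. Qed.

Lemma hatD D g h : hat D (g + h) = hat D g + hat D h.
Proof. by have := hat_linear D 1 g h; rewrite !scale1r. Qed.

Lemma hat_eq0 D g : (msize g <= D.+1)%N -> hat D g = 0 -> g = 0.
Proof.
move=> hg /eqP; rewrite /hat linsubst_eq0 ?unitmx_inv // => /eqP/dehom_eq0 h.
apply/eqP; rewrite -(@linsubst_eq0 C (invmx T)) ?unitmx_inv //; apply/eqP/h.
exact: leq_trans (msize_linsubst _ _) hg.
Qed.

Lemma mcoeff0_hat D g : (msize g <= D.+1)%N -> (hat D g)@_0%MM = ev (hom D g) v.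
Proof.
move=> hg; rewrite /hat mcoeff0_comp => [|i]; last exact: linsubst_ordge.
rewrite mcoeff0_dehom; last exact: leq_trans (msize_linsubst _ _) hg.
by rewrite pihomog_linsubst ev_pull.
Qed.

(** The direction of the original space that corresponds to the coordinate y_i. After [T] its first
    entry is 0 because the chart is the affine space x_1 = 1. *)
Definition frame_dir (i : 'I_3) : 'cV[C]_3 :=
  invmx T *m \col_(k < 3) (match nat_of_ord k with 0%N => 0 | 1%N => Q 0 i | _ => Q 1 i end).

Lemma mderiv_hat D g (i : 'I_3) : i != 2 -> (hat D.+1 g)^`M(i) = hat D (mdir (frame_dir i) g).
Proof.
move=> ni; rewrite /hat mderiv_linsubst !big_ord_recl big_ord0 addr0.
have i2 : lift ord0 (lift ord0 ord0) = 2 :> 'I_3 by apply/val_inj.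
have i1 : lift ord0 ord0 = 1 :> 'I_3 by apply/val_inj.
rewrite i2 i1 -[ord0]/(0 : 'I_3) Q2 (negPf ni) scale0r addr0.
rewrite !mderiv_dehom // /frame_dir -[mdir _ g]linsubst1.
have -> : pull (mdir (invmx T *m \col_(k < 3)
     (match nat_of_ord k with 0%N => 0 | 1%N => Q 0 i | _ => Q 1 i end)) g \mPo linsubst 1%:M) =
   mdir (\col_(k < 3) (match nat_of_ord k with 0%N => 0 | 1%N => Q 0 i | _ => Q 1 i end)) (pull g).
  by rewrite linsubst1 mdir_linsubst.
rewrite /mdir !big_ord_recl big_ord0 addr0 !mxE /= scale0r add0r i2 i1.
have -> : inord 1 = 1 :> 'I_3 by apply/val_inj; rewrite /= inordK.
have -> : inord 2 = 2 :> 'I_3 by apply/val_inj; rewrite /= inordK.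
by rewrite linearD !linearZ /= comp_mpolyD !comp_mpolyZ.
Qed.

End Frame.
End LocalChart.

(** The form in which property E is used: no integer relation between the eigenvalues has mixed
    signs, or only some of its coefficients equal to 0. *)
Definition sign_related (C : numFieldType) (lam : 'I_3 -> C) :=
  forall z : 'I_3 -> int, \sum_i (z i)%:~R * lam i = 0 ->
    [\/ forall i, z i = 0, forall i, 0 < z i | forall i, z i < 0].

Definition lin_indep3 (C : fieldType) (v q1 q2 : 'cV[C]_3) :=
  forall a b c : C, a *: v + b *: q1 + c *: q2 = 0 -> [/\ a = 0, b = 0 & c = 0].

Lemma sum3E (V : nmodType) (F : 'I_3 -> V) : \sum_i F i = F 0 + F 1 + F 2.
Proof.
rewrite !big_ord_recl big_ord0 addr0 addrA.
by congr (_ + _ + _); congr F; apply/val_inj.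
Qed.

Lemma conjvf_delta (C : fieldType) (P : 'M[C]_3) (X : vfield C) i j :
  (forall k, P i k = (k == j)%:R) -> conjvf P X i = X j \mPo linsubst (invmx P).
Proof.
move=> Pi; rewrite /conjvf (bigD1 j) //= big1 => [|k nk]; last by rewrite Pi (negPf nk) scale0r.
by rewrite Pi eqxx scale1r addr0.
Qed.

(** * Restriction to the plane at infinity *)

Section PlanarRestriction.
Variable C : fieldType.

Definition planar : 3.-tuple {mpoly C[2]} :=
  [tuple match nat_of_ord i with 0%N => 'X_0 | 1%N => 'X_1 | _ => 0 end | i < 3].

Lemma planar0 : tnth planar 0 = 'X_0. Proof. by rewrite tnth_mktuple. Qed.
Lemma planar1 : tnth planar 1 = 'X_1. Proof. by rewrite tnth_mktuple. Qed.
Lemma planar2 : tnth planar 2 = 0. Proof. by rewrite tnth_mktuple. Qed.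

Lemma planar_ordge i : ordge 1 (tnth planar i).
Proof.
move: i; apply: ord3P; rewrite ?planar0 ?planar1 ?planar2; [exact: ordgeXi|exact: ordgeXi|exact: ordge0].
Qed.

Definition planar_mnm (k : 'X_{1..2}) : 'X_{1..3} :=
  [multinom match nat_of_ord i with 0%N => k 0%R | 1%N => k 1%R | _ => 0%N end | i < 3].

Lemma mcoeff_planar p k : (p \mPo planar)@_k = p@_(planar_mnm k).
Proof.
apply: (linear_eq_supp (V := C^o) (f := fun p => (p \mPo planar)@_k) (g := fun p => p@_(planar_mnm k))).
- by move=> c a b; rewrite comp_mpolyD comp_mpolyZ mcoeffD mcoeffZ.
- by move=> c a b; rewrite mcoeffD mcoeffZ.
move=> m _; rewrite comp_mpolyX !big_ord_recl big_ord0 mulr1.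
have -> : lift ord0 ord0 = 1 :> 'I_3 by apply/val_inj.
have -> : lift ord0 (lift ord0 ord0) = 2 :> 'I_3 by apply/val_inj.
rewrite -[ord0]/(0 : 'I_3) planar0 planar1 planar2 mcoeffX expr0n.
have [m2|m2] := eqVneq (m 2) 0%N; last first.
  rewrite mulr0 mulr0 mcoeff0; case: eqP => // e.
  by case/negP: m2; rewrite e mnmE.
rewrite mulr1 !mpolyXn -mpolyXD mcoeffX; congr (_%:R); congr (nat_of_bool _).
apply/eqP/eqP => [<-|->].
  by apply: mnm3P; rewrite mnmE /= ?mnmDE ?mulmnE ?mnm1E //= ?mul1n ?mul0n ?addn0.
apply/mnmP => -[[|[|i]] hi] //.
  by rewrite mnmDE !mulmnE !mnm1E !mnmE /= mul1n mul0n addn0; congr (fun_of_multinom k _); apply/val_inj.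
by rewrite mnmDE !mulmnE !mnm1E !mnmE /= mul1n mul0n add0n; congr (fun_of_multinom k _); apply/val_inj.
Qed.

Lemma planar_eq0 (p : {mpoly C[3]}) : p \mPo planar = 0 -> exists q, p = 'X_2 * q.
Proof.
move=> e; have h (m : 'X_{1..3}) : m 2 = 0%N -> p@_m = 0.
  move=> m2; rewrite -(mcoeff0 C (n := 2) [multinom match nat_of_ord i with 0%N => m 0%R | _ => m 1%R end | i < 2]) -e.
  rewrite mcoeff_planar; congr (_@__); apply: mnm3P; by rewrite !mnmE.
exists (\sum_(m <- msupp p) p@_m *: 'X_[m - U_(2)]).
rewrite mulr_sumr {1}(mpolyE p) big_seq [RHS]big_seq; apply: eq_bigr => m ms.
have m2 : (0 < m 2%R)%N by rewrite lt0n; apply: contraTneq ms => /h/eqP; rewrite mcoeff_eq0.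
by rewrite -scalerAr -mpolyXD addmC submK // lep1mP -lt0n.
Qed.

Lemma mderiv_planar p : 
  ((p \mPo planar)^`M(0) = p^`M(0) \mPo planar) * ((p \mPo planar)^`M(1) = p^`M(1) \mPo planar).
Proof.
by split; rewrite mderiv_comp sum3E planar0 planar1 planar2 mderiv0 !mderivXU /= mulr0 mulr1 mulr0 ?addr0 ?add0r.
Qed.

End PlanarRestriction.

Section Frames.
Variable C : numFieldType.
Local Notation S := {mpoly C[3]}.
Local Notation hom k := (pihomog mdeg k).
Variables (f : vfield C) (m : nat) (v : 'cV[C]_3) (T : 'M[C]_3) (c : C).
Hypothesis sizef : forall i, (msize (f i) <= m.+1)%N.
Hypothesis unitT : T \in unitmx.
Hypothesis Tv : T *m v = e1 C.
Hypothesis pv : vfeval (vhpart m f) v = c *: v.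

Local Notation X := (poincare m T f).
Local Notation pull g := (g \mPo linsubst (invmx T)).

Definition eigenframe (P : 'M[C]_3) (lam : 'I_3 -> C) :=
  [/\ P \in unitmx, forall i b, \sum_k P i k * jac0 X k b = lam i * P i b,
      forall b, P 2 b = (b == 2)%:R & sign_related lam].

(** The two eigendirections inside the plane at infinity are symmetric, so only the branch belonging
    to [lam 0] has to be treated. *)
Lemma eigenframe_swap P lam : eigenframe P lam ->
  eigenframe (xrow 0 1 P) (fun i => lam (tperm 0 1 i)).
Proof.
move=> [uP PJ P2 rel]; split.
- by rewrite xrowE unitmx_mul unitmx_perm.
- have E i k : xrow 0 1 P i k = P (tperm 0 1 i) k by rewrite mxE.
  by move=> i b; rewrite E -PJ; apply: eq_bigr => k _; rewrite E.
- by move=> b; rewrite mxE tpermD // P2.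
move=> z e; have := rel (fun i => z (tperm 0 1 i)).
have -> : \sum_i (z (tperm 0 1 i))%:~R * lam i = 0.
  transitivity (\sum_i (z i)%:~R * lam (tperm 0 1 i)); last exact: e.
  rewrite [RHS]sum3E [LHS]sum3E.
  have -> : tperm 0 1 0 = 1 :> 'I_3 by rewrite tpermL.
  have -> : tperm 0 1 1 = 0 :> 'I_3 by rewrite tpermR.
  have -> : tperm 0 1 2 = 2 :> 'I_3 by rewrite tpermD.
  by rewrite [X in X + _]addrC.
by case=> // h; [apply: Or31|apply: Or32|apply: Or33] => i; rewrite -(tpermK 0 1 i).
Qed.

Section OneFrame.
Variables (P : 'M[C]_3) (lam : 'I_3 -> C).
Hypothesis frame : eigenframe P lam.
Local Notation Q := (invmx P).
Local Notation Z := (diag_field f m T P).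
Local Notation hatP := (hat T P).

Let uP : P \in unitmx. Proof. by case: frame. Qed.
Let PJ : forall i b, \sum_k P i k * jac0 X k b = lam i * P i b. Proof. by case: frame. Qed.
Let P2 : forall b, P 2 b = (b == 2)%:R. Proof. by case: frame. Qed.
Let rel : sign_related lam. Proof. by case: frame. Qed.

Lemma relation_absurd (a b d : int) : a%:~R * lam 0 + b%:~R * lam 1 + d%:~R * lam 2 = 0 ->
  0 < a -> (b <= 0) || (d <= 0) -> False.
Proof.
move=> e a0 bd; pose z (i : 'I_3) := match nat_of_ord i with 0%N => a | 1%N => b | _ => d end.
have := rel (z := z); rewrite sum3E => /(_ e)[] h.
- by have := h 0; rewrite /z /= => h0; rewrite h0 in a0.
- by case/orP: bd => le; [have := h 1|have := h 2]; rewrite /z /= ltNge le.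
- by have := h 0; rewrite /z /= ltNge (ltW a0).
Qed.

Lemma planar_field j : (j < 2)%N -> tnth (planar C) (inord j) = 'X_(inord j) ->
  ordge 2 ((Z (inord j) \mPo planar C) - lam (inord j) *: 'X_(inord j)).
Proof.
move=> lt e; rewrite -e -comp_mpolyXt -comp_mpolyZ -comp_mpolyB.
apply: ordge_comp => [i|]; first exact: planar_ordge.
exact: (diag_field_linear sizef unitT Tv pv uP PJ).
Qed.

Lemma Z2_planar : Z 2 \mPo planar C = 0.
Proof.
have -> : Z 2 = (X 2 \mPo linsubst Q).
  exact: conjvf_delta.
rewrite chart2 //.
rewrite raddfN /= comp_mpolyM comp_mpolyXt tnth_linsubst.
have -> : \sum_(l < 3) invmx P 2 l *: 'X_l = 'X_2 :> S.
  by rewrite sum3E !(Q2 uP P2) /= !scale0r !add0r scale1r.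
by rewrite raddfN /= comp_mpolyM comp_mpolyXt planar2 mulr0 oppr0.
Qed.

(** Otherwise x4 would divide the local equation, and [g] would have no component of degree [D]. *)
Lemma hat_planar_neq0 D g : (msize g <= D.+1)%N -> hom D g != 0 -> hatP D g \mPo planar C != 0.
Proof.
move=> szg; apply: contraNneq => /planar_eq0[q hq].
have e : dehom D (pull g) = 'X_2 * (q \mPo linsubst P).
  have : hatP D g \mPo linsubst P = dehom D (pull g) by rewrite /hat linsubstVK.
  move=> <-; rewrite hq comp_mpolyM comp_mpolyXt tnth_linsubst sum3E !P2 /=.
  by rewrite !scale0r !add0r scale1r.
rewrite -(@linsubst_eq0 C (invmx T)) ?unitmx_inv // -pihomog_linsubst.
apply/eqP/mpolyP => k; rewrite mcoeff0 mcoeff_pihomog; case: eqP => // dk.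
have szp : (msize (pull g) <= D.+1)%N by apply: leq_trans (msize_linsubst _ _) szg.
rewrite -(mcoeff_dehom szp) ?dk // e.
rewrite (mpolyE (q \mPo linsubst P)) mulr_sumr (raddf_sum (mcoeff _)) big1 // => l _ /=.
rewrite -scalerAr mcoeffZ -mpolyXD mcoeffX; case: eqP => [E|]; rewrite ?mulr0 //.
have := congr1 (fun a : 'X_{1..3} => a 2) E.
by rewrite chart_mnm2 dk subnn mnmDE mnm1E eqxx.
Qed.

(** All monomials of lowest degree on the plane at infinity get the same weight. By [weight_unique]
    there is then only one such monomial, whose exponents are the multiplicities along the two
    branches. *)
Lemma planar_weight D g kappa : (msize g <= D.+1)%N -> hom D g != 0 ->
  Xder X (dehom D (pull g)) = kappa * dehom D (pull g) ->
  forall k : 'X_{1..2}, (hatP D g \mPo planar C)@_k != 0 -> ordge (mdeg k) (hatP D g \mPo planar C) ->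
  (k 0%R)%:R * lam 0 + (k 1%R)%:R * lam 1 = kappa@_0%MM.
Proof.
move=> szg topg cof k Gk low.
have [e <-] := hat_semi_invariant uP cof.
set G := hatP D g \mPo planar C in Gk low.
pose Y (j : 'I_2) := Z (inord j) \mPo planar C.
have hY (j : 'I_2) : ordge 2 (Y j - lam (inord j) *: 'X_j).
  case: j => -[|[|j]] hj //.
    have := @planar_field 0 isT; rewrite /Y /=.
    have -> : inord 0 = 0 :> 'I_3 by apply/val_inj; rewrite /= inordK.
    have -> : Ordinal hj = 0 by apply/val_inj.
    have -> : inord 0 = 0 :> 'I_2 by apply/val_inj; rewrite /= inordK.
    by apply; rewrite planar0.
  have := @planar_field 1 isT; rewrite /Y /=.
  have -> : inord 1 = 1 :> 'I_3 by apply/val_inj; rewrite /= inordK.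
  have -> : Ordinal hj = 1 by apply/val_inj.
  have -> : inord 1 = 1 :> 'I_2 by apply/val_inj; rewrite /= inordK.
  by apply; rewrite planar1.
have E : \sum_j Y j * G^`M(j) = ((kappa \mPo linsubst Q) \mPo planar C) * G + 0.
  rewrite addr0 -comp_mpolyM -e comp_mpoly_sum sum3E !comp_mpolyM Z2_planar mul0r addr0.
  rewrite !big_ord_recl big_ord0 addr0 /Y /=.
  have -> : lift ord0 ord0 = 1 :> 'I_2 by apply/val_inj.
  rewrite -[ord0]/(0 : 'I_2) !mderiv_planar.
  have -> : inord (nat_of_ord (0%R : 'I_2)) = 0 :> 'I_3 by apply/val_inj; rewrite /= inordK.
  by have -> : inord (nat_of_ord (1%R : 'I_2)) = 1 :> 'I_3 by apply/val_inj; rewrite /= inordK.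
have := weight_of_lowest hY E (@ordge0 C 2 (mdeg k).+1) Gk (ltnSn _) low.
rewrite mcoeff0_comp => [<-|i]; last exact: planar_ordge.
rewrite !big_ord_recl big_ord0 addr0 /=.
have -> : lift ord0 ord0 = 1 :> 'I_2 by apply/val_inj.
by congr (_ * lam _ + _ * lam _); apply/val_inj; rewrite /= inordK.
Qed.

Lemma planar_weight_exists D g kappa : (msize g <= D.+1)%N -> hom D g != 0 ->
  Xder X (dehom D (pull g)) = kappa * dehom D (pull g) ->
  exists k : 'X_{1..2}, [/\ (hatP D g \mPo planar C)@_k != 0, ordge (mdeg k) (hatP D g \mPo planar C)
    & (k 0%R)%:R * lam 0 + (k 1%R)%:R * lam 1 = kappa@_0%MM].
Proof.
move=> szg topg cof; have G0 := hat_planar_neq0 szg topg.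
have [N nN] : exists N, ~ ordge N (hatP D g \mPo planar C).
  apply/boolp.existsNP => h; move/eqP: G0; apply; exact: ordge_eq0.
have [k [Gk _ low]] := not_ordge nN.
by exists k; split=> //; apply: planar_weight low.
Qed.

End OneFrame.
End Frames.

Section Branches.
Variable C : numFieldType.
Local Notation S := {mpoly C[3]}.
Local Notation hom k := (pihomog mdeg k).
Variables (f : vfield C) (m : nat) (v : 'cV[C]_3) (T : 'M[C]_3) (c : C).
Hypothesis sizef : forall i, (msize (f i) <= m.+1)%N.
Hypothesis unitT : T \in unitmx.
Hypothesis Tv : T *m v = e1 C.
Hypothesis pv : vfeval (vhpart m f) v = c *: v.

Local Notation X := (poincare m T f).
Local Notation pull g := (g \mPo linsubst (invmx T)).
Implicit Types (lam : 'I_3 -> C) (P : 'M[C]_3) (g h psi : S).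

(* [local_weight lam g a b]: along the two branches of the foliation at v, the
   curve g = 0 has multiplicities a and b. *)
Definition local_weight lam g (a b : nat) := exists kappa,
  Xder X (dehom (msize g).-1 (pull g)) = kappa * dehom (msize g).-1 (pull g) /\
  kappa@_0%MM = a%:R * lam 0 + b%:R * lam 1.

Lemma local_weight_swap lam g a b : local_weight lam g a b ->
  local_weight (fun i => lam (tperm 0 1 i)) g b a.
Proof. by move=> [kappa [e1 e2]]; exists kappa; rewrite tpermL tpermR addrC. Qed.

Lemma semi_invariant_size g : semi_invariant f g -> exists D, msize g = D.+2.
Proof. by move=> [lt _]; move: lt; case: (msize g) => [|[|D]] // _; exists D. Qed.

Lemma semi_invariant_neq0 g : semi_invariant f g -> g != 0.
Proof. by move=> [lt _]; rewrite -msize_poly_eq0 -lt0n (ltn_trans _ lt). Qed.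

Lemma local_weight_exists P lam g : eigenframe f m T P lam -> semi_invariant f g ->
  exists a b, local_weight lam g a b /\ (ev (hom (msize g).-1 g) v = 0 -> (0 < a + b)%N).
Proof.
move=> fr sg; have [D szg] := semi_invariant_size sg; have g0 := semi_invariant_neq0 sg.
have [_ [mu Xg]] := sg; have [kappa cof] := chart_semi_invariant sizef unitT Xg szg.
have top := top_neq0 g0; rewrite szg /= in top.
have szg' : (msize g <= D.+2)%N by rewrite szg.
have [k [Gk low e]] := planar_weight_exists sizef unitT Tv pv fr szg' top cof.
exists (k 0), (k 1); split; first by exists kappa; rewrite szg.
rewrite szg /= => top0; rewrite lt0n addn_eq0; apply: contraNN Gk => /andP[/eqP k0 /eqP k1].
have -> : k = 0%MM.
  by apply/mnmP => -[[|[|i]] hi] //; rewrite mnm0E; [rewrite -[RHS]k0|rewrite -[RHS]k1];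
    congr (fun_of_multinom k _); apply/val_inj.
rewrite mcoeff0_comp => [|i]; last exact: planar_ordge.
by rewrite (mcoeff0_hat unitT Tv) // top0.
Qed.

(** An equality with a natural combination of [lam 1] and [lam 2] would be an integer relation whose
    first coefficient is [a] > 0 and whose last is at most 0. *)
Lemma off_spectrumP P lam (a b : int) : eigenframe f m T P lam -> 0 < a ->
  off_spectrum (n := 2) lam (a%:~R * lam 0 + b%:~R * lam 1).
Proof.
move=> fr a0 k; apply/eqP; rewrite !big_ord_recl big_ord0 addr0.
have -> : lift ord0 ord0 = 1 :> 'I_3 by apply/val_inj.
have -> : lift ord0 (lift ord0 ord0) = 2 :> 'I_3 by apply/val_inj.
set k0 := k _; set k1 := k _ => e.
apply: (relation_absurd fr (a := a) (b := b - k0%:Z) (d := - k1%:Z)) => //.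
  rewrite -[RHS](subrr (a%:~R * lam 0 + b%:~R * lam 1)) -{2}e rmorphB rmorphN /= -!pmulrn; ring.
by rewrite oppr_le0 orbT.
Qed.

Section OneBranch.
Variables (P : 'M[C]_3) (lam : 'I_3 -> C).
Hypothesis frame : eigenframe f m T P lam.
Local Notation Q := (invmx P).
Local Notation Z := (diag_field f m T P).
Local Notation hatP := (hat T P).

Let uP : P \in unitmx. Proof. by case: frame. Qed.
Let PJ : forall i b, \sum_k P i k * jac0 X k b = lam i * P i b. Proof. by case: frame. Qed.
Let P2 : forall b, P 2 b = (b == 2)%:R. Proof. by case: frame. Qed.
Let linZ := diag_field_linear sizef unitT Tv pv uP PJ.

Lemma branch_exists N : exists2 t, ordge 2 t & ordge N (graph_defect (n := 2) Z t).
Proof.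
apply: (exists_graph (lam := lam)) => // k.
by have := @off_spectrumP P lam 1 0 frame isT k; rewrite mul1r mul0r addr0.
Qed.

Lemma branch_annihilates N t g a b : ordge 1 t -> ordge N (graph_defect (n := 2) Z t) ->
  local_weight lam g a b -> (0 < a)%N -> ordge N (hatP (msize g).-1 g \mPo graph t).
Proof.
move=> t1 tN [kappa [cof w]] a0; have [e k0] := hat_semi_invariant uP cof.
apply: (graph_annihilates linZ t1 tN e); rewrite k0 w.
exact: (@off_spectrumP P lam a%:Z b%:Z frame).
Qed.

Lemma frame_dir_indep : lin_indep3 v (frame_dir T P 0) (frame_dir T P 1).
Proof.
move=> x y z /(congr1 (mulmx T)); rewrite !mulmxDr -!scalemxAr Tv /frame_dir !mulKVmx // mulmx0 => e.
have x0 : x = 0.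
  have := congr1 (fun A : 'cV_3 => A 0 0) e; rewrite !mxE /=.
  by rewrite mulr1 !mulr0 !addr0.
pose w : 'cV[C]_3 := \col_i (match nat_of_ord i with 0%N => y | 1%N => z | _ => 0 end).
have Q20 : Q 2 0 = 0 by rewrite (Q2 uP P2).
have Q21 : Q 2 1 = 0 by rewrite (Q2 uP P2).
have Qw : Q *m w = 0.
  apply/matrixP => i j; rewrite [j]ord1 mxE sum3E ![w _ _]mxE /= mulr0 addr0 mxE.
  move: i; apply: ord3P.
  - have := congr1 (fun A : 'cV_3 => A 1 0) e; rewrite !mxE /= x0 mul0r add0r => <-; ring.
  - have := congr1 (fun A : 'cV_3 => A 2 0) e; rewrite !mxE /= x0 mul0r add0r => <-; ring.
  - by rewrite Q20 Q21 !mul0r addr0.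
have w0 : w = 0 by rewrite -[w](mulKVmx uP) Qw mulmx0.
split=> //.
- by have := congr1 (fun A : 'cV_3 => A 0 0) w0; rewrite !mxE.
- by have := congr1 (fun A : 'cV_3 => A 1 0) w0; rewrite !mxE.
Qed.

Lemma frame_dir0_neq0 : frame_dir T P 0 != 0.
Proof.
apply/eqP => e; have [] := @frame_dir_indep 0 1 0.
  by rewrite e !scale0r scaler0 !addr0.
by move=> _ /eqP; rewrite oner_eq0.
Qed.

(** The combination is constant along the eigendirection of y_0, so its local equation does not
    involve y_0; it vanishes on the graphs y_0 = t to every order, hence is 0. *)
Lemma combination_eq0 g h A B D E :
  (msize g <= D.+1)%N -> (msize h <= E.+1)%N -> mdir (frame_dir T P 0) (A * g + B * h) = 0 ->
  (forall N t, ordge 2 t -> ordge N.+1 (graph_defect (n := 2) Z t) ->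
     ordge N (hatP D g \mPo graph t) /\ ordge N (hatP E h \mPo graph t)) ->
  A * g + B * h = 0.
Proof.
move=> szg szh dr ann.
(* A common degree to which both products are homogenized; the extra 1 lets [mderiv_hat] lower
   it. *)
pose K := (msize A + D + (msize B + E)).+1%N.
have KA : K = ((msize A + (msize B + E)).+1 + D)%N by rewrite /K; lia.
have KB : K = ((msize B + (msize A + D)).+1 + E)%N by rewrite /K; lia.
have szA : (msize A <= (msize A + (msize B + E)).+2)%N by lia.
have szB : (msize B <= (msize B + (msize A + D)).+2)%N by lia.
have szr : (msize (A * g + B * h) <= K.+1)%N.
  apply: leq_trans (mmeasureD_le _ _ _) _; rewrite geq_max.
  by rewrite {1}KA {1}KB !msizeM_leS.
apply: (hat_eq0 unitT uP szr).
apply: (@graph_indep C 2 0) => [||N].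
- rewrite -[X in X^`M(_)]/(hatP K (A * g + B * h)) -[ord0]/(0 : 'I_3).
  rewrite /K (mderiv_hat T uP P2) // dr.
  by rewrite /hat comp_mpoly0 linear0 comp_mpoly0.
- exact: pchar_num.
have [t t2 tN] := branch_exists N.+1; exists t => //.
have [hg hh] := ann N t t2 tN.
rewrite hatD {1}KA {1}KB !hatM // comp_mpolyD !comp_mpolyM.
by apply: ordgeD; apply: ordgeMl.
Qed.

(** Both polynomials vanish on the graph y_0 = t, hence so does the nonzero combination that
    elimination along the direction of y_0 provides. *)
Lemma branch_not_shared g h a b a' b' : g != 0 -> h != 0 -> mcoprime g h ->
  local_weight lam g a b -> local_weight lam h a' b' -> (0 < a)%N -> (0 < a')%N -> False.
Proof.
move=> g0 h0 cop wg wh a0 a0'.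
have [A [B [/eqP r0 dr]]] := eliminate frame_dir0_neq0 g0 cop; apply: r0.
apply: (@combination_eq0 g h A B (msize g).-1 (msize h).-1) => //.
- by rewrite prednK // lt0n msize_poly_eq0.
- by rewrite prednK // lt0n msize_poly_eq0.
move=> N t t2 tN; have t1 : ordge 1 t by apply: (ordge_leq _ t2).
by split; apply: (ordge_leq (leqnSn N)); [apply: branch_annihilates wg a0|apply: branch_annihilates wh a0'].
Qed.

(** For a >= 2 the derivative of [psi] transversal to the graph vanishes on it as well. Having
    smaller degree, it is coprime to the irreducible [psi], and elimination applies as for two
    curves. *)
Lemma branch_multiplicity psi a b : mirreducible psi -> local_weight lam psi a b -> (a <= 1)%N.
Proof.
move=> irr w; rewrite leqNgt; apply/negP => a1; have a0 := ltnW a1.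
have psi0 := mirreducible_neq0 irr.
have [D szp] : exists D, msize psi = D.+2.
  by move: irr.1; case: (msize psi) => [|[|D]] // _; exists D.
have szp' : (msize psi <= D.+2)%N by rewrite szp.
pose q := frame_dir T P 0.
have annd N t : ordge 2 t -> ordge N.+1 (graph_defect (n := 2) Z t) ->
    ordge N (hatP D.+1 psi \mPo graph t) /\ ordge N (hatP D (mdir q psi) \mPo graph t).
  move=> t2 tN; have t1 : ordge 1 t by apply: (ordge_leq _ t2).
  split.
    by apply: (ordge_leq (leqnSn N)); have := branch_annihilates t1 tN w a0; rewrite szp.
  have [kappa [cof wk]] := w; rewrite szp in cof; have [e k0] := hat_semi_invariant uP cof.
  have := graph_annihilates_deriv linZ t2 tN e; rewrite -[ord0]/(0 : 'I_3).
  rewrite (mderiv_hat T uP P2) //; apply; rewrite k0 wk.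
    exact: (@off_spectrumP P lam a%:Z b%:Z frame).
  have -> : a%:R * lam 0 + b%:R * lam 1 - lam 0 = (a%:Z - 1)%:~R * lam 0 + (b%:Z)%:~R * lam 1.
    by rewrite rmorphB /= -!pmulrn; ring.
  by apply: (@off_spectrumP P lam _ _ frame); rewrite subr_gt0 ltz_nat.
have szd : (msize (mdir q psi) <= D.+1)%N.
  apply: msize_sum_le => i _; apply: leq_trans (msizeZ_le _ _) _; exact: msize_mderiv.
(* If this derivative is 0, then [psi] is itself constant along the direction and serves as the
   combination. *)
have [d0|d0] := eqVneq (mdir q psi) 0.
  have := @combination_eq0 psi psi 1 0 D.+1 D.+1 szp' szp'.
  rewrite mul1r mul0r addr0 => /(_ d0) H; move/eqP: psi0; apply; apply: H => N t t2 tN.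
  by have [? _] := annd N t t2 tN.
have cop : mcoprime psi (mdir q psi).
  apply: irreducible_coprime => // -[r dE].
  have r0 : r != 0 by apply: contraNneq d0 => r0; rewrite dE r0 mulr0.
  move: szd; rewrite dE msizeM // szp; have : msize r != 0%N by rewrite msize_poly_eq0.
  by move: (msize r) => x; lia.
have [A [B [/eqP r0 dr]]] := eliminate frame_dir0_neq0 psi0 cop; apply: r0.
exact: (@combination_eq0 psi (mdir q psi) A B D.+1 D).
Qed.

End OneBranch.
End Branches.

Lemma ord3_third (a b : 'I_3) : a != b -> exists k : 'I_3,
  (forall i, [\/ i = a, i = b | i = k]) /\
  forall (V : nmodType) (F : 'I_3 -> V), \sum_i F i = F a + F b + F k.
Proof.
move: a b; apply: ord3P; apply: ord3P => // _; [exists 2|exists 1|exists 2|exists 0|exists 1|exists 0];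
  (split; [by apply: ord3P; [constructor 1 + constructor 2 + constructor 3
    |constructor 1 + constructor 2 + constructor 3|constructor 1 + constructor 2 + constructor 3]
  |move=> V F; rewrite sum3E]).
- by [].
- by rewrite addrAC.
- by rewrite [F 1 + F 0]addrC.
- by rewrite -addrA addrC.
- by rewrite [LHS]addrC addrA.
- by rewrite [LHS]addrC [F 0 + F 1]addrC addrA.
Qed.

(** * Integer relations between the eigenvalues *)

Section SignRelation.
Variable C : numClosedFieldType.

(** In dimension 2, [w] eliminates the eigenvalue [lam k] between the relation [z] and the positive
    relation [mi]. The other two eigenvalues are independent, so [w] is 0 and [z] is proportional to
    [mi]. *)
Lemma sign_related_propertyE (lam : 'I_3 -> C) :
  Qindep lam \/ (Qdim_eq lam 2 /\ exists mi : 'I_3 -> nat, (forall i, 0 < mi i)%N /\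
                              \sum_(i < 3) (mi i)%:R * lam i = 0) -> sign_related lam.
Proof.
case=> [ind|[[[s [injs ind]] _] [mi [mi0 em]]]] z ez.
  apply: Or31 => i; have := ind (fun i => (z i)%:~R).
  have -> : \sum_(i < 3) ratr ((z i)%:~R) * lam i = 0.
    by rewrite -[RHS]ez; apply: eq_bigr => j _; rewrite ratr_int.
  by move=> /(_ erefl i)/eqP; rewrite intr_eq0 => /eqP.
have nab : s 0 != s 1 by apply/eqP => /injs.
have [k [cov sumE]] := ord3_third nab.
pose w i : int := z k * (mi i)%:Z - (mi k)%:Z * z i.
have wk : w k = 0 by rewrite /w mulrC subrr.
have ew : \sum_i (w i)%:~R * lam i = 0.
  transitivity ((z k)%:~R * \sum_(i < 3) (mi i)%:R * lam i - (mi k)%:R * \sum_i (z i)%:~R * lam i).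
    rewrite !mulr_sumr -sumrB; apply: eq_bigr => i _.
    by rewrite /w rmorphB !rmorphM /= -!pmulrn; ring.
  by rewrite em ez !mulr0 subr0.
have w0 i : w i = 0.
  have h j : ((w (s j))%:~R : rat) = 0.
    apply: (ind (fun j => (w (s j))%:~R)).
    rewrite -[RHS]ew sumE wk mul0r addr0 !big_ord_recl big_ord0 addr0 !ratr_int.
    by congr (_%:~R * lam (s _) + (w (s _))%:~R * lam (s _)); apply/val_inj.
  have h' j : w (s j) = 0 by apply/eqP; have /eqP := h j; rewrite intr_eq0.
  by case: (cov i) => ->; rewrite ?h' ?wk.
have e i : z k * (mi i)%:Z = (mi k)%:Z * z i by apply/eqP; rewrite -subr_eq0 -/(w i) w0.
have mpos i : (0 : int) < (mi i)%:Z by rewrite ltz_nat.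
have [zk|zk|zk] := ltgtP (z k) 0.
- apply: Or33 => i; have : (mi k)%:Z * z i < 0 by rewrite -e nmulr_rlt0.
  by rewrite pmulr_rlt0.
- apply: Or32 => i; have : 0 < (mi k)%:Z * z i by rewrite -e mulr_gt0.
  by rewrite pmulr_rgt0.
- apply: Or31 => i; have /eqP := e i; rewrite zk mul0r eq_sym mulf_eq0.
  by case/orP => [/eqP h|/eqP//]; have := mpos k; rewrite h ltxx.
Qed.

Lemma sign_related_neq (lam : 'I_3 -> C) i j : sign_related lam -> i != j -> lam i != lam j.
Proof.
move=> rel nij; apply/eqP => e.
have := rel (fun k => (k == i)%:Z - (k == j)%:Z).
have -> : \sum_k ((k == i)%:Z - (k == j)%:Z)%:~R * lam k = 0.
  have d l : \sum_k ((k == l)%:Z)%:~R * lam k = lam l.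
    by rewrite (bigD1 l) //= eqxx mul1r big1 ?addr0 // => k nk; rewrite (negPf nk) mul0r.
  under eq_bigr do rewrite rmorphB mulrBl.
  by rewrite sumrB !d e subrr.
case=> // h.
- by have := h i; rewrite eqxx (negPf nij).
- by have := h j; rewrite eqxx eq_sym (negPf nij).
- by have := h i; rewrite eqxx (negPf nij).
Qed.

End SignRelation.

Section FrameExistence.
Variable C : numClosedFieldType.
Local Notation hom k := (pihomog mdeg k).

Lemma char_poly_row2 (A B : 'M[C]_3) : (forall j, j != 2 -> A 2 j = 0) -> (forall j, j != 2 -> B 2 j = 0) ->
  A 2 2 = B 2 2 -> (forall i j, i != 2 -> j != 2 -> A i j = B i j) -> char_poly A = char_poly B.
Proof.
move=> a0 b0 e22 e; rewrite /char_poly.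
have D (M : 'M[C]_3) : (forall j, j != 2 -> M 2 j = 0) ->
    \det (char_poly_mx M) = char_poly_mx M 2 2 * cofactor (char_poly_mx M) 2 2.
  move=> m0; rewrite (expand_det_row _ 2) (bigD1 2) //= big1 ?addr0 // => j nj.
  by rewrite !mxE m0 // eq_sym (negPf nj) mulr0n subr0 mul0r.
rewrite !D // !mxE e22; congr (_ * (_ * _)); congr (\det _).
apply/matrixP => i j; rewrite !mxE e //; by rewrite eq_sym neq_lift.
Qed.

Lemma dehom_low D (g : {mpoly C[3]}) : (msize g <= D)%N -> exists q, dehom D g = 'X_2 * q.
Proof.
move=> szg; apply: planar_eq0.
apply: (linear_eq_supp (f := fun p => dehom D p \mPo planar C) (g := fun p => 0)).
- by move=> c a b; rewrite linearP comp_mpolyD comp_mpolyZ.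
- by move=> c a b; rewrite scaler0 addr0.
move=> k ks; have lt := leq_trans (msize_mdeg_lt ks) szg.
rewrite dehomX comp_mpolyX (bigD1 2) //= planar2 chart_mnm2 expr0n subn_eq0 leqNgt lt mul0r //.
Qed.

Lemma vhpart_id (f : vfield C) m : vhpart m (vhpart m f) = vhpart m f.
Proof. by apply: boolp.funext => i; rewrite /vhpart !hpartE pihomog_id. Qed.

Lemma msize_vhpart (f : vfield C) m i : (msize (vhpart m f i) <= m.+1)%N.
Proof. by apply/msize_leP => j le; rewrite (pihomog_ne0 _ (pihomogP _ m _)) // ltn_eqF. Qed.

(** The lower components of [f] contribute multiples of x4 to the first two components of the
    Poincare transform, so they change the Jacobian only in the last column above the diagonal. As
    its last row is diagonal, the characteristic polynomial stays the same. *)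
Lemma propertyE_top (f : vfield C) m : (forall i, msize (f i) <= m.+1)%N ->
  propertyE f m -> propertyE (vhpart m f) m.
Proof.
move=> szf E v v0; rewrite vhpart_id => -[c pv] T uT Tv lam cp.
apply: (E v v0 _ T uT Tv lam); first by exists c.
rewrite -cp; have szp := @msize_vhpart f m.
have pv' : vfeval (vhpart m (vhpart m f)) v = c *: v by rewrite vhpart_id.
apply: char_poly_row2.
- by move=> j nj; have e := jac0_row2 szf uT Tv pv j; rewrite (negPf nj) mulr0 in e.
- by move=> j nj; have e := jac0_row2 szp uT Tv pv' j; rewrite (negPf nj) mulr0 in e.
- exact: etrans (jac0_row2 szf uT Tv pv 2) (esym (jac0_row2 szp uT Tv pv' 2)).
have low k : exists q, G f m T k = G (vhpart m f) m T k + 'X_2 * q.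
  have [|q hq] := @dehom_low m (conjvf T f k - conjvf T (vhpart m f) k).
    have -> : conjvf T (vhpart m f) k = hom m (conjvf T f k).
      rewrite /conjvf raddf_sum; apply: eq_bigr => l _.
      by rewrite /= linearZ /= pihomog_linsubst.
    apply/msize_leP => j; rewrite leq_eqVlt raddfB /= => /orP[/eqP<-|lt].
      by rewrite pihomog_id subrr.
    rewrite (pihomog_ne0 _ (pihomogP _ m _)) ?ltn_eqF // subr0.
    by have /msize_leP -> := size_conj T szf k.
  by exists q; rewrite /G -hq linearB addrC subrK.
have [q0 h0] := low 0; have [q1 h1] := low 1; have [q2 h2] := low 2.
have X0d (q : {mpoly C[3]}) j : j != 2 -> ('X_2 * q)^`M(j)@_0%MM = 0.
  move=> nj; rewrite mderivM mderivXU eq_sym (negPf nj) mul0r add0r.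
  by apply: (ordgeMr _ (ordgeXi _ _)); rewrite mdeg0.
have aux (i : 'I_3) : i != 2 -> exists q, poincare m T f i = poincare m T (vhpart m f) i + 'X_2 * q.
  move: i; apply: ord3P => // _.
    exists (q1 - q0 * 'X_0).
    rewrite (chart0 T szf) (chart0 T szp) h0 h1; move: (G _ _ _ 0) (G _ _ _ 1) => u w.
    have aux (R : comPzRingType) (a b x y s t : R) :
       - ((a + y * s) * x) + (b + y * t) = - (a * x) + b + y * (t - s * x) by ring.
    exact: aux.
  exists (q2 - q0 * 'X_1).
  rewrite (chart1 T szf) (chart1 T szp) h0 h2; move: (G _ _ _ 0) (G _ _ _ 2) => u w.
  have aux (R : comPzRingType) (a b x y s t : R) :
     - ((a + y * s) * x) + (b + y * t) = - (a * x) + b + y * (t - s * x) by ring.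
  exact: aux.
move=> i j ni nj; have [q e] := aux i ni.
have ef := jac0E f m T i j; have ep := jac0E (vhpart m f) m T i j.
have key (a b r : {mpoly C[3]}) : a = b + 'X_2 * r -> (a^`M(j))@_0%MM = (b^`M(j))@_0%MM.
  by move=> ->; rewrite mderivD mcoeffD X0d // addr0.
exact: etrans ef (etrans (key _ _ _ e) (esym ep)).
Qed.

(** Given a dependency between the rows, multiplication by (J - lam b')(J - lam k) leaves only the
    row of index a. *)
Lemma left_eigenmatrix_unit (J P : 'M[C]_3) (lam : 'I_3 -> C) :
  (forall i b, \sum_k P i k * J k b = lam i * P i b) ->
  (forall i j, i != j -> lam i != lam j) -> (forall i, exists b, P i b != 0) -> P \in unitmx.
Proof.
move=> PJ neq P0; rewrite unitmxE unitfE; apply/negP => /det0P[u u0 uP].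
have step (x : 'I_3 -> C) : (forall b, \sum_i x i * P i b = 0) -> forall b, \sum_i x i * lam i * P i b = 0.
  move=> h b; transitivity (\sum_k (\sum_i x i * P i k) * J k b).
    under [RHS]eq_bigr do rewrite mulr_suml.
    rewrite exchange_sum; apply: eq_bigr => i _.
    by rewrite -mulrA -PJ mulr_sumr; apply: eq_bigr => k _; rewrite mulrA.
  by rewrite big1 // => k _; rewrite h mul0r.
have h0 b : \sum_i u 0 i * P i b = 0.
  by have := congr1 (fun A : 'rV_3 => A 0 b) uP; rewrite !mxE.
have h1 := step _ h0; have h2 := step _ h1.
case/negP: u0; apply/eqP/rowP => i; rewrite mxE.
have [b Pib] := P0 i; apply: (mulIf Pib); rewrite mul0r.
have key (a b' k : 'I_3) : a != b' -> a != k -> (forall F : 'I_3 -> C, \sum_i F i = F a + F b' + F k) ->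
   u 0 a * P a b = 0.
  move=> nab nak sumE; move: (h0 b) (h1 b) (h2 b); rewrite !sumE => e0 e1 e2.
  have : (lam a - lam b') * (lam a - lam k) * (u 0 a * P a b) = 0.
    transitivity ((u 0 a * lam a * lam a * P a b + u 0 b' * lam b' * lam b' * P b' b + u 0 k * lam k * lam k * P k b)
      - (lam b' + lam k) * (u 0 a * lam a * P a b + u 0 b' * lam b' * P b' b + u 0 k * lam k * P k b)
      + lam b' * lam k * (u 0 a * P a b + u 0 b' * P b' b + u 0 k * P k b)); first by ring.
    by rewrite e0 e1 e2 !mulr0 subr0 addr0.
  by move/eqP; rewrite !mulf_eq0 !subr_eq0 (negPf (neq _ _ nab)) (negPf (neq _ _ nak)) /= => /orP[/eqP->|/eqP->]; rewrite ?mul0r ?mulr0.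
move: i Pib; apply: ord3P => _.
- by apply: (key 0 1 2) => // F; rewrite sum3E.
- by apply: (key 1 0 2) => // F; rewrite sum3E [F 1 + F 0]addrC.
- by apply: (key 2 0 1) => // F; rewrite sum3E [LHS]addrC addrA.
Qed.

Lemma eigenframe_exists (f : vfield C) m v c : (forall i, msize (f i) <= m.+1)%N ->
  propertyE f m -> v != 0 -> vfeval (vhpart m f) v = c *: v ->
  exists T P lam, [/\ T \in unitmx, T *m v = e1 C & eigenframe f m T P lam].
Proof.
move=> szf E v0 pv; have [A uA Av] := exists_frame 0 v0.
pose T := invmx A; have uT : T \in unitmx by rewrite unitmx_inv.
have Tv : T *m v = e1 C by rewrite -Av mulKmx.
pose J := jac0 (poincare m T f); have row2 := jac0_row2 szf uT Tv pv.
have rt : root (char_poly J) (- c).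
  rewrite -eigenvalue_root_char; apply/eigenvalueP; exists (delta_mx 0 2).
    rewrite -rowE; apply/rowP => j; rewrite [LHS]mxE [LHS]row2 !mxE /=; by [].
  by apply/eqP => /rowP/(_ 2)/eqP; rewrite !mxE !eqxx oner_eq0.
have [rs rsE] := closed_field_poly_normal (char_poly J).
have mon := char_poly_monic J; rewrite (monicP mon) scale1r in rsE.
have crs : - c \in rs by move: rt; rewrite rsE root_prod_XsubC.
have szrs : size rs = 3%N.
  by have := size_char_poly J; rewrite rsE size_prod_XsubC => -[].
have perm := perm_to_rem crs; have : size (rem (- c) rs) = 2%N by rewrite size_rem // szrs.
case rE : (rem (- c) rs) perm => [|a [|b [|]]] // perm _.
(* The eigenvalue -c, whose left eigenvector is the last unit row, is listed last to match [P2]. *)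
pose lam (i : 'I_3) := match nat_of_ord i with 0%N => a | 1%N => b | _ => - c end.
have cp : char_poly J = \prod_(i < 3) ('X - (lam i)%:P).
  rewrite rsE (perm_big _ perm) !big_cons big_nil ?mulr1 !big_ord_recl big_ord0 ?mulr1 /lam /=; ring.
have rel : sign_related lam.
  apply: sign_related_propertyE; apply: (E v v0 _ T uT Tv lam cp); by exists c.
have evl i : exists2 l : 'rV[C]_3, l *m J = lam i *: l & l != 0.
  apply/eigenvalueP; rewrite eigenvalue_root_char cp /root horner_prod (bigD1 i) //=.
  by rewrite hornerXsubC subrr mul0r.
have [l0 e0 n0] := evl 0; have [l1 e1' n1] := evl 1.
pose P : 'M[C]_3 := \matrix_(i, j) (match nat_of_ord i with 0%N => l0 0 j | 1%N => l1 0 j | _ => (j == 2)%:R end).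
have P0k k : P 0 k = l0 0 k by rewrite mxE.
have P1k k : P 1 k = l1 0 k by rewrite mxE.
have P2k k : P 2 k = (k == 2)%:R by rewrite mxE.
have PJ i b' : \sum_k P i k * J k b' = lam i * P i b'.
  move: i; apply: ord3P.
  - have := congr1 (fun A : 'rV_3 => A 0 b') e0; rewrite [LHS]mxE [RHS]mxE P0k => <-.
    by apply: eq_bigr => k _; rewrite P0k.
  - have := congr1 (fun A : 'rV_3 => A 0 b') e1'; rewrite [LHS]mxE [RHS]mxE P1k => <-.
    by apply: eq_bigr => k _; rewrite P1k.
  - rewrite (bigD1 2) //= big1 => [|k nk]; last by rewrite P2k (negPf nk) mul0r.
    by rewrite !P2k eqxx mul1r addr0 row2.
have P0 i : exists b, P i b != 0.
  have nz (l : 'rV[C]_3) : l != 0 -> exists b, l 0 b != 0.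
    move=> nl; apply: boolp.contrapT => no; case/negP: nl; apply/eqP/rowP => k; rewrite mxE.
    by apply/eqP/negPn/negP => lk; apply: no; exists k.
  move: i; apply: ord3P.
  - by have [k lk] := nz _ n0; exists k; rewrite mxE.
  - by have [k lk] := nz _ n1; exists k; rewrite mxE.
  - by exists 2; rewrite P2k oner_neq0.
exists T, P, lam; split=> //; split=> //.
apply: (left_eigenmatrix_unit PJ) => // i j; exact: sign_related_neq.
Qed.

End FrameExistence.

Lemma euler_homog (C : fieldType) n d (p : {mpoly C[n]}) : p \is d.-homog ->
  \sum_i 'X_i * p^`M(i) = d%:R * p.
Proof.
move=> hp; apply/mpolyP => k; rewrite (raddf_sum (mcoeff k)) -mpolyC_nat mcoeffCM.
under eq_bigr do rewrite /= mcoeff_X_deriv.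
rewrite -mulr_suml -natr_sum -mdegE.
have [dk|nk] := eqVneq (mdeg k) d; first by rewrite dk.
by rewrite (dhomog_nemf_coeff hp nk) !mulr0.
Qed.

Lemma euler_ev (C : fieldType) d (p : {mpoly C[3]}) v : p \is d.-homog ->
  ev (mdir v p) v = d%:R * ev p v.
Proof.
move=> hp; have := congr1 (fun q => ev q v) (euler_homog hp).
rewrite /ev mevalM -mpolyC_nat mevalC => <-.
rewrite /mdir !(raddf_sum (meval _)); apply: eq_bigr => i _ /=.
by rewrite mevalZ mevalM mevalXU.
Qed.

Lemma mdir_homog (C : fieldType) d u (p : {mpoly C[3]}) : p \is d.+1.-homog -> mdir u p \is d.-homog.
Proof. by move=> hp; apply: rpred_sum => i _; apply: rpredZ; apply: mderiv_homog hp. Qed.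

Lemma mdirD (C : fieldType) a b u w (p : {mpoly C[3]}) :
  mdir (a *: u + b *: w) p = a *: mdir u p + b *: mdir w p.
Proof.
rewrite /mdir !scaler_sumr -big_split; apply: eq_bigr => i _ /=.
by rewrite !mxE scalerDl !scalerA.
Qed.

Definition columns3 (C : fieldType) (v q1 q2 : 'cV[C]_3) : 'M[C]_3 :=
  \matrix_(i, j) (match nat_of_ord j with 0%N => v i 0 | 1%N => q1 i 0 | _ => q2 i 0 end).

Lemma columns3_mul (C : fieldType) (v q1 q2 x : 'cV[C]_3) :
  columns3 v q1 q2 *m x = x 0 0 *: v + x 1 0 *: q1 + x 2 0 *: q2.
Proof. by apply/colP => i; rewrite mxE sum3E !mxE /=; ring. Qed.

Lemma columns3_unit (C : fieldType) (v q1 q2 : 'cV[C]_3) : lin_indep3 v q1 q2 ->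
  columns3 v q1 q2 \in unitmx.
Proof.
move=> ind; rewrite -unitmx_tr unitmxE unitfE; apply/negP => /det0P[u u0 uM].
have Mu : columns3 v q1 q2 *m u^T = 0 by rewrite -(trmxK (columns3 _ _ _)) -trmx_mul uM trmx0.
rewrite columns3_mul in Mu; have [a0 b0 c0] := ind _ _ _ Mu; case/negP: u0; apply/eqP/rowP => i.
move: a0 b0 c0; rewrite !mxE; move: i; apply: ord3P => //.
Qed.

Lemma lin_indep3_span (C : fieldType) (v q1 q2 : 'cV[C]_3) : lin_indep3 v q1 q2 ->
  forall w, exists a b c, w = a *: v + b *: q1 + c *: q2.
Proof.
move=> /columns3_unit uM w; set M := columns3 v q1 q2 in uM.
by exists ((invmx M *m w) 0 0), ((invmx M *m w) 1 0), ((invmx M *m w) 2 0); rewrite -columns3_mul mulKVmx.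
Qed.

(** * The local shape of invariant curves *)

Section NodePackage.
Variable C : numClosedFieldType.
Local Notation S := {mpoly C[3]}.
Local Notation hom k := (pihomog mdeg k).

Definition bilinear2 (u w : 'cV[C]_3) (psi : S) v := ev (mdir u (mdir w psi)) v.

(* The behaviour at v of an irreducible invariant curve: smooth and transversal
   to q1, smooth and transversal to q2, or an ordinary node whose two tangent
   lines are spanned by q1 and q2. *)
Definition node_type (v q1 q2 : 'cV[C]_3) (br : bool -> S -> Prop) (psi : S) :=
  [\/ [/\ br true psi, ev (mdir q1 psi) v != 0 & ev (mdir q2 psi) v = 0],
      [/\ br false psi, ev (mdir q2 psi) v != 0 & ev (mdir q1 psi) v = 0]
    | [/\ br true psi /\ br false psi, forall w, ev (mdir w psi) v = 0,
          bilinear2 q1 q2 psi v != 0, bilinear2 q1 q1 psi v = 0 & bilinear2 q2 q2 psi v = 0]].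

Section WithFrame.
Variables (f : vfield C) (m : nat) (v : 'cV[C]_3) (T : 'M[C]_3) (c : C).
Hypothesis sizef : forall i, (msize (f i) <= m.+1)%N.
Hypothesis unitT : T \in unitmx.
Hypothesis Tv : T *m v = e1 C.
Hypothesis pv : vfeval (vhpart m f) v = c *: v.
Variables (P : 'M[C]_3) (lam : 'I_3 -> C).
Hypothesis frame : eigenframe f m T P lam.

(** The label [true] stands for the branch y_0 = t, and [false] for the one obtained by exchanging
    y_0 and y_1. *)
Definition on_branch (b : bool) g := exists i j, local_weight f m T lam g i j /\
  (0 < if b then i else j)%N.

Lemma on_branch_unique b g h : g != 0 -> h != 0 -> mcoprime g h ->
  on_branch b g -> on_branch b h -> False.
Proof.
case: b => g0 h0 cop [i [j [wg pos]]] [i' [j' [wh pos']]].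
  exact: (branch_not_shared sizef unitT Tv pv frame g0 h0 cop wg wh).
have fr := eigenframe_swap frame.
exact: (branch_not_shared sizef unitT Tv pv fr g0 h0 cop (local_weight_swap wg) (local_weight_swap wh)).
Qed.

Lemma on_some_branch g : semi_invariant f g -> ev (hom (msize g).-1 g) v = 0 ->
  exists b, on_branch b g.
Proof.
move=> sg gv; have [i [j [w pos]]] := local_weight_exists sizef unitT Tv pv frame sg.
move: (pos gv); rewrite addn_gt0 => /orP[i0|j0]; [exists true|exists false]; by exists i, j.
Qed.

Let uP : P \in unitmx. Proof. by case: frame. Qed.
Let P2 : forall b, P 2 b = (b == 2)%:R. Proof. by case: frame. Qed.
Let rel : sign_related lam. Proof. by case: frame. Qed.
Local Notation q1 := (frame_dir T P 0).
Local Notation q2 := (frame_dir T P 1).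

Lemma weight_unique (i j i' j' : nat) :
  i%:R * lam 0 + j%:R * lam 1 = i'%:R * lam 0 + j'%:R * lam 1 -> i = i' /\ j = j'.
Proof.
move=> e; pose z (k : 'I_3) := match nat_of_ord k with 0%N => i%:Z - i'%:Z | 1%N => j%:Z - j'%:Z | _ => 0 end.
have := rel (z := z); rewrite sum3E /z /= => h.
case: h.
- rewrite !rmorphB /= -!pmulrn mul0r addr0.
  transitivity ((i%:R * lam 0 + j%:R * lam 1) - (i'%:R * lam 0 + j'%:R * lam 1)); first by ring.
  by rewrite e subrr.
- by move=> h0; have := h0 0; have := h0 1; rewrite /=; lia.
- by move=> h0; have := h0 2; rewrite /= ltxx.
- by move=> h0; have := h0 2; rewrite /= ltxx.
Qed.

Lemma mnm2P (a b : 'X_{1..2}) : a 0 = b 0 -> a 1 = b 1 -> a = b.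
Proof.
move=> e0 e1; apply/mnmP => -[[|[|i]] hi] //.
  by move: e0; congr (_ = _); congr (fun_of_multinom _ _); apply/val_inj.
by move: e1; congr (_ = _); congr (fun_of_multinom _ _); apply/val_inj.
Qed.

(** On the plane at infinity the local equation has one monomial of lowest degree, with both
    exponents at most 1 by [branch_multiplicity]. Since psi(v) = 0 it is y_0, y_1 or y_0 y_1, and
    low coefficients are derivatives of [psi] along the frame. *)
Lemma homog_node psi : mirreducible psi -> mhomogeneous psi -> semi_invariant f psi ->
  ev psi v = 0 -> node_type v q1 q2 on_branch psi.
Proof.
move=> irr [d hpsi] sg psiv; have [D szp] := semi_invariant_size sg.
have psi0 := mirreducible_neq0 irr.
have dD : d = D.+1 by have := msize_hom hpsi psi0; rewrite szp => -[].
rewrite {d}dD in hpsi.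
have szp' : (msize psi <= D.+2)%N by rewrite szp.
have [_ [mu Xg]] := sg; have [kappa cof] := chart_semi_invariant sizef unitT Xg szp.
have top : hom D.+1 psi != 0 by rewrite pihomog_dE.
have [k [Gk low wk]] := planar_weight_exists sizef unitT Tv pv frame szp' top cof.
have uniq k' : (hat T P D.+1 psi \mPo planar C)@_k' != 0 -> mdeg k' = mdeg k -> k' = k.
  move=> Gk' dk'; have := planar_weight sizef unitT Tv pv frame szp' top cof Gk'.
  rewrite dk' -wk => /(_ low)/weight_unique[e0 e1]; exact: mnm2P.
have w : local_weight f m T lam psi (k 0) (k 1) by exists kappa; rewrite szp.
have k0 := branch_multiplicity sizef unitT Tv pv frame irr w.
have k1 := branch_multiplicity sizef unitT Tv pv (eigenframe_swap frame) irr (local_weight_swap w).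
have dk0 : mdeg k != 0%N.
  apply: contraNneq Gk => /eqP; rewrite mdeg_eq0 => /eqP->.
  rewrite mcoeff0_comp => [|i]; last exact: planar_ordge.
  by rewrite (mcoeff0_hat unitT Tv) // pihomog_dE // psiv.
have md2 (a : 'X_{1..2}) : mdeg a = (a 0%R + a 1%R)%N.
  by rewrite mdegE !big_ord_recl big_ord0 addn0; congr (_ + _)%N; congr (fun_of_multinom _ _); apply/val_inj.
have D1 (i : 'I_3) : i != 2 -> ev (mdir (frame_dir T P i) psi) v = (hat T P D.+1 psi)@_U_(i).
  move=> ni; have hd := mdir_homog (frame_dir T P i) hpsi.
  rewrite -{1}(pihomog_dE hd) -(mcoeff0_hat unitT Tv P); last first.
    by apply/msize_leP => j le; apply: (pihomog_ne0 _ hd); rewrite ltn_eqF.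
  by rewrite -(mderiv_hat T uP P2) // mcoeff_deriv add0m mnm0E mulr1n.
have U0 : planar_mnm U_(0%R) = U_(0%R)%MM by apply: mnm3P; rewrite !mnmE.
have U1 : planar_mnm U_(1%R) = U_(1%R)%MM by apply: mnm3P; rewrite !mnmE.
have d1 : ev (mdir q1 psi) v = (hat T P D.+1 psi \mPo planar C)@_U_(0%R) by rewrite D1 // mcoeff_planar U0.
have d2 : ev (mdir q2 psi) v = (hat T P D.+1 psi \mPo planar C)@_U_(1%R) by rewrite D1 // mcoeff_planar U1.
have zero k' : mdeg k' = mdeg k -> k' != k -> (hat T P D.+1 psi \mPo planar C)@_k' = 0.
  by move=> dk' nk; apply/eqP/negPn/negP => /uniq/(_ dk')/eqP; apply/negP.
have : [\/ k = U_(0%R)%MM, k = U_(1%R)%MM | k = (U_(0%R) + U_(1%R))%MM].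
  move: dk0 k0 k1; rewrite md2.
  have kE a b : k 0 = a -> k 1 = b -> forall k' : 'X_{1..2}, k' 0 = a -> k' 1 = b -> k = k'.
    by move=> ea eb k' ea' eb'; apply: mnm2P; rewrite ?ea ?eb.
  case e0 : (k 0) => [|[|?]] //; case e1 : (k 1) => [|[|?]] // _ _ _.
  - by apply: Or32; apply: (kE _ _ e0 e1); rewrite mnm1E.
  - by apply: Or31; apply: (kE _ _ e0 e1); rewrite mnm1E.
  - by apply: Or33; apply: (kE _ _ e0 e1); rewrite mnmDE !mnm1E.
case=> kE; rewrite kE in Gk low zero.
- apply: Or31; split; [|by rewrite d1|by rewrite d2 zero ?mdeg1 ?eq_mnm1].
  by exists (k 0), (k 1); split; [exact: w|rewrite kE mnm1E].
- apply: Or32; split; [|by rewrite d2|by rewrite d1 zero ?mdeg1 ?eq_mnm1].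
  by exists (k 0), (k 1); split; [exact: w|rewrite kE mnm1E].
apply: Or33.
have grad1 : ev (mdir q1 psi) v = 0 by rewrite d1 low // mdegD !mdeg1.
have grad2 : ev (mdir q2 psi) v = 0 by rewrite d2 low // mdegD !mdeg1.
have grad w' : ev (mdir w' psi) v = 0.
  have [x [y [z ->]]] := lin_indep3_span (frame_dir_indep unitT Tv frame) w'.
  have -> : x *: v + y *: q1 + z *: q2 = 1 *: (x *: v + y *: q1) + z *: q2 by rewrite scale1r.
  rewrite !mdirD /ev mevalD !mevalZ mevalD !mevalZ -!/(ev _ _) grad1 grad2 (euler_ev _ hpsi) psiv.
  by rewrite !mulr0 !addr0 mulr0.
(* A linear form has no second derivatives, so y_0 y_1 cannot be its lowest monomial; the degree is
   at least 2. *)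
case: D szp hpsi szp' cof top Gk low uniq w D1 d1 d2 zero => [|D] szp hpsi szp' cof top Gk low uniq w D1 d1 d2 zero.
  have [a0 a0E] := homog0_const (mdir_homog q1 hpsi).
  have hE : (hat T P 1 psi)^`M(0) = a0%:MP.
    rewrite (mderiv_hat T uP P2) // a0E /hat comp_mpolyC.
    have -> : a0%:MP = a0 *: 1 :> S by rewrite -mul_mpolyC mulr1.
    by rewrite linearZ /= dehom1 comp_mpolyZ rmorph1.
  have : ((hat T P 1 psi)^`M(0))^`M(1)@_0%MM = 0 by rewrite hE mderivC mcoeff0.
  rewrite !mcoeff_deriv add0m mnm0E mulr1n mnm1E /= mulr1n => e.
  move: Gk; rewrite mcoeff_planar (_ : planar_mnm _ = (U_(1%R) + U_(0%R))%MM) ?e ?eqxx //.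
  by apply: mnm3P; rewrite !mnmE.
have H (i j : 'I_3) : i != 2 -> j != 2 ->
    bilinear2 (frame_dir T P i) (frame_dir T P j) psi v =
    (hat T P D.+2 psi)@_(U_(i) + U_(j)) *+ (i == j).+1.
  move=> ni nj; have hd := mdir_homog (frame_dir T P i) (mdir_homog (frame_dir T P j) hpsi).
  rewrite /bilinear2 -{1}(pihomog_dE hd) -(mcoeff0_hat unitT Tv P); last first.
    by apply/msize_leP => l le; apply: (pihomog_ne0 _ hd); rewrite ltn_eqF.
  rewrite -(mderiv_hat T uP P2) // -(mderiv_hat T uP P2) // !mcoeff_deriv.
  by rewrite add0m mnm0E mulr1n mnm1E.
have U01 : planar_mnm (U_(0%R) + U_(1%R)) = (U_(0%R) + U_(1%R))%MM by apply: mnm3P; rewrite !mnmE.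
have U00 : planar_mnm (U_(0%R) + U_(0%R)) = (U_(0%R) + U_(0%R))%MM by apply: mnm3P; rewrite !mnmE.
have U11 : planar_mnm (U_(1%R) + U_(1%R)) = (U_(1%R) + U_(1%R))%MM by apply: mnm3P; rewrite !mnmE.
have ne (a : 'X_{1..2}) i : a i != (U_(0%R) + U_(1%R))%MM i -> a != (U_(0%R) + U_(1%R))%MM.
  by apply: contraNneq => ->.
split.
- by split; exists (k 0), (k 1); (split; [exact: w|rewrite kE mnmDE !mnm1E]).
- exact: grad.
- by rewrite H // -U01 -mcoeff_planar.
- rewrite H // -U00 -mcoeff_planar zero ?mul0rn // ?mdegD ?mdeg1 //.
  by apply: (ne _ 1); rewrite !mnmDE !mnm1E.
- rewrite H // -U11 -mcoeff_planar zero ?mul0rn // ?mdegD ?mdeg1 //.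
  by apply: (ne _ 1); rewrite !mnmDE !mnm1E.
Qed.

End WithFrame.

(** Hides charts and eigenvalues from the rest of the proof: what remains are two directions and a
    relation [br] with two labels, each taken by at most one of several pairwise coprime curves. *)
Theorem node_package (f : vfield C) m v c : (forall i, msize (f i) <= m.+1)%N ->
  propertyE f m -> v != 0 -> vfeval (vhpart m f) v = c *: v ->
  exists q1 q2 br, [/\ lin_indep3 v q1 q2,
    forall psi, mirreducible psi -> mhomogeneous psi -> semi_invariant (vhpart m f) psi ->
      ev psi v = 0 -> node_type v q1 q2 br psi
    & forall b g h, g != 0 -> h != 0 -> mcoprime g h -> br b g -> br b h -> False].
Proof.
move=> szf E v0 pv; have szp := @msize_vhpart C f m.
have Ep := propertyE_top szf E.
have pv' : vfeval (vhpart m (vhpart m f)) v = c *: v by rewrite vhpart_id.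
have [T [P [lam [uT Tv fr]]]] := eigenframe_exists szp Ep v0 pv'.
exists (frame_dir T P 0), (frame_dir T P 1), (on_branch (vhpart m f) m T lam); split.
- exact (frame_dir_indep uT Tv fr).
- by move=> psi irr hpsi sg psiv; apply: (homog_node szp uT Tv pv' fr).
- by move=> b g h g0 h0 cop; apply: (on_branch_unique szp uT Tv pv' fr).
Qed.

(** The local analysis is applied to [f] itself at a point of the plane at infinity: two labels
    cannot serve three coprime polynomials. *)
Theorem three_coprime_absurd (f : vfield C) m v c (g : nat -> S) :
  (forall i, msize (f i) <= m.+1)%N ->
  propertyE f m -> v != 0 -> vfeval (vhpart m f) v = c *: v ->
  (forall i, semi_invariant f (g i)) -> (forall i j, i != j -> mcoprime (g i) (g j)) ->
  (forall i, (i < 3)%N -> ev (hom (msize (g i)).-1 (g i)) v = 0) -> False.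
Proof.
move=> szf E v0 pv sg cop gv.
have [T [P [lam [uT Tv fr]]]] := eigenframe_exists szf E v0 pv.
have br i : (i < 3)%N -> exists b, on_branch f m T lam b (g i).
  by move=> lt; apply: (on_some_branch szf uT Tv pv fr (sg i)); apply: gv.
have [b0 h0] := br 0%N isT; have [b1 h1] := br 1%N isT; have [b2 h2] := br 2%N isT.
have no i j b : i != j -> on_branch f m T lam b (g i) -> on_branch f m T lam b (g j) -> False.
  move=> nij; apply: (on_branch_unique szf uT Tv pv fr); last exact: cop.
    exact: semi_invariant_neq0 (sg i).
  exact: semi_invariant_neq0 (sg j).
case: b0 h0 => h0; case: b1 h1 => h1; case: b2 h2 => h2;
  by [apply: (no 0%N 1%N) h0 h1 | apply: (no 0%N 2%N) h0 h2 | apply: (no 1%N 2%N) h1 h2].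
Qed.

End NodePackage.

(** * Points where invariant curves meet *)

Section Cross.
Variable C : fieldType.
Implicit Types u v w : 'cV[C]_3.

Definition det3 u v w : C :=
  u 0 0 * (v 1 0 * w 2 0 - v 2 0 * w 1 0) + u 1 0 * (v 2 0 * w 0 0 - v 0 0 * w 2 0)
  + u 2 0 * (v 0 0 * w 1 0 - v 1 0 * w 0 0).

Lemma det3_indep u v w : det3 u v w != 0 -> lin_indep3 u v w.
Proof.
move=> d0 a b c e.
have e0 i := congr1 (fun A : 'cV_3 => A i 0) e.
move: (e0 0) (e0 1) (e0 2); rewrite !mxE => h0 h1 h2.
have H x : x * det3 u v w = 0 -> x = 0 by move/eqP; rewrite mulf_eq0 (negPf d0) orbF => /eqP.
split; apply: H; rewrite /det3.
- transitivity ((a * u 0 0 + b * v 0 0 + c * w 0 0) * (v 1 0 * w 2 0 - v 2 0 * w 1 0)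
    + (a * u 1 0 + b * v 1 0 + c * w 1 0) * (v 2 0 * w 0 0 - v 0 0 * w 2 0)
    + (a * u 2 0 + b * v 2 0 + c * w 2 0) * (v 0 0 * w 1 0 - v 1 0 * w 0 0)); first by ring.
  by rewrite h0 h1 h2 !mul0r !addr0.
- transitivity ((a * u 0 0 + b * v 0 0 + c * w 0 0) * (w 1 0 * u 2 0 - w 2 0 * u 1 0)
    + (a * u 1 0 + b * v 1 0 + c * w 1 0) * (w 2 0 * u 0 0 - w 0 0 * u 2 0)
    + (a * u 2 0 + b * v 2 0 + c * w 2 0) * (w 0 0 * u 1 0 - w 1 0 * u 0 0)); first by ring.
  by rewrite h0 h1 h2 !mul0r !addr0.
- transitivity ((a * u 0 0 + b * v 0 0 + c * w 0 0) * (u 1 0 * v 2 0 - u 2 0 * v 1 0)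
    + (a * u 1 0 + b * v 1 0 + c * w 1 0) * (u 2 0 * v 0 0 - u 0 0 * v 2 0)
    + (a * u 2 0 + b * v 2 0 + c * w 2 0) * (u 0 0 * v 1 0 - u 1 0 * v 0 0)); first by ring.
  by rewrite h0 h1 h2 !mul0r !addr0.
Qed.

Lemma cV3P u v : u 0 0 = v 0 0 -> u 1 0 = v 1 0 -> u 2 0 = v 2 0 -> u = v.
Proof. by move=> *; apply/colP; apply: ord3P. Qed.

Lemma det3_collinear v w : v != 0 -> (forall u, det3 u v w = 0) -> exists c, w = c *: v.
Proof.
move=> v0 h; have E i j : (delta_mx i 0 : 'cV[C]_3) j 0 = (j == i)%:R by rewrite mxE andbT.
have h0 : v 1 0 * w 2 0 = v 2 0 * w 1 0.
  by have := h (delta_mx 0 0); rewrite /det3 !E /= mul1r !mul0r !addr0 => /eqP; rewrite subr_eq0 => /eqP.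
have h1 : v 2 0 * w 0 0 = v 0 0 * w 2 0.
  by have := h (delta_mx 1 0); rewrite /det3 !E /= mul1r !mul0r addr0 add0r => /eqP; rewrite subr_eq0 => /eqP.
have h2 : v 0 0 * w 1 0 = v 1 0 * w 0 0.
  by have := h (delta_mx 2 0); rewrite /det3 !E /= mul1r !mul0r !add0r => /eqP; rewrite subr_eq0 => /eqP.
have [vz0|vz0] := eqVneq (v 0 0) 0; last first.
  exists (w 0 0 / v 0 0); apply: cV3P; rewrite mxE; apply: (mulfI vz0).
  - by field.
  - by rewrite h2; field.
  - by rewrite -h1; field.
have [vz1|vz1] := eqVneq (v 1 0) 0; last first.
  exists (w 1 0 / v 1 0); apply: cV3P; rewrite mxE; apply: (mulfI vz1).
  - by rewrite -h2; field.
  - by field.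
  - by rewrite h0; field.
have vz2 : v 2 0 != 0.
  by apply: contraNneq v0 => vz2; apply/eqP/cV3P; rewrite ?mxE.
exists (w 2 0 / v 2 0); apply: cV3P; rewrite mxE; apply: (mulfI vz2).
- by rewrite h1; field.
- by rewrite -h0; field.
- by field.
Qed.

End Cross.

Section NonSingular.
Variable C : numClosedFieldType.
Local Notation S := {mpoly C[3]}.
Local Notation hom k := (pihomog mdeg k).
Variable X : vfield C.

Lemma ev_Xder (p : S) v : ev (Xder X p) v = ev (mdir (vfeval X v) p) v.
Proof.
rewrite /ev /Xder /mdir !(raddf_sum (meval _)); apply: eq_bigr => i _ /=.
by rewrite mevalM mevalZ mxE.
Qed.

Section Ideal.
Variables (v : 'cV[C]_3) (J : S -> Prop).
Hypothesis stableJ : forall a, J a -> J (Xder X a).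
Hypothesis vanishJ : forall a, J a -> ev a v = 0.

(** Applying [X] to L^(k+1) s lowers the exponent of [L] by one and brings out the factor (k+1)
    X(L), which does not vanish at [v]. *)
Lemma stable_ideal_power (L s : S) k : ev L v = 0 -> ev (Xder X L) v != 0 ->
  J (L ^+ k * s) -> ev s v = 0.
Proof.
move=> Lv XLv; elim: k s => [|k IH] s; first by rewrite expr0 mul1r => /vanishJ.
move/stableJ; rewrite XderM XderX => h.
have /IH : J (L ^+ k * (k.+1%:R * Xder X L * s + L * Xder X s)).
  have -> : L ^+ k * (k.+1%:R * Xder X L * s + L * Xder X s) =
    k.+1%:R * L ^+ k * Xder X L * s + L ^+ k.+1 * Xder X s by rewrite exprSr; ring.
  exact: h.
rewrite /ev mevalD !mevalM -/(ev L v) Lv mul0r addr0 -mpolyC_nat mevalC -/(ev _ _) -/(ev s v).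
by move/eqP; rewrite !mulf_eq0 pnatr_eq0 (negPf XLv) /= => /eqP.
Qed.

(** An algebraic substitute for the solution through the nonsingular point [v]. In the basis v,
    X(v), u the form [r] involves two coordinates, so vanishing at [v] means divisibility by the
    linear form [L]. The quotient times a power of [L] is still in [J], so this repeats until the
    degree is exhausted. *)
Lemma stable_ideal_no_cone u r : lin_indep3 v (vfeval X v) u ->
  (exists d, r \is d.-homog) -> mdir u r = 0 -> J r -> r = 0.
Proof.
move=> ind; have uM := columns3_unit ind; set M := columns3 _ _ _ in uM.
have Me0 : M *m delta_mx 0 0 = v.
  by rewrite columns3_mul !mxE /= scale1r !scale0r !addr0.
have Me1 : M *m delta_mx 1 0 = vfeval X v.
  by rewrite columns3_mul !mxE /= scale1r !scale0r add0r addr0.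
have Me2 : M *m delta_mx 2 0 = u.
  by rewrite columns3_mul !mxE /= scale1r !scale0r !add0r.
pose L : S := 'X_1 \mPo linsubst (invmx M).
have dirL w : mdir w L = ((invmx M *m w) 1 0)%:MP.
  rewrite /L mdir_linsubst /mdir (bigD1 1) //= big1 => [|i ni].
    by rewrite addr0 mderivXU eqxx comp_mpolyZ rmorph1 -mul_mpolyC mulr1.
  by rewrite mderivXU eq_sym (negPf ni) scaler0.
have Lv : ev L v = 0.
  by rewrite ev_linsubst -Me0 mulKmx // /ev mevalXU mxE.
have XLv : ev (Xder X L) v != 0.
  by rewrite ev_Xder dirL /ev mevalC -Me1 mulKmx // mxE oner_neq0.
have dirLu : mdir u L = 0 by rewrite dirL -Me2 mulKmx // mxE.
have L0 : L != 0.
  by apply: contraNneq XLv => ->; rewrite raddf0 /ev meval0.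
have L1 : msize L = 2%N.
  by apply: (@msize_hom _ _ _ 1) => //; rewrite /L comp_mpolyXt; exact: tnth_linsubst_homog.
have LE : L = 'X_1 \mPo linsubst (invmx M) by [].
clearbody L; suff H k n : (msize r < n)%N -> (exists d, r \is d.-homog) -> mdir u r = 0 -> J (L ^+ k * r) -> r = 0.
  by move=> hr ur Jr; apply: (H 0%N (msize r).+1) => //; rewrite expr0 mul1r.
elim: n k r => // n IH k r lt [d hr] ur Jr; have rv := stable_ideal_power Lv XLv Jr.
have [//|r0] := eqVneq r 0; exfalso.
pose r' := r \mPo linsubst M.
(* A monomial of [r'] without X_1 would be X_0^d, because X_2 does not occur; its coefficient is
   r(v) = 0. *)
have [q rq] : exists q, r' = 'X_1 * q.
  exists (\sum_(m <- msupp r') r'@_m *: 'X_[m - U_(1)]).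
  rewrite mulr_sumr {1}(mpolyE r') big_seq [RHS]big_seq; apply: eq_bigr => m ms.
  suff m1 : (0 < m 1%R)%N by rewrite -scalerAr -mpolyXD addmC submK // lep1mP -lt0n.
  have hr' : r' \is d.-homog by apply: dhomog_linsubst.
  have md : mdeg m = d := dhomog_mf hr' ms.
  have m2 : m 2 = 0%N.
    apply/eqP; rewrite -leqn0 leqNgt; apply/negP => m2.
    have dr : r'^`M(2) = 0 by rewrite -mdir_delta mdir_linsubst Me2 ur rmorph0.
    have := mcoeff_deriv 2 (m - U_(2))%MM r'; rewrite dr mcoeff0 submK ?lep1mP -?lt0n //.
    by move/esym/eqP; rewrite mulrn_eq0 /= mcoeff_eq0 ms.
  rewrite lt0n; apply/negP => /eqP m1.
  have mE : m = (U_(0%R) *+ d)%MM.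
    apply: mnm3P; rewrite mulmnE mnm1E /= ?mul1n ?mul0n // -md mdeg3 m1 m2 !addn0 //.
  have : ev r' (delta_mx 0 0) = r'@_m.
    rewrite /ev mevalE (bigD1_seq m) ?msupp_uniq //= [X in _ + X]big1_seq => [|k' /andP[nk ks]].
      rewrite addr0 big1 ?mulr1 // => i _; rewrite mE mulmnE mnm1E mxE andbT eq_sym.
      by case: eqP; rewrite ?expr1n // mul0n expr0.
    have dk : mdeg k' = d := dhomog_mf hr' ks.
    have [i [ni ki]] : exists i : 'I_3, i != 0 /\ (0 < k' i)%N.
      apply: boolp.contrapT => no; case/negP: nk; apply/eqP.
      have z i : i != 0 -> k' i = 0%N.
        by move=> ni; apply/eqP; rewrite -leqn0 leqNgt; apply/negP => ki; apply: no; exists i.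
      have z1 := z 1 isT; have z2 := z 2 isT.
      by rewrite mE; apply: mnm3P; rewrite mulmnE mnm1E /= ?mul1n ?mul0n ?z1 ?z2 // -dk mdeg3 z1 z2 !addn0.
    by rewrite (bigD1 i) //= mxE (negPf ni) /= expr0n eqn0Ngt ki mul0r mulr0.
  rewrite ev_linsubst Me0 rv => /esym/eqP; rewrite mcoeff_eq0 ms //.
have rE : r = L * (q \mPo linsubst (invmx M)).
  by rewrite LE -comp_mpolyM -rq linsubstK.
move: (q \mPo _) rE => q' rE {rq}.
have q0 : q' != 0 by apply: contraNneq r0 => q0; rewrite rE q0 mulr0.
have hq : exists d, q' \is d.-homog.
  by apply: (@homog_factor _ _ q' L d); rewrite mulrC -rE.
have qz : q' = 0.
  apply: (IH k.+1 q'); last by rewrite exprSr -mulrA -rE.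
  - move: lt; rewrite rE msizeM // L1 add2n; exact.
  - exact: hq.
  - have := ur; rewrite rE mdirM dirLu mul0r add0r => /eqP.
    by rewrite mulf_eq0 (negPf L0) => /eqP.
by rewrite qz eqxx in q0.
Qed.

End Ideal.

Lemma independent_complement v : v != 0 -> ~ (exists c, vfeval X v = c *: v) ->
  exists u, u != 0 /\ lin_indep3 v (vfeval X v) u.
Proof.
move=> v0 nc.
have [u du] : exists u, det3 u v (vfeval X v) != 0.
  apply: boolp.contrapT => no; apply: nc; apply: det3_collinear => // u.
  by apply/eqP/negPn/negP => h; apply: no; exists u.
exists u; split; first by apply: contraNneq du => ->; rewrite /det3 !mxE !mul0r !addr0.
by apply: det3_indep; move: du; congr (_ != _); rewrite /det3; ring.
Qed.

(** The ideal of [psi] and [phi] is stable under [X]; at a nonsingular common zero, elimination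
    would put a forbidden form into it. *)
Lemma coprime_meet_singular psi phi v : psi != 0 -> mhomogeneous psi -> mhomogeneous phi ->
  semi_invariant X psi -> semi_invariant X phi -> mcoprime psi phi -> v != 0 ->
  ev psi v = 0 -> ev phi v = 0 -> exists c, vfeval X v = c *: v.
Proof.
move=> psi0 [d hd] [e he] [_ [mu Xpsi]] [_ [nu Xphi]] cop v0 psiv phiv.
apply: boolp.contrapT => nc; have [u [u0 ind]] := independent_complement v0 nc.
have [A [B [k [r0 dr hr]]]] := eliminate_homog u0 psi0 hd he cop.
move/eqP: r0; apply.
apply: (@stable_ideal_no_cone v (fun a => exists A B, a = A * psi + B * phi) _ _ u) => //.
- move=> a [A' [B' ->]]; exists (Xder X A' + A' * mu), (Xder X B' + B' * nu).
  by rewrite raddfD /= !XderM Xpsi Xphi; ring.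
- by move=> a [A' [B' ->]]; rewrite /ev mevalD !mevalM -!/(ev _ _) psiv phiv !mulr0 addr0.
- by exists k.
- by exists A, B.
Qed.

Lemma exists_mderiv_neq0 (p : S) : (1 < msize p)%N -> exists i, p^`M(i) != 0.
Proof.
move=> lt; apply: boolp.contrapT => no.
have dz i : p^`M(i) = 0 by apply/eqP/negPn/negP => h; apply: no; exists i.
have [m [ms m0]] : exists m, m \in msupp p /\ mdeg m != 0%N.
  have p0 : p != 0 by rewrite -msize_poly_eq0 -lt0n (ltn_trans _ lt).
  exists (mlead p); split; first exact: mlead_supp.
  by have := mlead_deg p0; rewrite -lt0n; move: lt; case: (msize p) => [|[|]] // k _ [->].
have [i mi] : exists i, (0 < m i)%N.
  apply: boolp.contrapT => noi; case/negP: m0; rewrite mdegE big1 // => i _.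
  by apply/eqP; rewrite -leqn0 leqNgt; apply/negP => mi; apply: noi; exists i.
have := mcoeff_deriv i (m - U_(i))%MM p; rewrite dz mcoeff0 submK ?lep1mP -?lt0n //.
by move/esym/eqP; rewrite mulrn_eq0 /= mcoeff_eq0 ms.
Qed.

Lemma irreducible_coprime_small psi (b : S) : mirreducible psi -> b != 0 ->
  (msize b < msize psi)%N -> mcoprime psi b.
Proof.
move=> irr b0 lt; apply: irreducible_coprime => // -[r bE].
have r0 : r != 0 by apply: contraNneq b0 => r0; rewrite bE r0 mulr0.
have := mirreducible_neq0 irr => psi0.
move: lt; rewrite bE msizeM //; have : msize r != 0%N by rewrite msize_poly_eq0.
by move: (msize r) (msize psi) => x y; lia.
Qed.

Lemma msize_mderiv_lt (p : S) i : p != 0 -> (msize p^`M(i) < msize p)%N.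
Proof.
move=> p0; have : msize p != 0%N by rewrite msize_poly_eq0.
have := @msize_mderiv _ _ p i (msize p).-1; case: (msize p) => // k /(_ (leqnn _)) le _.
by rewrite ltnS.
Qed.

(** Here the stable ideal is generated by [psi] and its partial derivatives; stability follows by
    differentiating X(psi) = mu psi. A nonzero partial derivative is coprime to the irreducible
    [psi], so elimination applies. *)
Lemma singular_point_of_curve psi v : mirreducible psi -> mhomogeneous psi ->
  semi_invariant X psi -> v != 0 -> ev psi v = 0 -> (forall w, ev (mdir w psi) v = 0) ->
  exists c, vfeval X v = c *: v.
Proof.
move=> irr [d hd] [lt [mu Xpsi]] v0 psiv grad.
have psi0 := mirreducible_neq0 irr.
apply: boolp.contrapT => nc; have [u [u0 ind]] := independent_complement v0 nc.
have [i di] := exists_mderiv_neq0 lt.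
have cop := irreducible_coprime_small irr di (msize_mderiv_lt i psi0).
have [A [B [k [r0 dr hr]]]] := eliminate_homog u0 psi0 hd (mderiv_homog i hd) cop.
move/eqP: r0; apply.
pose J (a : S) := exists A (B : 'I_3 -> S), a = A * psi + \sum_j B j * psi^`M(j).
apply: (@stable_ideal_no_cone v J _ _ u) => //.
- move=> a [A' [B' ->]].
  have Xd j : Xder X psi^`M(j) = mu^`M(j) * psi + mu * psi^`M(j) - \sum_l (X l)^`M(j) * psi^`M(l).
    have := congr1 (mderiv j) Xpsi; rewrite mderivM => <-.
    rewrite /Xder (raddf_sum (mderiv j)) -sumrB; apply: eq_bigr => l _ /=.
    by rewrite mderivM mderiv_comm; ring.
  exists (Xder X A' + A' * mu + \sum_j B' j * mu^`M(j)),
    (fun l => Xder X (B' l) + B' l * mu - \sum_j B' j * (X l)^`M(j)).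
  rewrite raddfD /= XderM Xpsi (raddf_sum (Xder X)) /=.
  under eq_bigr do rewrite XderM Xd.
  have aux (R : comPzRingType) (xa a' mu' psi' : R) (xB B'' dm dp : 'I_3 -> R) (XM : 'I_3 -> 'I_3 -> R) :
      xa * psi' + a' * (mu' * psi') +
        \sum_j (xB j * dp j + B'' j * (dm j * psi' + mu' * dp j - \sum_l XM l j * dp l)) =
      (xa + a' * mu' + \sum_j B'' j * dm j) * psi' +
        \sum_l (xB l + B'' l * mu' - \sum_j B'' j * XM l j) * dp l.
    rewrite !sum3E; ring.
  exact: aux.
- move=> a [A' [B' ->]]; rewrite /ev mevalD mevalM -/(ev psi v) psiv mulr0 add0r.
  rewrite (raddf_sum (meval _)) big1 // => j _ /=; rewrite mevalM.
  have := grad (delta_mx j 0); rewrite mdir_delta /ev => ->; by rewrite mulr0.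
- by exists k.
- exists A, (fun j => if j == i then B else 0).
  by rewrite (bigD1 i) //= eqxx big1 ?addr0 // => j nj; rewrite (negPf nj) mul0r.
Qed.

End NonSingular.

(** * Norms and orders of contact *)

Section Companion.
Variable R : comNzRingType.

(** [companionmx] with an explicit dimension, so that norms can be specialized at points without a
    change of type. *)
Definition companion n (a : {poly R}) : 'M[R]_n.+1 :=
  \matrix_(i, j) if i == n :> nat then - a`_j else (i.+1 == j :> nat)%:R.

(* The norm of b from R[y]/(a) to R, for a monic of degree n + 1. *)
Definition norm n (a b : {poly R}) : R := \det (horner_mx (companion n a) b).

Lemma char_poly_companion n a : a \is monic -> size a = n.+2 -> char_poly (companion n a) = a.
Proof.
move=> mon sz; rewrite -[RHS](companionmxK mon) /companionmx /companion.
have : n.+1 = (size a).-1 by rewrite sz.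
by move: (size a).-1 => k ek; case: k / ek.
Qed.

Lemma normM n a b c : norm n a (b * c) = norm n a b * norm n a c.
Proof. by rewrite /norm rmorphM det_mulmx. Qed.

Lemma normC n a c : norm n a c%:P = c ^+ n.+1.
Proof. by rewrite /norm horner_mx_C det_scalar. Qed.

Lemma norm1 n a : norm n a 1 = 1.
Proof. by rewrite /norm rmorph1 det1. Qed.

Lemma norm_prod n a (I : Type) (r : seq I) (F : I -> {poly R}) :
  norm n a (\prod_(i <- r) F i) = \prod_(i <- r) norm n a (F i).
Proof. by elim/big_rec2: _ => [|i x y _ <-]; rewrite ?normM ?norm1. Qed.

Section Modulus.
Variables (n : nat) (a : {poly R}).
Hypotheses (mon : a \is monic) (sz : size a = n.+2).

Lemma norm_mod b g : norm n a (b + a * g) = norm n a b.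
Proof.
have := Cayley_Hamilton (companion n a); rewrite (char_poly_companion mon sz) => e.
rewrite /norm rmorphD; congr (\det _); apply/eqP; rewrite -subr_eq0 addrC addKr.
by rewrite [X in X == 0](rmorphM (horner_mx (companion n a))) [X in X * _]e mul0r.
Qed.

Lemma norm_relation U l A b B : U * l = A * a + B * b ->
  norm n a U * norm n a l = norm n a B * norm n a b.
Proof. by move=> e; rewrite -!normM e [A * a + _]addrC [A * a]mulrC norm_mod. Qed.

Lemma norm_XsubC s : norm n a ('X - s%:P) = (-1) ^+ n.+1 * a.[s].
Proof.
rewrite /norm rmorphB /= horner_mx_X horner_mx_C.
rewrite -opprB -scaleN1r detZ; congr (_ * _).
have <- : \det (map_mx (horner_eval s) (char_poly_mx (companion n a))) = a.[s].
  by rewrite det_map_mx -/(char_poly _) (char_poly_companion mon sz).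
congr (\det _).
by apply/matrixP => i j; rewrite !mxE /horner_eval !hornerE hornerMn hornerX.
Qed.

End Modulus.
End Companion.

Section NormField.
Variable C : closedFieldType.

Lemma prodr_const_seq (I : Type) (r : seq I) (x : C) : \prod_(i <- r) x = x ^+ size r.
Proof. by elim: r => [|i r IH]; rewrite ?big_nil // big_cons IH exprS. Qed.

(** Identifies the norm with the resultant of [a] and [b]. *)
Lemma norm_roots n (a b : {poly C}) (rs : seq C) : size rs = n.+1 ->
  a = \prod_(z <- rs) ('X - z%:P) -> norm n a b = \prod_(z <- rs) b.[z].
Proof.
move=> szrs aE.
have mon : a \is monic by rewrite aE monic_prod_XsubC.
have sz : size a = n.+2 by rewrite aE size_prod_XsubC szrs.
have [bs bE] := closed_field_poly_normal b.
rewrite bE -mul_polyC normM normC norm_prod.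
under eq_bigr do rewrite (norm_XsubC mon sz).
under [RHS]eq_bigr do rewrite hornerM hornerC horner_prod.
rewrite [in RHS]big_split /= [in RHS]prodr_const_seq szrs; congr (_ * _).
rewrite [in RHS]exchange_big /=; apply: eq_bigr => x _.
rewrite aE horner_prod -szrs -prodr_const_seq -big_split /=.
by apply: eq_bigr => z _; rewrite !hornerXsubC mulN1r opprB.
Qed.

End NormField.

Section NormOverLine.
Variable C : numClosedFieldType.
Local Notation R2 := {poly {poly C}}.

Definition fiber (x : C) : R2 -> {poly C} := map_poly (horner_eval x).
HB.instance Definition _ x := GRing.RMorphism.on (fiber x).

Definition ev2 (p : R2) (x y : C) : C := p.[y%:P].[x].

Lemma fiberE p x y : (fiber x p).[y] = ev2 p x y.
Proof.
have e : horner_eval x y%:P = y by rewrite /horner_eval hornerC.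
exact: etrans (congr1 (horner (fiber x p)) (esym e)) (horner_map _ p y%:P).
Qed.

Lemma ev2M p q x y : ev2 (p * q) x y = ev2 p x y * ev2 q x y.
Proof. by rewrite /ev2 !hornerM. Qed.

Lemma ev2D p q x y : ev2 (p + q) x y = ev2 p x y + ev2 q x y.
Proof. by rewrite /ev2 !hornerD. Qed.

Lemma ev2C c x y : ev2 c%:P x y = c.[x].
Proof. by rewrite /ev2 hornerC. Qed.

Lemma ev2X x y : ev2 'X x y = y.
Proof. by rewrite /ev2 hornerX hornerC. Qed.

Lemma norm_fiber n (a b : R2) x : (norm n a b).[x] = norm n (fiber x a) (fiber x b).
Proof.
rewrite /norm -[LHS]/(horner_eval x _) -det_map_mx map_horner_mx; congr (\det (horner_mx _ _)).
apply/matrixP => i j; rewrite !mxE coef_map; case: ifP => _; first by rewrite rmorphN.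
by rewrite rmorph_nat.
Qed.

Lemma poly_ext (p q : {poly C}) : (forall x, p.[x] = q.[x]) -> p = q.
Proof.
move=> e; apply/eqP; rewrite -subr_eq0; apply/negPn/negP => /poly_nonroot[x].
by rewrite hornerD hornerN e subrr eqxx.
Qed.

Lemma coprimep_XsubC_exp (x : C) k q : ~~ root q x -> coprimep (('X - x%:P) ^+ k) q.
Proof. by move=> nr; rewrite coprimep_expl // coprimep_sym coprimep_XsubC. Qed.

(** Divisibility can be tested one root at a time; this turns the comparison of norms into local
    estimates. *)
Lemma dvdp_local (p q : {poly C}) : p != 0 ->
  (forall x k, ('X - x%:P) ^+ k %| p -> ('X - x%:P) ^+ k %| q) -> p %| q.
Proof.
have [n] := ubnP (size p); elim: n p q => // n IH p q lt p0 h.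
have [sz1|nsz1] := eqVneq (size p) 1%N.
  by move/eqP: sz1 => /size_poly1P[c c0 ->]; rewrite -[c%:P]mulr1 mul_polyC dvdpZl ?dvd1p.
have /closed_rootP[x] := nsz1; rewrite -dvdp_XsubCl => /dvdpP[p' pE].
have xp : ('X - x%:P) ^+ 1 %| p by rewrite expr1 pE dvdp_mull.
have /dvdpP[q' qE] := h x 1%N xp; rewrite expr1 in qE.
have X0 : 'X - x%:P != 0 :> {poly C} by rewrite polyXsubC_eq0.
have p'0 : p' != 0 by apply: contraNneq p0 => e; rewrite pE e mul0r.
rewrite pE qE dvdp_mul2r //; apply: IH => //.
  by move: lt; rewrite pE size_mul // size_XsubC addn2 /= ltnS.
move=> y k yk; have [eyx|nxy] := eqVneq y x.
  have := h x k.+1; rewrite pE qE !exprSr !dvdp_mul2r //; subst y; exact.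
have nr : ~~ root ('X - x%:P) y by rewrite root_XsubC.
have : ('X - y%:P) ^+ k %| p by rewrite pE dvdp_mulr.
by move/(h y k); rewrite qE (Gauss_dvdpl _ (coprimep_XsubC_exp k nr)).
Qed.

Lemma norm_at n (a b : R2) x rs : size rs = n.+1 ->
  fiber x a = \prod_(z <- rs) ('X - z%:P) -> (norm n a b).[x] = \prod_(z <- rs) ev2 b x z.
Proof.
move=> sz aE; rewrite norm_fiber (norm_roots _ sz aE).
by apply: eq_bigr => z _; rewrite fiberE.
Qed.

Section Monic.
Variables (n : nat) (a : R2).
Hypotheses (mon : a \is monic) (sz : size a = n.+2).

Lemma fiber_monic x : fiber x a \is monic.
Proof. by exact: monic_map. Qed.

Lemma size_fiber x : size (fiber x a) = n.+2.
Proof.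
rewrite /fiber size_map_poly_id0 // (monicP mon) rmorph1; exact: oner_neq0.
Qed.

Lemma fiber_roots x : exists2 rs : seq C, size rs = n.+1 &
  fiber x a = \prod_(z <- rs) ('X - z%:P).
Proof.
have [rs E] := closed_field_poly_normal (fiber x a).
move: E; rewrite (monicP (fiber_monic x)) scale1r => E; exists rs => //.
by have := size_fiber x; rewrite E size_prod_XsubC => -[].
Qed.

Lemma norm_neq0_at b x : (forall y, ev2 a x y = 0 -> ev2 b x y != 0) -> (norm n a b).[x] != 0.
Proof.
move=> h; have [rs szr E] := fiber_roots x.
rewrite (norm_at b szr E) prodf_seq_neq0; apply/allP => y yr /=; apply: h.
by apply/eqP; rewrite -fiberE -/(root _ _) E root_prod_XsubC.
Qed.

Lemma norm_eq0_at b x y : ev2 a x y = 0 -> ev2 b x y = 0 -> (norm n a b).[x] = 0.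
Proof.
move=> ay yb; have [rs szr E] := fiber_roots x.
have yr : y \in rs by rewrite -root_prod_XsubC -E /root fiberE ay.
by rewrite (norm_at b szr E) (big_rem _ yr) /= yb mul0r.
Qed.

Lemma common_root b x : (norm n a b).[x] = 0 -> exists2 y, ev2 a x y = 0 & ev2 b x y = 0.
Proof.
move=> N0; apply: boolp.contrapT => h.
have : (norm n a b).[x] != 0.
  by apply: norm_neq0_at => y ay; apply/negP => /eqP yb; apply: h; exists y.
by rewrite N0 eqxx.
Qed.

Lemma norm_relation_neq0 A B b r : r%:P = A * a + B * b -> r != 0 -> norm n a b != 0.
Proof.
move=> e r0; apply/negP => /eqP N0; have := norm_relation mon sz (U := r%:P) (l := 1) (etrans (mulr1 _) e).
by rewrite N0 mulr0 norm1 mulr1 normC => /eqP; rewrite expf_eq0 (negPf r0) andbF.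
Qed.

Lemma exists_avoid (s : seq C) : exists t : C, t \notin s.
Proof.
have /poly_nonroot[t] : \prod_(z <- s) ('X - z%:P) != 0 :> {poly C}.
  exact: monic_neq0 (monic_prod_XsubC _ _ _).
by move=> h; exists t; rewrite -root_prod_XsubC.
Qed.

(* Replacing (U, B) by (U + t b, B + t l) makes the norm of U invertible at x0 for general t. *)
Lemma norm_order_le b U s A B x0 k : U * ('X - s%:P) = A * a + B * b ->
  ev2 U x0 s.[x0] != 0 -> ev2 b x0 s.[x0] = 0 ->
  (forall y, ev2 a x0 y = 0 -> y != s.[x0] -> ev2 b x0 y != 0) ->
  ('X - x0%:P) ^+ k %| norm n a b -> ('X - x0%:P) ^+ k %| a.[s].
Proof.
move=> e U0 b0 h; have [rs szr E] := fiber_roots x0.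
have [t ht] := exists_avoid [seq - (ev2 U x0 y / ev2 b x0 y) | y <- rs].
have e' : (U + t%:P%:P * b) * ('X - s%:P) = A * a + (B + t%:P%:P * ('X - s%:P)) * b.
  by rewrite mulrDl e; move: (t%:P%:P) ('X - s%:P) => tt l; ring.
have := norm_relation mon sz e'; rewrite (norm_XsubC mon sz) => eN.
have nr : ~~ root (norm n a (U + t%:P%:P * b)) x0.
  rewrite /root (norm_at _ szr E) prodf_seq_neq0; apply/allP => y yr /=.
  rewrite ev2D ev2M ev2C hornerC; have [ey|ney] := eqVneq y s.[x0].
    by rewrite ey b0 mulr0 addr0.
  have ay : ev2 a x0 y = 0 by apply/eqP; rewrite -fiberE -/(root _ _) E root_prod_XsubC.
  have by0 := h y ay ney; apply: contra ht => /eqP z0; apply/mapP; exists y => //.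
  have Uy : ev2 U x0 y = - (t * ev2 b x0 y) by apply/eqP; rewrite -addr_eq0 z0.
  by rewrite Uy mulNr mulfK ?opprK.
move=> dv; have := dvdp_mull (norm n a (B + t%:P%:P * ('X - s%:P))) dv; rewrite -eN.
rewrite (Gauss_dvdpr _ (coprimep_XsubC_exp k nr)) => /(dvdp_mull ((-1) ^+ n.+1)).
by rewrite signrMK.
Qed.

End Monic.

End NormOverLine.

(** * Lower bounds for the divisibility of norms *)

Section LineDivisor.
Variable F : fieldType.

Lemma dvdp_det_sub n (pi : {poly F}) (M N : 'M[{poly F}]_n) :
  (forall i j, pi %| M i j - N i j) -> pi %| \det M - \det N.
Proof.
move=> h; rewrite /determinant -sumrB; apply: (big_ind (fun p => pi %| p)).
- exact: dvdp0.
- by move=> p q; exact: dvdp_add.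
move=> s _; rewrite -mulrBr; apply: dvdp_mull.
elim/big_rec2: _ => [|i p q _ IH]; first by rewrite subrr dvdp0.
have -> : M i (s i) * q - N i (s i) * p = (M i (s i) - N i (s i)) * q + N i (s i) * (q - p) by ring.
by apply: dvdp_add; [exact: dvdp_mulr | exact: dvdp_mull].
Qed.

(** Modulo [pi] the polynomial [b] is a multiple of y - s, whose norm is a(s) up to sign. *)
Lemma dvdp_norm n (a b : {poly {poly F}}) (s pi : {poly F}) : a \is monic -> size a = n.+2 ->
  pi %| a.[s] -> pi %| b.[s] -> pi %| norm n a b.
Proof.
move=> mon sz pa pb.
have /factor_theorem[b' e] : root (b - b.[s]%:P) s by rewrite /root hornerD hornerN hornerC subrr.
have bE : b = b.[s]%:P + b' * ('X - s%:P) by rewrite -e addrC subrK.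
have h : pi %| norm n a b - norm n a (b' * ('X - s%:P)).
  apply: dvdp_det_sub => i j; rewrite {1}bE (rmorphD (horner_mx _)) /= horner_mx_C mxE addrK mxE.
  by case: eqP => _; rewrite ?mulr1n ?mulr0n ?dvdp0.
rewrite -[norm n a b](subrK (norm n a (b' * ('X - s%:P)))) dvdp_add //.
by rewrite normM (norm_XsubC mon sz) 2?dvdp_mull.
Qed.

(** The hypotheses say that [b] passes through a double point of [a]. Since M = b(Y) commutes with
    [Y], each row of [M] is the previous one times [Y]. Hence the first column is divisible by [pi],
    below its top entry by pi^2, and the second column is divisible by [pi] below its top entry. *)
Lemma dvdp_norm_sqr n (a b : {poly {poly F}}) (pi : {poly F}) :
  pi ^+ 2 %| a`_0 -> pi %| a`_1 -> pi %| b`_0 -> pi ^+ 2 %| norm n.+1 a b.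
Proof.
move=> a0 a1 b0; rewrite /norm; set Y := companion n.+1 a; set M := horner_mx Y b.
have YM : Y *m M = M *m Y.
  have := rmorphM (horner_mx Y) 'X b; rewrite mulrC rmorphM /= horner_mx_X => e.
  exact: esym e.
have MY0 (N : 'M_n.+2) k : (N *m Y) k 0 = - (N k ord_max * a`_0).
  rewrite mxE (bigD1 ord_max) //= mxE eqxx mulrN big1 ?addr0 // => i ni.
  have e : (i == n.+1 :> nat) = false by apply: negPf ni.
  by rewrite mxE e mulr0.
pose o1 : 'I_n.+2 := Ordinal (isT : 1 < n.+2)%N.
have MY1 (N : 'M_n.+2) k : (N *m Y) k o1 = N k ord0 - N k ord_max * a`_1.
  rewrite mxE (bigD1 ord_max) //= mxE eqxx mulrN addrC (bigD1 ord0) //= mxE /= mulr1 big1 ?addr0 // => i /andP[ni i0].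
  have e : (i == n.+1 :> nat) = false by apply: negPf ni.
  have e0 : (i.+1 == o1 :> nat) = false by apply: negPf i0.
  by rewrite mxE e e0 mulr0.
have MS (k : 'I_n.+1) j : M (lift ord0 k) j = (M *m Y) (widen_ord (leqnSn _) k) j.
  have ek : (widen_ord (leqnSn n.+1) k == n.+1 :> nat) = false by apply: ltn_eqF (ltn_ord k).
  rewrite -YM mxE (bigD1 (lift ord0 k)) //= mxE ek lift0 eqxx mul1r big1 ?addr0 // => i ni.
  have e0 : (k.+1 == i :> nat) = false by rewrite eq_sym -(lift0 k); apply: negPf ni.
  by rewrite mxE ek e0 mul0r.
have M00 : pi %| M 0 0.
  have /factor_theorem[b' bE] : root (b - (b`_0)%:P) 0 by rewrite /root hornerD hornerN hornerC horner_coef0 subrr.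
  have -> : M 0 0 = b`_0 - horner_mx Y b' 0 ord_max * a`_0.
    rewrite /M -[b in LHS](subrK (b`_0)%:P) bE subr0 (rmorphD (horner_mx Y)) rmorphM /= horner_mx_X horner_mx_C.
    by rewrite mxE [X in X + _]MY0 !mxE eqxx mulr1n addrC.
  by rewrite dvdp_sub ?dvdp_mull // (dvdp_trans _ a0) // expr2 dvdp_mulr.
have Mk0 k : pi ^+ 2 %| M (lift ord0 k) 0 by rewrite MS MY0 dvdpNr dvdp_mull.
have M0 k : pi %| M k 0.
  case: (unliftP ord0 k) => [j ->|->]; last exact: M00.
  by apply: (dvdp_trans _ (Mk0 j)); rewrite expr2 dvdp_mulr.
have Mk1 k : pi %| M (lift ord0 k) o1 by rewrite MS MY1 dvdp_sub ?M0 ?dvdp_mull.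
have big (I : finType) (G : I -> {poly F}) d : (forall i, d %| G i) -> d %| \sum_i G i.
  by move=> h; apply: (big_ind (fun p => d %| p)) => [|p q|i _]; [exact: dvdp0 | exact: dvdp_add | exact: h].
rewrite (expand_det_col _ ord0); apply: (big) => i.
case: (unliftP ord0 i) => [j ->|->]; first by rewrite dvdp_mulr.
rewrite expr2 dvdp_mul ?M00 // /cofactor dvdp_mull // (expand_det_col _ ord0); apply: (big) => k.
rewrite dvdp_mulr // !mxE; have -> : lift ord0 ord0 = o1 by apply: val_inj.
exact: Mk1.
Qed.

End LineDivisor.

Section Reversal.
Variable F : numFieldType.

(** This is how a norm changes under the change of chart x -> 1/x; the value of [q] at 0 tells
    whether the degree of [p] falls below [K]. *)
Lemma reversal (p q : {poly F}) K : (forall x, x != 0 -> p.[x] = x ^+ K * q.[x^-1]) ->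
  (size p <= K.+1)%N /\ p`_K = q.[0].
Proof.
move=> h; pose N := size q; pose r := \poly_(i < N.+1) q`_(N - i).
(* The hypothesis says nothing about x = 0; the factor X takes care of that point. *)
have E : 'X * ('X^N * p - 'X^K * r) = 0.
  apply/eqP/negPn/negP => /poly_nonroot[x]; rewrite !hornerE.
  have [->|x0] := eqVneq x 0; first by rewrite mul0r eqxx.
  rewrite h // mulrCA -mulrBr !mulf_eq0 => /norP[_ /norP[_]].
  rewrite horner_poly (@horner_coef_wide _ N.+1 q) ?leqnSn // (reindex_inj rev_ord_inj) /=.
  rewrite mulr_sumr -sumrB big1 ?eqxx // => i _.
  have iN : (i <= N)%N by rewrite -ltnS.
  rewrite subSS exprVn mulrCA; apply/eqP; rewrite subr_eq0; apply/eqP; congr (_ * _).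
  by rewrite -{1}(subnK iN) exprD mulrAC mulfV ?mul1r ?expf_neq0.
move/eqP: E; rewrite mulf_eq0 polyX_eq0 /= subr_eq0 => /eqP E.
have co i : p`_i = if (K <= N + i)%N then r`_(N + i - K) else 0.
  have := congr1 (fun s : {poly F} => s`_(N + i)) E; rewrite !coefXnM.
  by rewrite ltnNge leq_addr addKn /= ltnNge; case: (K <= _)%N.
split.
  apply/leq_sizeP => j Kj; rewrite co; case: ifP => // _; rewrite coef_poly ifN // -leqNgt; lia.
rewrite co leq_addl addnK coef_poly ltnSn subnn.
by rewrite horner_coef0.
Qed.

End Reversal.

(** U = D b1^2 - B b1 b2 + A b2^2 is the resultant of the quadratic and the linear form, so U x^2, U
    x y and U y^2 are combinations of the two. The line c1 x + c2 y differs from b1 x + b2 y by just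
    such quadratic terms. *)
Lemma node_relation (R : comPzRingType) (A B D b1 b2 p q r t x y c1 c2 : R) :
     b1 = c1 + p * x + q * y -> b2 = c2 + r * x + t * y ->
     (D * b1 ^+ 2 - B * b1 * b2 + A * b2 ^+ 2) * (c1 * x + c2 * y) =
     (- (p * b2 ^+ 2) + (q + r) * (b1 * b2) - t * b1 ^+ 2) * (A * x ^+ 2 + B * x * y + D * y ^+ 2) +
     (D * b1 ^+ 2 - B * b1 * b2 + A * b2 ^+ 2 + p * (B * b2 * x + D * (b2 * y - b1 * x)) - (q + r) * (D * b1 * y + A * b2 * x)
     + t * (B * b1 * y + A * (b1 * x - b2 * y))) * (b1 * x + b2 * y).
Proof.
move=> e1 e2; have -> : c1 = b1 - p * x - q * y by rewrite e1; ring.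
have -> : c2 = b2 - r * x - t * y by rewrite e2; ring.
by clear; ring.
Qed.

Section LocalOrder.
Variable C : numClosedFieldType.
Local Notation R2 := {poly {poly C}}.

Lemma horner_ev2 (P : R2) s x : P.[s].[x] = ev2 P x s.[x].
Proof. by rewrite -fiberE; exact: esym (horner_map (horner_eval x) P s). Qed.

Lemma norm_shift n (a b : R2) (c : {poly C}) : a \is monic -> size a = n.+2 ->
  norm n (a \Po ('X + c%:P)) (b \Po ('X + c%:P)) = norm n a b.
Proof.
move=> mon sz; apply: poly_ext => x; have [rs szr E] := fiber_roots mon sz x.
have fX : fiber x ('X + c%:P) = 'X + (c.[x])%:P.
  by rewrite /fiber rmorphD /= map_polyX map_polyC.
have fc p : fiber x (p \Po ('X + c%:P)) = fiber x p \Po ('X + (c.[x])%:P).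
  by rewrite -fX; exact: map_comp_poly.
rewrite (norm_at b szr E) (@norm_at C n _ _ x [seq z - c.[x] | z <- rs]); last 2 first.
- by rewrite size_map.
- rewrite fc E big_map rmorph_prod /=; apply: eq_bigr => z _.
  by rewrite rmorphB /= comp_polyX comp_polyC rmorphB /= opprB addrA.
rewrite big_map; apply: eq_bigr => z _.
by rewrite -fiberE fc horner_comp hornerD hornerX hornerC subrK fiberE.
Qed.

Section Point.
Variables (x0 y0 : C).
Let x : R2 := ('X - x0%:P)%:P.
Let y : R2 := 'X - y0%:P%:P.

Lemma norm_ge2_of_node n (a b A B D b1 b2 : R2) : a \is monic -> size a = n.+3 ->
  a = A * x ^+ 2 + B * x * y + D * y ^+ 2 -> b = b1 * x + b2 * y ->
  ('X - x0%:P) ^+ 2 %| norm n.+1 a b.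
Proof.
move=> mon sz aE bE; rewrite -(norm_shift b y0%:P mon sz).
have cx p : (p * x) \Po ('X + y0%:P%:P) = (p \Po ('X + y0%:P%:P)) * ('X - x0%:P)%:P.
  by rewrite rmorphM /= comp_polyC.
have cy p : (p * y) \Po ('X + y0%:P%:P) = (p \Po ('X + y0%:P%:P)) * 'X.
  by rewrite rmorphM rmorphB /= comp_polyX comp_polyC addrK.
rewrite aE bE !rmorphD /= !expr2 !mulrA !(cx, cy).
apply: dvdp_norm_sqr; rewrite !coefD !(coefMX, coefMC) /= ?addr0 ?coefMC.
- by rewrite -mulrA dvdp_mull // -expr2.
- by rewrite -mulrDl dvdp_mull.
- exact: dvdp_mull.
Qed.

Section Upper.
Variables (n : nat) (a b : R2).
Hypotheses (mon : a \is monic) (sz : size a = n.+2).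
Hypothesis uniq_zero : forall t, ev2 a x0 t = 0 -> t != y0 -> ev2 b x0 t != 0.

Lemma ev2x : ev2 x x0 y0 = 0.
Proof. by rewrite /x ev2C !hornerE subrr. Qed.

Lemma ev2y : ev2 y x0 y0 = 0.
Proof. by rewrite /y /ev2 !hornerE subrr. Qed.

(** By Cramer's rule the determinant times [y] lies in the ideal of [a] and [b]. By [norm_order_le]
    the order of the norm is at most that of [a] on the line y = 0, which is 1. *)
Lemma norm_le1_of_transversal (a1 a2 b1 b2 : R2) :
  a = a1 * x + a2 * y -> b = b1 * x + b2 * y ->
  ev2 a1 x0 y0 != 0 -> ev2 a1 x0 y0 * ev2 b2 x0 y0 != ev2 a2 x0 y0 * ev2 b1 x0 y0 ->
  ~~ (('X - x0%:P) ^+ 2 %| norm n a b).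
Proof.
move=> aE bE a10 d0; apply/negP.
have e : (a1 * b2 - a2 * b1) * y = - b1 * a + a1 * b.
  by rewrite aE bE; ring.
have b0 : ev2 b x0 y0 = 0 by rewrite bE ev2D !ev2M ev2x ev2y !mulr0 addr0.
have ay : a.[y0%:P] = a1.[y0%:P] * ('X - x0%:P).
  by rewrite aE /x /y !hornerE subrr mulr0 addr0.
have U0 : ev2 (a1 * b2 - a2 * b1) x0 (y0%:P).[x0] != 0.
  by rewrite hornerC /ev2 !hornerE subr_eq0.
have un t : ev2 a x0 t = 0 -> t != (y0%:P).[x0] -> ev2 b x0 t != 0 by rewrite hornerC; exact: uniq_zero.
have b0' : ev2 b x0 (y0%:P).[x0] = 0 by rewrite hornerC.
move/(norm_order_le mon sz e U0 b0' un).
rewrite ay expr2 dvdp_mul2r ?polyXsubC_eq0 // dvdp_XsubCl.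
by rewrite /root -[_.[x0]]/(ev2 a1 x0 y0) (negPf a10).
Qed.

(** Here [a] is restricted to the tangent line of [b]. The last hypothesis says that this line is
    not tangent to the double point of [a], so the restriction has order exactly 2. *)
Lemma norm_le2_of_node (A B D b1 b2 p q r t : R2) (c1 c2 : C) :
  a = A * x ^+ 2 + B * x * y + D * y ^+ 2 ->
  b = b1 * x + b2 * y -> b1 = c1%:P%:P + p * x + q * y -> b2 = c2%:P%:P + r * x + t * y ->
  c2 != 0 ->
  ev2 D x0 y0 * c1 ^+ 2 - ev2 B x0 y0 * c1 * c2 + ev2 A x0 y0 * c2 ^+ 2 != 0 ->
  ~~ (('X - x0%:P) ^+ 3 %| norm n a b).
Proof.
move=> aE bE b1E b2E c20 d0; apply/negP.
(* The tangent c1 x + c2 y = 0 of [b], solved for the outer variable. *)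
pose s := y0%:P - (c1 / c2)%:P * ('X - x0%:P).
pose U := D * b1 ^+ 2 - B * b1 * b2 + A * b2 ^+ 2.
have lE : c2%:P%:P * ('X - s%:P) = c1%:P%:P * x + c2%:P%:P * y.
  rewrite /s /x /y rmorphB rmorphM /=.
  have -> : c1%:P%:P = c2%:P%:P * (c1 / c2)%:P%:P :> R2 by rewrite -!rmorphM /= mulrC divfK.
  by ring.
have [V [W e]] : exists V W, (c2%:P%:P * U) * ('X - s%:P) = V * a + W * b.
  rewrite mulrAC lE mulrC.
  exists (- (p * b2 ^+ 2) + (q + r) * (b1 * b2) - t * b1 ^+ 2).
  exists (U + p * (B * b2 * x + D * (b2 * y - b1 * x)) - (q + r) * (D * b1 * y + A * b2 * x)
     + t * (B * b1 * y + A * (b1 * x - b2 * y))).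
  by rewrite {1}aE {1}bE; apply: node_relation.
have sx0 : s.[x0] = y0 by rewrite /s !hornerE subrr mulr0 subr0.
have b0 : ev2 b x0 y0 = 0 by rewrite bE ev2D !ev2M ev2x ev2y !mulr0 addr0.
have eb1 : ev2 b1 x0 y0 = c1.
  by rewrite b1E !ev2D !ev2M ev2x ev2y !mulr0 !addr0 ev2C hornerC.
have eb2 : ev2 b2 x0 y0 = c2.
  by rewrite b2E !ev2D !ev2M ev2x ev2y !mulr0 !addr0 ev2C hornerC.
have as_ : a.[s] = (A.[s] - B.[s] * (c1 / c2)%:P + D.[s] * (c1 / c2)%:P ^+ 2) * ('X - x0%:P) ^+ 2.
  rewrite aE /x /y !(hornerXsubC, hornerD, hornerM, horner_exp, hornerC).
  have -> : s - y0%:P = - ((c1 / c2)%:P * ('X - x0%:P)) by rewrite /s addrAC subrr add0r.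
  by ring.
have evn (P Q : R2) : ev2 (- P) x0 y0 = - ev2 P x0 y0 by rewrite /ev2 !hornerE.
have U0 : ev2 (c2%:P%:P * U) x0 s.[x0] != 0.
  rewrite sx0 ev2M ev2C hornerC mulf_neq0 // /U !(ev2D, evn, ev2M, expr2) // eb1 eb2.
  by move: d0; rewrite !expr2 !mulrA.
have un u : ev2 a x0 u = 0 -> u != s.[x0] -> ev2 b x0 u != 0 by rewrite sx0; exact: uniq_zero.
have b0' : ev2 b x0 s.[x0] = 0 by rewrite sx0.
move/(norm_order_le mon sz e U0 b0' un).
rewrite as_ (exprS _ 2) dvdp_mul2r ?expf_neq0 ?polyXsubC_eq0 // dvdp_XsubCl.
have ex (P : R2) : P.[s].[x0] = ev2 P x0 y0 by rewrite horner_ev2 sx0.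
rewrite /root !(hornerD, hornerN, hornerM, horner_exp, hornerC) !ex => /eqP e0; case/negP: d0; apply/eqP.
transitivity (c2 ^+ 2 * (ev2 A x0 y0 - ev2 B x0 y0 * (c1 / c2) + ev2 D x0 y0 * (c1 / c2) ^+ 2)).
  by field.
by rewrite e0 mulr0.
Qed.

End Upper.
End Point.
End LocalOrder.

Lemma mpoly_ring_ind (R : comNzRingType) n (P : {mpoly R[n]} -> Prop) :
  (forall c, P c%:MP) -> (forall i, P 'X_i) -> (forall p q, P p -> P q -> P (p + q)) ->
  (forall p q, P p -> P q -> P (p * q)) -> forall p, P p.
Proof.
move=> PC PX PD PM; apply: mpolyind => [|c m p _ _ Pp]; first by rewrite -mpolyC0.
apply: (PD) => //; rewrite -mul_mpolyC; apply: (PM) => //; rewrite mpolyXE_id.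
apply: big_ind => [||i _]; [exact: PC | exact: PM |].
elim: (m i) => [|k IH]; first by rewrite expr0 -mpolyC1.
by rewrite exprS; apply: PM.
Qed.

Lemma coef_mul_top (R : nzRingType) (p q : {poly R}) k l : (size p <= k.+1)%N -> (size q <= l.+1)%N ->
  (p * q)`_(k + l) = p`_k * q`_l.
Proof.
move=> sp sq; have kl : (k < (k + l).+1)%N by rewrite ltnS leq_addr.
rewrite coefM (bigD1 (Ordinal kl)) //= addKn big1 ?addr0 // => i ni.
have {}ni : (i : nat) <> k by apply/eqP.
have [lt|ge] := ltnP i k; last first.
  by rewrite [p`__]nth_default ?mul0r // (leq_trans sp) // ltn_neqAle ge andbT; apply/eqP => e; apply: ni.
by rewrite [q`__]nth_default ?mulr0 // (leq_trans sq) // ltn_subRL ltn_add2r.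
Qed.

Lemma taylor2_add (R : comPzRingType) (p0 p1 p2 A B D q0 q1 q2 A' B' D' x y : R) :
  (p0 + p1 * x + p2 * y + A * x ^+ 2 + B * x * y + D * y ^+ 2)
  + (q0 + q1 * x + q2 * y + A' * x ^+ 2 + B' * x * y + D' * y ^+ 2)
  = (p0 + q0) + (p1 + q1) * x + (p2 + q2) * y + (A + A') * x ^+ 2 + (B + B') * x * y
    + (D + D') * y ^+ 2.
Proof. by ring. Qed.

Lemma taylor2_mul (R : comPzRingType) (p0 p1 p2 A B D q0 q1 q2 A' B' D' x y q : R) :
  q = q0 + q1 * x + q2 * y + A' * x ^+ 2 + B' * x * y + D' * y ^+ 2 ->
  (p0 + p1 * x + p2 * y + A * x ^+ 2 + B * x * y + D * y ^+ 2) * q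
  = p0 * q0 + (p1 * q0 + p0 * q1) * x + (p2 * q0 + p0 * q2) * y
    + (p1 * q1 + A * q + (p0 + p1 * x + p2 * y) * A') * x ^+ 2
    + (p1 * q2 + p2 * q1 + B * q + (p0 + p1 * x + p2 * y) * B') * x * y
    + (p2 * q2 + D * q + (p0 + p1 * x + p2 * y) * D') * y ^+ 2.
Proof.
move=> e; transitivity (A * q * x ^+ 2 + B * q * x * y + D * q * y ^+ 2 + (p0 + p1 * x + p2 * y) * q).
  by ring.
by rewrite {4}e; ring.
Qed.

(** * Affine charts of the projective plane *)

Section Chart.
Variable C : numClosedFieldType.
Local Notation R2 := {poly {poly C}}.
Local Notation S := {mpoly C[3]}.
Implicit Types (p q psi : S).

Section Fixed.
Variables o u z : 'cV[C]_3.

(* The polynomial (x, y) |-> p (y o + x u + z), with y the outer variable. *)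
Definition chart : S -> R2 :=
  mmap (polyC \o polyC) (fun i => (o i 0)%:P%:P * 'X + ((u i 0)%:P * 'X + (z i 0)%:P)%:P).

HB.instance Definition _ := GRing.RMorphism.on chart.

Lemma chartC c : chart c%:MP = c%:P%:P.
Proof. exact: mmapC. Qed.

Lemma chartX i : chart 'X_i = (o i 0)%:P%:P * 'X + ((u i 0)%:P * 'X + (z i 0)%:P)%:P.
Proof. by rewrite /chart mmapX mmap1U. Qed.

Lemma chartD p q : chart (p + q) = chart p + chart q.
Proof. exact: (raddfD chart). Qed.

Lemma chartB p q : chart (p - q) = chart p - chart q.
Proof. exact: (raddfB chart). Qed.

Lemma chartM p q : chart (p * q) = chart p * chart q.
Proof. exact: (rmorphM chart). Qed.

Lemma chart_sum (I : Type) (r : seq I) (F : I -> S) :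
  chart (\sum_(i <- r) F i) = \sum_(i <- r) chart (F i).
Proof. exact: (raddf_sum chart). Qed.

Definition pt x y : 'cV[C]_3 := y *: o + x *: u + z.

Lemma ev2_chart p x y : ev2 (chart p) x y = ev p (pt x y).
Proof.
elim/mpoly_ring_ind: p => [c|i|p q IHp IHq|p q IHp IHq].
- by rewrite chartC ev2C hornerC /ev mevalC.
- rewrite chartX ev2D ev2M !ev2C ev2X !hornerE /ev mevalXU !mxE.
  by rewrite mulrC [x * _]mulrC ?addrA.
- by rewrite chartD ev2D IHp IHq /ev mevalD.
- by rewrite chartM ev2M IHp IHq /ev mevalM.
Qed.

(** [o] is the direction of the outer variable, so the top coefficient is the value at [o]; psi(o) =
    1 makes the chart monic. *)
Lemma chart_homog d psi : psi \is d.-homog ->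
  (size (chart psi) <= d.+1)%N /\ (chart psi)`_d = (ev psi o)%:P.
Proof.
move=> hd; pose T (q : R2) k (c : {poly C}) := (size q <= k.+1)%N /\ q`_k = c.
have TM (q q' : R2) k c k' c' : T q k c -> T q' k' c' -> T (q * q') (k + k')%N (c * c').
  move=> [sq cq] [sq' cq']; split; first by have := size_polyMleq q q'; lia.
  by rewrite -cq -cq' coef_mul_top.
have TX m : T (chart 'X_[m]) (mdeg m) (\prod_i o i 0 ^+ m i)%:P.
  have -> : chart 'X_[m] = \prod_i chart 'X_i ^+ m i.
    by rewrite mpolyXE_id (rmorph_prod chart); apply: eq_bigr => i _; rewrite (rmorphXn chart).
  rewrite mdegE (rmorph_prod polyC).
  apply: (big_ind3 T) => [|q1 k c q2 k' c'|i _]; [|exact: TM|].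
    by split; rewrite ?size_poly1 ?coef1.
  rewrite (rmorphXn polyC) /= chartX; elim: (m i) => [|k IH].
    by rewrite !expr0; split; rewrite ?size_poly1 ?coef1.
  rewrite !exprS; apply: (TM _ _ 1%N) => //; split.
    have h := size_polyC_leq1 (o i 0)%:P.
    apply: leq_trans (size_polyD _ _) _; rewrite geq_max; apply/andP; split.
      by apply: leq_trans (size_polyMleq _ _) _; rewrite size_polyX addn2 /= ltnS.
    exact: leq_trans (size_polyC_leq1 _) _.
  by rewrite coefD coefC addr0 coefMX coefC.
split.
  rewrite (mpolyE psi) chart_sum; apply: (big_ind (fun q1 : R2 => size q1 <= d.+1)%N) => [|q1 q2 h h'|m _]; first by rewrite size_poly0.
    by apply: leq_trans (size_polyD _ _) _; rewrite geq_max h h'.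
  have [->|m0] := eqVneq psi@_m 0; first by rewrite scale0r (raddf0 chart) size_poly0.
  have <- : mdeg m = d by apply: (dhomog_mf hd); rewrite mcoeff_msupp.
  rewrite -mul_mpolyC chartM chartC mul_polyC; apply: leq_trans (size_scale_leq _ _) _.
  by have [] := TX m.
rewrite {1}(mpolyE psi) chart_sum coef_sum /ev mevalE rmorph_sum /=; apply: eq_big_seq => m mp.
have <- : mdeg m = d by apply: (dhomog_mf hd).
rewrite -mul_mpolyC chartM chartC coefCM.
by have [_ ->] := TX m; rewrite rmorphM.
Qed.

Lemma chart_monic d psi : psi \is d.-homog -> ev psi o = 1 ->
  chart psi \is monic /\ size (chart psi) = d.+1.
Proof.
move=> hd e1; have [sz cf] := chart_homog hd; rewrite e1 in cf.
have szE : size (chart psi) = d.+1.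
  apply/eqP; rewrite eqn_leq sz ltnNge; apply/negP => /(nth_default 0).
  by rewrite cf => /eqP; rewrite oner_eq0.
by split=> //; rewrite monicE lead_coefE szE /= cf.
Qed.

Section Taylor.
Variables x0 y0 : C.
Let v := pt x0 y0.
Let x : R2 := ('X - x0%:P)%:P.
Let y : R2 := 'X - y0%:P%:P.

(** Taylor's formula with the remainder absorbed into the quadratic coefficients, which are
    therefore polynomials; only their values at the point matter. *)
Lemma taylor2 p : exists A B D : R2,
  [/\ chart p = (ev p v)%:P%:P + (ev (mdir u p) v)%:P%:P * x + (ev (mdir o p) v)%:P%:P * y
      + A * x ^+ 2 + B * x * y + D * y ^+ 2,
      2 * ev2 A x0 y0 = ev (mdir u (mdir u p)) v,
      ev2 B x0 y0 = ev (mdir u (mdir o p)) v &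
      2 * ev2 D x0 y0 = ev (mdir o (mdir o p)) v].
Proof.
have evx : ev2 x x0 y0 = 0 by rewrite /x ev2C !hornerE subrr.
have evy : ev2 y x0 y0 = 0 by rewrite /y /ev2 !hornerE subrr.
have evD q r w : ev (q + r) w = ev q w + ev r w by rewrite /ev mevalD.
have evM q r w : ev (q * r) w = ev q w * ev r w by rewrite /ev mevalM.
have evC c w : ev c%:MP w = c by rewrite /ev mevalC.
have ev20 : ev2 0 x0 y0 = 0 by rewrite /ev2 !horner0.
have pD (a b : C) : (a + b)%:P%:P = a%:P%:P + b%:P%:P :> R2 by rewrite !polyCD.
have pM (a b : C) : (a * b)%:P%:P = a%:P%:P * b%:P%:P :> R2 by rewrite !polyCM.
have mdirA w q r : mdir w (q + r) = mdir w q + mdir w r by exact: (raddfD (mdir w)).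
have mdir0 w : mdir w (0 : S) = 0 by rewrite -mpolyC0 mdirC.
have mdirX w i : mdir w ('X_i : S) = (w i 0)%:MP.
  rewrite /mdir (bigD1 i) //= mderivXU eqxx big1 ?addr0 => [|j ji].
    by rewrite -mul_mpolyC mulr1.
  by rewrite mderivXU eq_sym (negPf ji) scaler0.
have hX i : chart 'X_i = (v i 0)%:P%:P + (u i 0)%:P%:P * x + (o i 0)%:P%:P * y.
  rewrite chartX /v /pt !mxE /x /y.
  rewrite !(polyCD, polyCB, polyCM); ring.
have hv q : ev2 (chart q) x0 y0 = ev q v by exact: ev2_chart.
clearbody x y v.
elim/mpoly_ring_ind: p => [c|i|p q|p q].
- exists 0, 0, 0; rewrite !mdirC ?mdir0 /ev !meval0 ev20 !mulr0 chartC mevalC; split=> //.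
  by rewrite !mul0r !addr0.
- exists 0, 0, 0; rewrite !mdirX !mdirC /ev !meval0 !mevalC ev20 !mulr0; split=> //.
  by rewrite !mul0r !addr0 mevalXU hX.
- move=> [A [B [D [e1 e2 e3 e4]]]] [A' [B' [D' [f1 f2 f3 f4]]]].
  exists (A + A'), (B + B'), (D + D').
  rewrite !mdirA !evD !ev2D e3 f3 -e2 -f2 -e4 -f4; split=> //; [|by rewrite mulrDr|by rewrite mulrDr].
  by rewrite chartD e1 f1 !pD; exact: taylor2_add.
- move=> [A [B [D [e1 e2 e3 e4]]]] [A' [B' [D' [f1 f2 f3 f4]]]].
  set L1 := ev (mdir u p) v in e1; set L2 := ev (mdir o p) v in e1.
  set M1 := ev (mdir u q) v in f1; set M2 := ev (mdir o q) v in f1.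
  exists ((L1 * M1)%:P%:P + A * chart q + ((ev p v)%:P%:P + L1%:P%:P * x + L2%:P%:P * y) * A').
  exists ((L1 * M2 + L2 * M1)%:P%:P + B * chart q + ((ev p v)%:P%:P + L1%:P%:P * x + L2%:P%:P * y) * B').
  exists ((L2 * M2)%:P%:P + D * chart q + ((ev p v)%:P%:P + L1%:P%:P * x + L2%:P%:P * y) * D').
  have E2 (P P' : R2) c : ev2 (c%:P%:P + P * chart q + ((ev p v)%:P%:P + L1%:P%:P * x + L2%:P%:P * y) * P') x0 y0
     = c + ev2 P x0 y0 * ev q v + ev p v * ev2 P' x0 y0.
    by rewrite !(ev2D, ev2M) !ev2C !hornerC evx evy !mulr0 !addr0 hv.
  rewrite !E2 !(mdirM, mdirA) !(evD, evM) e3 f3 -/L1 -/L2 -/M1 -/M2.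
  split.
  + by rewrite chartM {1}e1 !(pD, pM); exact: taylor2_mul.
  + by rewrite -e2 -f2; ring.
  + ring.
  + by rewrite -e4 -f4; ring.
Qed.

End Taylor.
End Fixed.
End Chart.

(** * Degrees of norms: Bezout's theorem *)

Section NormDegree.
Variable C : numClosedFieldType.
Local Notation S := {mpoly C[3]}.
Implicit Types (psi b : S).

Lemma ev_scale d b (c : C) v : b \is d.-homog -> ev b (c *: v) = c ^+ d * ev b v.
Proof.
move=> hd; rewrite /ev !mevalE mulr_sumr; apply: eq_big_seq => m mb.
have <- : mdeg m = d by apply: (dhomog_mf hd).
rewrite mulrCA; congr (_ * _); rewrite mdegE -prodrXr -big_split.
by apply: eq_bigr => i _; rewrite mxE exprMn.
Qed.

Variables (o u z : 'cV[C]_3) (d e : nat) (psi b : S).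
Hypotheses (hpsi : psi \is d.+1.-homog) (hb : b \is e.-homog) (psio : ev psi o = 1).

Let F := norm d (chart o u z psi) (chart o u z b).
Let G := norm d (chart o z u psi) (chart o z u b).

(** Exchanging [u] and [z] is the change of chart x -> 1/x. Over one [x] the norm is a product of d
    + 1 values of [b], and rescaling each point by [x] contributes x^e. *)
Lemma norm_chart_swap x : x != 0 -> F.[x] = x ^+ (d.+1 * e) * G.[x^-1].
Proof.
move=> x0; have [mon sz] := chart_monic u z hpsi psio.
have [rs szr E] := fiber_roots mon sz x.
have FE : F.[x] = \prod_(y <- rs) ev2 (chart o u z b) x y by exact: norm_at.
have GE : G.[x^-1] = \prod_(y <- [seq y / x | y <- rs]) ev2 (chart o z u b) x^-1 y.
  apply: norm_at; first by rewrite size_map.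
  have ptE y : pt o z u x^-1 y = x^-1 *: pt o u z x (x * y).
    by rewrite /pt !scalerDr !scalerA mulrA mulVf // mul1r scale1r addrAC.
  apply: poly_ext => y; rewrite fiberE ev2_chart ptE (ev_scale _ _ hpsi) -ev2_chart -fiberE E.
  rewrite big_map !horner_prod -szr -prodr_const_seq -big_split /=.
  by apply: eq_bigr => t _; rewrite !hornerXsubC mulrBr mulrA mulVf // mul1r mulrC.
apply: (etrans FE); apply: (etrans _ (congr1 (fun c => _ * c) (esym GE))).
rewrite big_map mulnC exprM -szr -(prodr_const_seq rs) -big_split /=; apply: eq_bigr => y _.
rewrite !ev2_chart -(ev_scale _ _ hb) /pt; congr ev.
by rewrite !scalerDr !scalerA mulrCA mulfV // mulr1 scale1r addrAC.
Qed.

Lemma norm_chart_coef : (size F <= (d.+1 * e).+1)%N /\ F`_(d.+1 * e) = G.[0].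
Proof. by apply: reversal => x; exact: norm_chart_swap. Qed.

Lemma at_infinity_monic : chart o z u psi \is monic /\ size (chart o z u psi) = d.+2.
Proof. exact: chart_monic. Qed.

Lemma ptinf y : pt o z u 0 y = y *: o + u.
Proof. by rewrite /pt scale0r addr0. Qed.

(** Bezout's theorem for curves without common points on the line through [o] and [u], the line at
    infinity of the chart; [size_norm_lt] treats the case of a common point there. *)
Lemma size_norm_eq : (forall y, ev psi (y *: o + u) = 0 -> ev b (y *: o + u) != 0) ->
  size F = (d.+1 * e).+1.
Proof.
move=> h; have [sz cf] := norm_chart_coef; have [mon szp] := at_infinity_monic.
apply/eqP; rewrite eqn_leq sz ltnNge; apply/negP => /(nth_default 0); rewrite cf.
by apply/eqP/(norm_neq0_at mon szp) => y; rewrite !ev2_chart ptinf; exact: h.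
Qed.

Lemma size_norm_lt y : ev psi (y *: o + u) = 0 -> ev b (y *: o + u) = 0 ->
  (size F <= d.+1 * e)%N.
Proof.
move=> py by0; have [sz cf] := norm_chart_coef; have [mon szp] := at_infinity_monic.
have G0 : G.[0] = 0 by apply: (norm_eq0_at mon szp (y := y)); rewrite ev2_chart ptinf.
move: sz; rewrite leq_eqVlt => /orP[/eqP szF|//]; exfalso.
have : lead_coef F == 0 by rewrite lead_coefE szF /= cf G0.
by rewrite lead_coef_eq0 => /eqP F0; move: szF; rewrite F0 size_poly0.
Qed.

End NormDegree.

(** * Counting singular lines *)

Section Theta.
Variable C : numClosedFieldType.
Local Notation S := {mpoly C[3]}.
Implicit Types (psi b p q : S) (u v w o z : 'cV[C]_3).

Lemma evD p q v : ev (p + q) v = ev p v + ev q v.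
Proof. exact: mevalD. Qed.
Lemma evB p q v : ev (p - q) v = ev p v - ev q v.
Proof. exact: mevalB. Qed.
Lemma evM p q v : ev (p * q) v = ev p v * ev q v.
Proof. exact: mevalM. Qed.
Lemma evZ c p v : ev (c *: p) v = c * ev p v.
Proof. exact: mevalZ. Qed.
Lemma evX i v : ev 'X_i v = v i 0.
Proof. exact: mevalXU. Qed.
Lemma evC c v : ev (c%:MP : S) v = c.
Proof. exact: mevalC. Qed.
Lemma ev0 v : ev (0 : S) v = 0.
Proof. exact: meval0. Qed.

Definition cross_form u v : S :=
  (u 1 0 * v 2 0 - u 2 0 * v 1 0) *: 'X_0 + (u 2 0 * v 0 0 - u 0 0 * v 2 0) *: 'X_1
  + (u 0 0 * v 1 0 - u 1 0 * v 0 0) *: 'X_2.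

Lemma ev_cross_form u v w : ev (cross_form u v) w = det3 u v w.
Proof. by rewrite /cross_form !(evD, evZ) !evX /det3; ring. Qed.

Lemma cross_form_neq0 u v w : det3 u v w != 0 -> cross_form u v != 0.
Proof. by apply: contraNneq => e; rewrite -ev_cross_form e ev0. Qed.

Lemma var_homog (i : 'I_3) : ('X_i : S) \is 1.-homog.
Proof. by rewrite dhomogX; apply/eqP; exact: mdeg1. Qed.

Lemma cross_form_homog u v : cross_form u v \is 1.-homog.
Proof. by rewrite /cross_form !rpredD ?rpredZ // var_homog. Qed.

Lemma det3_cycle u v w : det3 u v w = det3 v w u.
Proof. by rewrite /det3; ring. Qed.

Lemma det3_swap u v w : det3 v u w = - det3 u v w.
Proof. by rewrite /det3; ring. Qed.

Variable X : vfield C.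

Definition theta w : S :=
  w 0 0 *: ('X_1 * X 2 - 'X_2 * X 1) + w 1 0 *: ('X_2 * X 0 - 'X_0 * X 2)
  + w 2 0 *: ('X_0 * X 1 - 'X_1 * X 0).

Lemma ev_theta w v : ev (theta w) v = det3 w v (vfeval X v).
Proof. by rewrite /theta !(evB, evD, evZ, evM) !evX /det3 !mxE. Qed.

Lemma theta_homog m w : (forall i, X i \is m.-homog) -> theta w \is m.+1.-homog.
Proof.
move=> hX; have h i j : ('X_i * X j : S) \is m.+1.-homog.
  exact: dhomogM (var_homog i) (hX j).
by rewrite /theta !rpredD ?rpredZ ?rpredB ?h.
Qed.

Definition singular v := exists c, vfeval X v = c *: v.

Lemma singular_of_theta v : v != 0 -> (forall w, ev (theta w) v = 0) -> singular v.
Proof.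
move=> v0 h; apply: (det3_collinear v0) => w; rewrite -ev_theta; exact: h.
Qed.

Lemma theta_of_singular v w : singular v -> ev (theta w) v = 0.
Proof. by move=> [c e]; rewrite ev_theta e /det3 !mxE; ring. Qed.

Lemma lagrange (R : comPzRingType) (w0 w1 w2 w0' w1' w2' x0 x1 x2 p0 p1 p2 g0 g1 g2 : R) :
  (w0 * (x1 * p2 - x2 * p1) + w1 * (x2 * p0 - x0 * p2) + w2 * (x0 * p1 - x1 * p0))
    * (w0' * g0 + w1' * g1 + w2' * g2)
  - (w0' * (x1 * p2 - x2 * p1) + w1' * (x2 * p0 - x0 * p2) + w2' * (x0 * p1 - x1 * p0))
    * (w0 * g0 + w1 * g1 + w2 * g2)
  = ((w1 * w2' - w2 * w1') * p0 + (w2 * w0' - w0 * w2') * p1 + (w0 * w1' - w1 * w0') * p2)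
      * (x0 * g0 + x1 * g1 + x2 * g2)
  - ((w1 * w2' - w2 * w1') * x0 + (w2 * w0' - w0 * w2') * x1 + (w0 * w1' - w1 * w0') * x2)
      * (p0 * g0 + p1 * g1 + p2 * g2).
Proof. by ring. Qed.

(** By Lagrange's identity for cross products the difference is a combination of x . grad psi and X
    . grad psi, which are multiples of [psi] by Euler's formula and by invariance. *)
Lemma theta_mdir d psi w w' : psi \is d.-homog -> semi_invariant X psi ->
  exists q, theta w * mdir w' psi - theta w' * mdir w psi = q * psi.
Proof.
move=> hd [_ [lam e]]; have := euler_homog hd; move: e; rewrite /Xder !sum3E => e1 e2.
rewrite /theta /mdir !sum3E -!mul_mpolyC lagrange e1 e2.
by eexists; rewrite mulrA [X in _ - X]mulrA -mulrBl.
Qed.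

(* Componentwise, (e x e') x (x x X) = det(e, e', X) x - det(e, e', x) X. *)
Lemma theta_kernel (e e' : 'cV[C]_3) i :
  theta e * (e' i 0)%:MP - theta e' * (e i 0)%:MP =
  ((e 1 0 * e' 2 0 - e 2 0 * e' 1 0) *: X 0 + (e 2 0 * e' 0 0 - e 0 0 * e' 2 0) *: X 1
  + (e 0 0 * e' 1 0 - e 1 0 * e' 0 0) *: X 2) * 'X_i - cross_form e e' * X i.
Proof.
rewrite /theta /cross_form -!mul_mpolyC !(rmorphB, rmorphM).
by move: i; apply: ord3P => /=; ring.
Qed.

End Theta.

(** * Charts in general position *)

Section ChartGeometry.
Variable C : numClosedFieldType.
Local Notation S := {mpoly C[3]}.
Local Notation R2 := {poly {poly C}}.
Implicit Types (psi b p q r : S) (u v w o z : 'cV[C]_3).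

Lemma deriv_chart o u z p : deriv (chart o u z p) = chart o u z (mdir o p).
Proof.
elim/mpoly_ring_ind: p => [c|i|p q IHp IHq|p q IHp IHq].
- by rewrite chartC derivC mdirC -mpolyC0 chartC.
- rewrite chartX derivD derivM !derivC derivX mul0r mulr1 add0r addr0.
  rewrite /mdir (bigD1 i) //= mderivXU eqxx big1 ?addr0 => [|j ji].
    by rewrite -mul_mpolyC mulr1 chartC.
  by rewrite mderivXU eq_sym (negPf ji) scaler0.
- by rewrite chartD derivD IHp IHq (raddfD (mdir o)) chartD.
- by rewrite chartM derivM IHp IHq mdirM chartD !chartM.
Qed.

Lemma deriv_eq0_const (a : R2) : deriv a = 0 -> a = (a`_0)%:P.
Proof.
move=> e; apply/polyP => -[|i]; rewrite coefC //=.
have := congr1 (fun q : R2 => q`_i) e; rewrite coef_deriv coef0 => /polyP h.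
apply/polyP => j; have := h j; rewrite coefMn !coef0 => /eqP.
by rewrite mulrn_eq0 => /eqP.
Qed.

Lemma chart_of_cone o u z r : mdir o r = 0 -> exists c, chart o u z r = c%:P.
Proof.
move=> e; exists (chart o u z r)`_0; apply: deriv_eq0_const.
by rewrite deriv_chart e -mpolyC0 chartC.
Qed.

Lemma chart_point o u z v : det3 o u z != 0 -> det3 o u v != 0 ->
  exists l x y, l != 0 /\ l *: v = pt o u z x y.
Proof.
move=> d0 dv; have [a [b [c e]]] := lin_indep3_span (det3_indep d0) v.
have c0 : c != 0.
  by apply: contraNneq dv => c0; rewrite e c0 /det3 !mxE; apply/eqP; ring.
exists c^-1, (c^-1 * b), (c^-1 * a); split; first by rewrite invr_eq0.
by rewrite /pt e !scalerDr !scalerA mulVf // scale1r.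
Qed.

Lemma chart_neq0 o u z k p : det3 o u z != 0 -> p \is k.-homog -> p != 0 -> chart o u z p != 0.
Proof.
move=> d0 hp p0; have [|v hv] := @common_nonzero_point C 3 [:: p; cross_form o u].
  by rewrite /= p0 (cross_form_neq0 d0).
have dv : det3 o u v != 0 by rewrite -ev_cross_form; apply: hv; rewrite !inE eqxx orbT.
have pv : ev p v != 0 by apply: hv; rewrite inE eqxx.
have [l [x [y [l0 e]]]] := chart_point d0 dv.
apply: contraNneq pv => c0; have : ev p (l *: v) = 0.
  by rewrite e -ev2_chart c0 /ev2 !horner0.
by rewrite (ev_scale _ _ hp) => /eqP; rewrite mulf_eq0 expf_eq0 (negPf l0) andbF.
Qed.

(** Elimination along [o] gives a nonzero combination in the inner variable alone, and the norm
    divides a power of it. *)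
Lemma norm_coprime_neq0 o u z d e psi b : det3 o u z != 0 -> psi \is d.+1.-homog ->
  b \is e.-homog -> ev psi o = 1 -> mcoprime psi b ->
  norm d (chart o u z psi) (chart o u z b) != 0.
Proof.
move=> d0 hpsi hb psio cop.
have o0 : o != 0 by apply: contraNneq d0 => ->; rewrite /det3 !mxE !mul0r !addr0.
have psi0 : psi != 0.
  by apply/eqP => p0; move: psio; rewrite p0 ev0 => /eqP; rewrite eq_sym oner_eq0.
have [A [B [k [r0 dr hr]]]] := eliminate_homog o0 psi0 hpsi hb cop.
have [c ec] := chart_of_cone u z dr.
have [mon sz] := chart_monic u z hpsi psio.
apply: (@norm_relation_neq0 C d _ mon sz (chart o u z A) (chart o u z B) _ c).
  by rewrite -ec chartD !chartM.
by have := chart_neq0 d0 hr r0; rewrite ec polyC_eq0.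
Qed.

Lemma zero_on_line d q (e e' : 'cV[C]_3) : q \is d.+1.-homog ->
  ev q e = 0 \/ exists y, ev q (y *: e + e') = 0.
Proof.
move=> hq; have [|q0] := eqVneq (ev q e) 0; [by left | right].
have [mon sz] : chart e e' e' ((ev q e)^-1 *: q) \is monic /\ size (chart e e' e' ((ev q e)^-1 *: q)) = d.+2.
  by apply: chart_monic; rewrite ?rpredZ // evZ mulVf.
have /closed_rootP[y] : size (fiber 0 (chart e e' e' ((ev q e)^-1 *: q))) != 1%N.
  by rewrite (size_fiber mon sz).
rewrite /root fiberE ev2_chart evZ mulf_eq0 invr_eq0 (negPf q0) /= => /eqP h.
by exists y; rewrite -h /pt scale0r addr0.
Qed.

Lemma exists_noncollinear v : v != 0 -> exists w w', det3 v w w' != 0.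
Proof.
move=> v0; apply: boolp.contrapT => h; case/negP: v0; apply/eqP.
have E i j : (delta_mx i 0 : 'cV[C]_3) j 0 = (j == i)%:R by rewrite mxE andbT.
have H w w' : det3 v w w' = 0.
  by apply/eqP/negPn/negP => d; apply: h; exists w, w'.
apply: cV3P; rewrite mxE.
- by rewrite -(H (delta_mx 1 0) (delta_mx 2 0)) /det3 !E /=; ring.
- by rewrite -(H (delta_mx 2 0) (delta_mx 0 0)) /det3 !E /=; ring.
- by rewrite -(H (delta_mx 0 0) (delta_mx 1 0)) /det3 !E /=; ring.
Qed.

Definition noncollinear (vs : seq 'cV[C]_3) := forall i j, (i < size vs)%N -> (j < size vs)%N ->
  i != j -> exists w, det3 (nth 0 vs i) (nth 0 vs j) w != 0.

(** The condition [Q] on [u] may depend on [o], which is chosen first. The last clause keeps [o] off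
    the lines joining two points of [vs], so that these points lie over different x. *)
Lemma generic_chart (vs : seq 'cV[C]_3) (P : seq S) (Q : 'cV[C]_3 -> S) :
  all (fun v => v != 0) vs -> noncollinear vs -> all (fun p => p != 0) P ->
  (forall o, (forall p, p \in P -> ev p o != 0) -> Q o != 0) ->
  exists o u z, [/\ forall p, p \in P -> ev p o != 0, ev (Q o) u != 0, det3 o u z != 0,
    forall v, v \in vs -> det3 o u v != 0 &
    forall i j, (i < size vs)%N -> (j < size vs)%N -> i != j ->
      det3 (nth 0 vs i) (nth 0 vs j) o != 0].
Proof.
move=> /allP vs0 nc P0 hQ.
have H v : exists w, v != 0 -> exists w', det3 v w w' != 0.
  by have [->|v0] := eqVneq v 0; [exists 0 | have [w h] := exists_noncollinear v0; exists w].
have [f hf] := boolp.choice H.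
pose s1 := [seq (if i == j then 1 else cross_form (nth 0 vs i) (nth 0 vs j) : S)
  | i <- iota 0 (size vs), j <- iota 0 (size vs)].
pose s2 := [seq cross_form v (f v) | v <- vs].
have X0 : 'X_0 != 0 :> S.
  apply/eqP => /(congr1 (fun p => ev p (const_mx 1))); rewrite evX ev0 mxE => /eqP.
  by rewrite oner_eq0.
have [|o ho] := @common_nonzero_point C 3 ('X_0 :: P ++ s1 ++ s2).
  rewrite /= X0 /= !all_cat P0 /=; apply/andP; split.
    apply/allP => p /allpairsP[[i j] /= [+ + ->]]; rewrite !mem_iota /= !add0n => hi hj.
    case: (i =P j) => [_|/eqP ij]; first by rewrite oner_eq0.
    by have [w] := nc i j hi hj ij; exact: cross_form_neq0.
  apply/allP => p /mapP[v hv ->]; have [w] := hf v (vs0 v hv); exact: cross_form_neq0.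
have o0 : o != 0.
  by have := ho 'X_0 (mem_head _ _); rewrite evX; apply: contraNneq => ->; rewrite mxE.
have oP p : p \in P -> ev p o != 0 by move=> hp; apply: ho; rewrite inE mem_cat hp orbT.
have [z [z' dz]] := exists_noncollinear o0.
have [|u hu] := @common_nonzero_point C 3 (Q o :: cross_form z o :: [seq cross_form v o | v <- vs]).
  rewrite /= (hQ o oP) /=; apply/andP; split.
    apply: (@cross_form_neq0 _ _ _ z'); by rewrite det3_swap oppr_eq0.
  apply/allP => p /mapP[v hv ->]; apply: (@cross_form_neq0 _ _ _ (f v)).
  rewrite det3_cycle det3_cycle det3_swap oppr_eq0 -ev_cross_form; apply: ho.
  rewrite inE !mem_cat; apply/orP; right; apply/orP; right; apply/orP; right.
  exact: map_f.
exists o, u, z; split=> //.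
- by apply: hu; rewrite inE eqxx.
- by rewrite -det3_cycle -ev_cross_form; apply: hu; rewrite !inE eqxx orbT.
- move=> v hv; rewrite -det3_cycle -ev_cross_form; apply: hu; rewrite !inE.
  by apply/orP; right; apply/orP; right; apply: map_f.
- move=> i j hi hj ij; rewrite -ev_cross_form; apply: ho.
  rewrite inE !mem_cat; apply/orP; right; apply/orP; right; apply/orP; left.
  apply/allpairsP; exists (i, j); rewrite !mem_iota /= !add0n; split=> //.
  by rewrite (negPf ij).
Qed.

End ChartGeometry.

(** * The line without singular points *)

Section Infinity.
Variable C : numClosedFieldType.
Local Notation S := {mpoly C[3]}.
Implicit Types (psi p q r : S) (u v w o z : 'cV[C]_3).

Definition cvec (a b c : C) : 'cV[C]_3 := \col_i nth 0 [:: a; b; c] i.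

(** [e] and [e'] span the kernel of [alpha], which is thus proportional to det(e, e', .); the cases
    follow its first nonzero coordinate. *)
Lemma kernel_basis (alpha : 'rV[C]_3) : alpha != 0 -> exists e e' : 'cV[C]_3,
  (exists u, det3 e e' u != 0) /\ forall v, det3 e e' v = 0 -> alpha *m v = 0.
Proof.
move=> a0; have E v : (alpha *m v) 0 0 = alpha 0 0 * v 0 0 + alpha 0 1 * v 1 0 + alpha 0 2 * v 2 0.
  by rewrite mxE sum3E.
have fin e e' k : k != 0 -> (forall v, det3 e e' v = k * (alpha *m v) 0 0) ->
    exists e e' : 'cV[C]_3, (exists u, det3 e e' u != 0) /\ forall v, det3 e e' v = 0 -> alpha *m v = 0.
  move=> k0 h; exists e, e'; split.
    have [i ai] : exists i, alpha 0 i != 0.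
      apply: boolp.contrapT => n; case/negP: a0; apply/eqP/rowP => i; rewrite mxE.
      by apply/eqP/negPn/negP => ai; apply: n; exists i.
    by exists (delta_mx i 0); rewrite h mulf_neq0 // -colE mxE.
  move=> v; rewrite h => /eqP; rewrite mulf_eq0 (negPf k0) /= => /eqP av.
  by apply/matrixP => i j; rewrite !ord1 av mxE.
have [z0|n0] := eqVneq (alpha 0 0) 0; last first.
  apply: (fin (cvec (- alpha 0 1) (alpha 0 0) 0) (cvec (- alpha 0 2) 0 (alpha 0 0)) _ n0) => v.
  by rewrite E /det3 !mxE /=; ring.
have [z1|n1] := eqVneq (alpha 0 1) 0; last first.
  apply: (fin (cvec 0 (- alpha 0 2) (alpha 0 1)) (cvec (alpha 0 1) (- alpha 0 0) 0) _ n1) => v.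
  by rewrite E /det3 !mxE /=; ring.
have n2 : alpha 0 2 != 0.
  apply: contraNneq a0 => z2; apply/eqP/rowP => i; rewrite mxE; move: i; exact: ord3P.
apply: (fin (cvec (alpha 0 2) 0 (- alpha 0 0)) (cvec 0 (alpha 0 2) (- alpha 0 1)) _ n2) => v.
by rewrite E /det3 !mxE /=; ring.
Qed.

Variables (X : vfield C) (m : nat).
Hypothesis hX : forall i, X i \is m.-homog.

Section Basis.
Variables e e' : 'cV[C]_3.
Hypothesis ind : exists u, det3 e e' u != 0.
Hypothesis hinf : forall v, v != 0 -> det3 e e' v = 0 -> ~ singular X v.

Definition cross_field : S :=
  (e 1 0 * e' 2 0 - e 2 0 * e' 1 0) *: X 0 + (e 2 0 * e' 0 0 - e 0 0 * e' 2 0) *: X 1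
  + (e 0 0 * e' 1 0 - e 1 0 * e' 0 0) *: X 2.

Lemma ev_cross_field v : ev cross_field v = det3 e e' (vfeval X v).
Proof. by rewrite /cross_field !(evD, evZ) /det3 !mxE -!/(ev _ _); ring. Qed.

Lemma cross_field_homog : cross_field \is m.-homog.
Proof. by rewrite /cross_field !rpredD ?rpredZ ?hX. Qed.

Lemma ev_theta_kernel v i :
  ev (theta X e) v * e' i 0 - ev (theta X e') v * e i 0 =
  ev cross_field v * v i 0 - det3 e e' v * ev (X i) v.
Proof. by rewrite -(evC (e' i 0) v) -(evC (e i 0) v) -!evM -evB theta_kernel evB !evM evX ev_cross_form. Qed.

Lemma comb_eq0 (a b : C) : (forall i, a * e' i 0 - b * e i 0 = 0) -> a = 0 /\ b = 0.
Proof.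
move=> h; have [u du] := ind; have [|] := det3_indep du (a := - b) (b := a) (c := 0).
  by apply/colP => i; rewrite !mxE mul0r addr0 mulNr addrC h.
by move=> /eqP; rewrite oppr_eq0 => /eqP -> -> _.
Qed.

Lemma singular_on_plane v o' : v != 0 -> det3 e e' o' != 0 -> ev (theta X e) v = 0 ->
  ev (theta X e') v = 0 -> ev (theta X o') v = 0 -> singular X v.
Proof.
move=> v0 d h1 h2 h3; apply: singular_of_theta => // w.
have [a [b [c ->]]] := lin_indep3_span (det3_indep d) w.
rewrite !ev_theta in h1 h2 h3 *; rewrite -[c *: o']addr0 -(scale0r o') addrA.
have -> : det3 (a *: e + b *: e' + c *: o' + 0 *: o') v (vfeval X v) =
  a * det3 e v (vfeval X v) + b * det3 e' v (vfeval X v) + c * det3 o' v (vfeval X v).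
  by rewrite /det3 !mxE; ring.
by rewrite h1 h2 h3 !mulr0 !addr0.
Qed.

Lemma plane_zero d p : p \is d.+1.-homog -> exists v, [/\ v != 0, det3 e e' v = 0 & ev p v = 0].
Proof.
move=> hp; have [u du] := ind.
have [h|[y h]] := zero_on_line e e' hp.
  exists e; split=> //; last by rewrite /det3; ring.
  by apply: contraNneq du => ->; rewrite /det3 !mxE; apply/eqP; ring.
exists (y *: e + e'); split=> //; last by rewrite /det3 !mxE; ring.
apply: contraNneq du => h0.
have -> : e' = - y *: e by apply/eqP; rewrite scaleNr -addr_eq0 addrC h0.
by rewrite /det3 !mxE; apply/eqP; ring.
Qed.

(** Some theta_o' has a zero [v] on the line. If det(e, e', X(v)) were 0 too, [theta_kernel] would
    make theta_e and theta_e' vanish at [v], and [v] would be singular. *)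
Lemma cross_field_nonzero : exists v, [/\ v != 0, det3 e e' v = 0 & ev cross_field v != 0].
Proof.
have [o' d] := ind; have [v [v0 dv hv]] := plane_zero (theta_homog o' hX).
apply: boolp.contrapT => n; case: (hinf v0 dv).
have k0 : ev cross_field v = 0 by apply/eqP/negPn/negP => k; apply: n; exists v.
have [|h1 h2] := @comb_eq0 (ev (theta X e) v) (ev (theta X e') v).
  by move=> i; rewrite ev_theta_kernel k0 dv !mul0r subrr.
exact: (singular_on_plane v0 d).
Qed.

End Basis.

(** The point found in [cross_field_nonzero] becomes the second basis vector of the line; this
    multiplies det(e, e', .) by a nonzero constant. *)
Lemma good_basis : no_stationary_at_infinity X -> exists e e' : 'cV[C]_3,
  [/\ exists u, det3 e e' u != 0, forall v, v != 0 -> det3 e e' v = 0 -> ~ singular X v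
   & det3 e e' (vfeval X e') != 0].
Proof.
move=> [alpha [a0 h]]; have [e [e' [ind ker]]] := kernel_basis a0.
have hinf v : v != 0 -> det3 e e' v = 0 -> ~ singular X v.
  by move=> v0 dv; apply: h => //; apply: ker.
have [v [v0 dv kv]] := cross_field_nonzero ind hinf; have [o' d] := ind.
have [a [b [c ve]]] := lin_indep3_span (det3_indep d) v.
have c0 : c = 0.
  have : c * det3 e e' o' = 0 by rewrite -dv ve /det3 !mxE; ring.
  by move/eqP; rewrite mulf_eq0 (negPf d) orbF => /eqP.
rewrite c0 scale0r addr0 in ve; rewrite ev_cross_field in kv.
have fin f t : t != 0 -> (forall w, det3 f v w = t * det3 e e' w) -> exists e e' : 'cV[C]_3,
  [/\ exists u, det3 e e' u != 0, forall v, v != 0 -> det3 e e' v = 0 -> ~ singular X v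
   & det3 e e' (vfeval X e') != 0].
  move=> t0 E; exists f, v; split; rewrite ?E ?mulf_neq0 //.
    by exists o'; rewrite E mulf_neq0.
  move=> w w0; rewrite E => /eqP; rewrite mulf_eq0 (negPf t0) /= => /eqP; exact: hinf.
have [b0|b0] := eqVneq b 0; last first.
  by apply: (fin e b b0) => w; rewrite ve /det3 !mxE; ring.
have a1 : - a != 0.
  by rewrite oppr_eq0; apply: contraNneq v0 => a0'; rewrite ve a0' b0 !scale0r addr0.
by apply: (fin e' _ a1) => w; rewrite ve b0 /det3 !mxE; ring.
Qed.

End Infinity.

Section SingularBound.
Variable C : numClosedFieldType.
Local Notation S := {mpoly C[3]}.
Implicit Types (psi p q r : S) (u v w o z : 'cV[C]_3).
Variables (X : vfield C) (m : nat).
Hypothesis hX : forall i, X i \is m.-homog.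
Variables e e' : 'cV[C]_3.
Hypothesis ind : exists u, det3 e e' u != 0.
Hypothesis hinf : forall v, v != 0 -> det3 e e' v = 0 -> ~ singular X v.
Hypothesis ke' : det3 e e' (vfeval X e') != 0.

Local Notation alpha := (cross_form e e').
Local Notation kappa := (cross_field X e e').

Lemma theta_basis_neq0 : theta X e != 0.
Proof. by apply: contraNneq ke' => t0; rewrite -ev_theta t0 ev0. Qed.

Lemma mdvd_scale q p (c : C) : mdvd q p -> mdvd q (p * c%:MP).
Proof. by move=> [s ->]; exists (s * c%:MP); rewrite mulrA. Qed.

Lemma mdvdB q p r : mdvd q p -> mdvd q r -> mdvd q (p - r).
Proof. by move=> [s ->] [t ->]; exists (s - t); rewrite mulrBr. Qed.

Lemma irreducible_degree q : mirreducible q -> mhomogeneous q -> exists k, q \is k.+1.-homog.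
Proof.
move=> irr [[|k] hk]; last by exists k.
have /msize_le1P := homog0_const hk; by rewrite leqNgt irr.1.
Qed.

(** A common irreducible factor [q] divides kappa x_i - alpha X_i. It does not divide alpha, since
    kappa(e') is nonzero; hence it divides every theta_w, and its zero on the line alpha = 0 would
    be singular. *)
Lemma theta_coprime : mcoprime (theta X e) (theta X e').
Proof.
move=> d [s es] [t et]; rewrite leqNgt; apply/negP => sd.
have [k hd] : exists k, d \is k.-homog.
  apply: (@homog_factor C 3 d s m.+1); rewrite -es; [exact: theta_basis_neq0 | exact: theta_homog].
have [q [r [irr hq dE]]] := irreducible_factor hd sd.
have qd p : mdvd d p -> mdvd q p by move=> [x ->]; exists (r * x); rewrite mulrA -dE.
have qk i : mdvd q (kappa * 'X_i - alpha * X i).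
  rewrite -theta_kernel; apply: mdvdB; apply: mdvd_scale; apply: qd; [by exists s | by exists t].
have [k' hqk] := irreducible_degree irr hq.
have e'0 : e' != 0.
  by have [u] := ind; apply: contraNneq => ->; rewrite /det3 !mxE; apply/eqP; ring.
have ae' : det3 e e' e' = 0 by rewrite /det3; ring.
have [[s' as']|na] := boolp.EM (mdvd q alpha).
  have qe' : ev q e' = 0.
    have sc : (msize s' <= 1)%N.
      have [u du] := ind; have a0 := cross_form_neq0 du.
      have := msize_hom (cross_form_homog e e') a0; rewrite as' msizeM.
      - by move: irr.1; move: (msize q) (msize s') => a b; lia.
      - exact: mirreducible_neq0.
      - by apply: contraNneq a0 => s0; rewrite as' s0 mulr0.
    have /msize_le1P[c s'c] := sc.
    have c0 : c != 0.
      have [u du] := ind; apply: contraNneq (cross_form_neq0 du) => c0.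
      by rewrite as' s'c c0 mpolyC0 mulr0.
    have : ev q e' * c = 0 by rewrite -(evC c e') -evM -s'c -as' ev_cross_form.
    by move/eqP; rewrite mulf_eq0 (negPf c0) orbF => /eqP.
  case/negP: e'0; apply/eqP/colP => i; rewrite mxE.
  have [x ex] := qk i; have := congr1 (fun p => ev p e') ex.
  rewrite evB !evM ev_cross_form ae' mul0r subr0 qe' mul0r ev_cross_field evX => /eqP.
  by rewrite mulf_eq0 (negPf ke') => /eqP.
have qt w : mdvd q (theta X w).
  have : mdvd q (alpha * theta X w).
    (* In the combination of kappa x_i - alpha X_i and kappa x_j - alpha X_j that cancels kappa,
       this product remains. *)
    have aux i j : mdvd q (alpha * ('X_i * X j - 'X_j * X i)).
      have -> : alpha * ('X_i * X j - 'X_j * X i) =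
        (kappa * 'X_i - alpha * X i) * 'X_j - (kappa * 'X_j - alpha * X j) * 'X_i by ring.
      have [x ex] := qk i; have [y ey] := qk j.
      by exists (x * 'X_j - y * 'X_i); rewrite ex ey; ring.
    have [x ex] := aux 1 2; have [y ey] := aux 2 0; have [z ez] := aux 0 1.
    exists ((w 0 0)%:MP * x + (w 1 0)%:MP * y + (w 2 0)%:MP * z).
    transitivity ((w 0 0)%:MP * (q * x) + (w 1 0)%:MP * (q * y) + (w 2 0)%:MP * (q * z)).
      by rewrite -ex -ey -ez /theta -!mul_mpolyC; ring.
    by ring.
  by case/(irreducible_euclid irr).
have [v [v0 dv qv]] := plane_zero ind hqk.
apply: (hinf v0 dv); apply: singular_of_theta => // w.
by have [x ->] := qt w; rewrite evM qv mul0r.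
Qed.

(* project v u is the point of the line through v and u on the plane alpha = 0. *)
Definition project v : 'M[C]_3 :=
  \matrix_(i, j) (v i 0 * ev alpha (delta_mx j 0) - ev alpha v * (i == j)%:R).

Lemma projectE v w : project v *m w = ev alpha w *: v - ev alpha v *: w.
Proof.
have aw : ev alpha w = \sum_j ev alpha (delta_mx j 0) * w j 0.
  by rewrite sum3E !ev_cross_form /det3 !mxE /=; ring.
apply/colP => i; rewrite !mxE aw mulr_suml -(mulr1 (ev alpha v)).
transitivity (\sum_j (ev alpha (delta_mx j 0) * w j 0 * v i 0 - ev alpha v * (i == j)%:R * w j 0)).
  by apply: eq_bigr => j _; rewrite mxE mulrBl; congr (_ - _); ring.
rewrite big_split /= mulr1; congr (_ + _); rewrite (bigD1 i) //= eqxx mulr1 big1 ?addr0 // => j ji.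
by rewrite eq_sym (negPf ji) mulr0 mul0r oppr0.
Qed.

Lemma project_kappa_neq0 v : ev alpha v != 0 -> kappa \mPo linsubst (project v) != 0.
Proof.
move=> av; have : ev (kappa \mPo linsubst (project v)) e' != 0.
  rewrite ev_linsubst projectE ev_cross_form (_ : det3 e e' e' = 0); last by rewrite /det3; ring.
  rewrite scale0r sub0r -scaleNr (ev_scale _ _ (cross_field_homog hX e e')).
  by rewrite mulf_neq0 ?expf_neq0 ?oppr_eq0 // ev_cross_field.
by apply: contraNneq => ->; rewrite ev0.
Qed.

Lemma dvdp_theta_line (pi A B : {poly C}) :
  (forall i, pi %| A * (e' i 0)%:P - B * (e i 0)%:P) -> pi %| A /\ pi %| B.
Proof.
move=> h; have [u du] := ind.
have comb (D E F : C) : pi %| D%:P * (A * (e' 0 0)%:P - B * (e 0 0)%:P)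
   + E%:P * (A * (e' 1 0)%:P - B * (e 1 0)%:P) + F%:P * (A * (e' 2 0)%:P - B * (e 2 0)%:P).
  by rewrite !dvdp_add // dvdp_mull // h.
split.
  have := comb (u 1 0 * e 2 0 - u 2 0 * e 1 0) (u 2 0 * e 0 0 - u 0 0 * e 2 0) (u 0 0 * e 1 0 - u 1 0 * e 0 0).
  rewrite [X in pi %| X](_ : _ = (det3 e e' u)%:P * A) ?mul_polyC ?dvdpZr //.
  by rewrite -!mul_polyC /det3 !(polyCD, polyCB, polyCM); ring.
have := comb (u 1 0 * e' 2 0 - u 2 0 * e' 1 0) (u 2 0 * e' 0 0 - u 0 0 * e' 2 0) (u 0 0 * e' 1 0 - u 1 0 * e' 0 0).
rewrite [X in pi %| X](_ : _ = (det3 e e' u)%:P * B) ?mul_polyC ?dvdpZr //.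
by rewrite -!mul_polyC /det3 !(polyCD, polyCB, polyCM); ring.
Qed.

(* The plane alpha = 0 is y = plane_height x in the chart (o, u, z). *)
Definition plane_height o u z : {poly C} :=
  - (ev alpha o)^-1 *: (ev alpha u *: 'X + (ev alpha z)%:P).

Lemma plane_heightE o u z x :
  (plane_height o u z).[x] = - (x * ev alpha u + ev alpha z) / ev alpha o.
Proof. by rewrite /plane_height !hornerE; ring. Qed.

Lemma alpha_lin (a b : C) v w : ev alpha (a *: v + b *: w) = a * ev alpha v + b * ev alpha w.
Proof. by rewrite !ev_cross_form /det3 !mxE; ring. Qed.

Lemma alpha_height o u z x : ev alpha o != 0 ->
  ev alpha (pt o u z x (plane_height o u z).[x]) = 0.
Proof.
move=> ao; rewrite plane_heightE.
have E y : ev alpha (pt o u z x y) = y * ev alpha o + (x * ev alpha u + ev alpha z).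
  by rewrite !ev_cross_form /det3 /pt !mxE; ring.
by rewrite E divfK // addNr.
Qed.

(** [kappa] on the line alpha = 0 has the full degree [m] in x because it does not vanish at the
    point of that line at infinity of the chart. *)
Lemma size_plane_divisor o u z : ev alpha o != 0 ->
  ev kappa (ev alpha u *: o - ev alpha o *: u) != 0 ->
  size (chart o u z kappa).[plane_height o u z] = m.+1.
Proof.
move=> ao ku; have [|sz cf] := @reversal C (chart o u z kappa).[plane_height o u z]
    (chart o z u kappa).[plane_height o z u] m.
  move=> x x0; rewrite !horner_ev2 !ev2_chart -(ev_scale _ _ (cross_field_homog hX e e')).
  congr ev; rewrite /pt !plane_heightE !scalerDr !scalerA mulfV // scale1r addrAC.
  by congr (_ *: _ + _ + _); field; rewrite ?x0 ?ao.
apply/eqP; rewrite eqn_leq sz ltnNge; apply/negP => /(nth_default 0).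
rewrite cf horner_ev2 ev2_chart ptinf plane_heightE mul0r add0r => h.
case/negP: ku; apply/eqP.
have -> : ev alpha u *: o - ev alpha o *: u = - ev alpha o *: (- ev alpha u / ev alpha o *: o + u).
  by rewrite scalerDr scalerA scaleNr; congr (_ *: _ - _); field.
by rewrite (ev_scale _ _ (cross_field_homog hX e e')) h mulr0.
Qed.

Lemma singular_off_plane v : v != 0 -> singular X v -> ev alpha v != 0.
Proof. by move=> v0 sv; apply/eqP; rewrite ev_cross_form => /(hinf v0). Qed.

Lemma mcoprime_scale (c : C) p q : c != 0 -> mcoprime p q -> mcoprime (c *: p) q.
Proof.
move=> c0 h d [s es] dq; apply: h => //; exists (c^-1 *: s).
by rewrite -scalerAr -es scalerA mulVf // scale1r.
Qed.

(* The curves theta_e = theta_e' = 0 meet in (m + 1)^2 points, and m of these,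
   the zeros of kappa on the line alpha = 0, are not singular. *)
Lemma singular_bound (vs : seq 'cV[C]_3) : all (fun v => v != 0) vs -> noncollinear vs ->
  (forall v, v \in vs -> singular X v) -> (size vs <= m ^ 2 + m + 1)%N.
Proof.
move=> vs0 nc sing; have [u0 du0] := ind.
(* The conditions with [project] ensure that no singular point lies on a line through [o] and a zero
   of [kappa] on alpha = 0, so that the two kinds of roots of the norm are different. *)
have [||o [u [z [hP hQ d0 dv dvv]]]] := @generic_chart C vs
  (theta X e :: alpha :: [seq kappa \mPo linsubst (project v) | v <- vs])
  (fun o => kappa \mPo linsubst (project o)) vs0 nc.
- rewrite /= theta_basis_neq0 (cross_form_neq0 du0) /=; apply/allP => p /mapP[v hv ->].
  by apply: project_kappa_neq0; apply: singular_off_plane (sing v hv); exact: (allP vs0).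
- by move=> o h; apply: project_kappa_neq0; apply: h; rewrite !inE eqxx orbT.
have to0 : ev (theta X e) o != 0 by apply: hP; rewrite inE eqxx.
have ao : ev alpha o != 0 by apply: hP; rewrite !inE eqxx orbT.
rewrite ev_linsubst projectE in hQ.
have kv v : v \in vs -> ev kappa (ev alpha o *: v - ev alpha v *: o) != 0.
  by move=> hv; rewrite -projectE -ev_linsubst; apply: hP; rewrite !inE; apply/orP; right; apply/orP; right; exact: map_f.
set c := (ev (theta X e) o)^-1; pose a := c *: theta X e; pose b := theta X e'.
have c0 : c != 0 by rewrite invr_eq0.
have ha : a \is m.+1.-homog by rewrite rpredZ // theta_homog.
have hb : b \is m.+1.-homog by exact: theta_homog.
have ao1 : ev a o = 1 by rewrite evZ mulVf.
set F := norm m (chart o u z a) (chart o u z b).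
have F0 : F != 0.
  exact: norm_coprime_neq0 d0 ha hb ao1 (mcoprime_scale c0 theta_coprime).
have [szF _] := norm_chart_coef u z ha hb ao1.
have [mon sz] := chart_monic u z ha ao1.
set s := plane_height o u z; set pi := (chart o u z kappa).[s].
have szpi : size pi = m.+1 by exact: size_plane_divisor.
have piF : pi %| F.
  (* On alpha = 0 the right side of [theta_kernel] is kappa times a coordinate. *)
  have [pA pB] : pi %| (chart o u z (theta X e)).[s] /\ pi %| (chart o u z (theta X e')).[s].
    apply: dvdp_theta_line => i.
    have := congr1 (fun p => (chart o u z p).[s]) (theta_kernel X e e' i).
    rewrite !chartB !chartM !chartC !hornerD !hornerN !hornerM !hornerC => ->.
    have -> : (chart o u z alpha).[s] = 0.
      by apply: poly_ext => x; rewrite horner_ev2 ev2_chart alpha_height // horner0.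
    by rewrite mul0r subr0 dvdp_mulr.
  apply: (dvdp_norm mon sz (s := s)) => //.
  by rewrite /a -mul_mpolyC chartM chartC hornerM dvdp_mull.
have H v : exists lxy : C * (C * C), v \in vs -> lxy.1 != 0 /\ lxy.1 *: v = pt o u z lxy.2.1 lxy.2.2.
  have [hv|] := boolP (v \in vs); last by exists (0, (0, 0)).
  by have [l [x [y h]]] := chart_point d0 (dv v hv); exists (l, (x, y)).
have [f hf] := boolp.choice H; pose xs := [seq (f v).2.1 | v <- vs].
have uxs : uniq xs.
  apply/(uniqP 0) => i j; rewrite !inE !size_map => hi hj.
  rewrite (nth_map 0) // (nth_map 0) // => exy; apply/eqP/negPn/negP => ij.
  have [li ei] := hf _ (mem_nth 0 hi); have [lj ej] := hf _ (mem_nth 0 hj).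
  case/negP: (dvv i j hi hj ij); apply/eqP; apply: (mulfI li); apply: (mulfI lj); rewrite !mulr0.
  move: ei ej exy; set vi := nth 0 vs i; set vj := nth 0 vs j => ei ej exy.
  transitivity (det3 ((f vi).1 *: vi) ((f vj).1 *: vj) o); first by rewrite /det3 !mxE; ring.
  by rewrite ei ej exy /det3 /pt !mxE; ring.
have rootF v : v \in vs -> root F (f v).2.1 && ~~ root pi (f v).2.1.
  move=> hv; have [lv ev_] := hf v hv; set x := (f v).2.1 in ev_ *; set y := (f v).2.2 in ev_ *.
  have zeroth w : ev (theta X w) (pt o u z x y) = 0.
    by rewrite -ev_ (ev_scale _ _ (theta_homog w hX)) (theta_of_singular _ (sing v hv)) mulr0.
  apply/andP; split.
    rewrite /root (norm_eq0_at mon sz (y := y)) // ev2_chart; last exact: zeroth.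
    by rewrite evZ zeroth mulr0.
  rewrite /root horner_ev2 ev2_chart.
  have -> : pt o u z x s.[x] = (f v).1 / ev alpha o *: (ev alpha o *: v - ev alpha v *: o).
    have e1 : pt o u z x s.[x] = (f v).1 *: v + (s.[x] - y) *: o.
      by rewrite ev_ /pt; apply/colP => i; rewrite !mxE; ring.
    have e2 : (s.[x] - y) * ev alpha o = - (f v).1 * ev alpha v.
      have := alpha_height u z x ao; rewrite -/s e1 alpha_lin => /eqP.
      by rewrite addrC addr_eq0 mulNr => /eqP.
    rewrite e1 scalerBr !scalerA divfK // -scaleNr; congr (_ + _ *: _).
    by apply: (mulIf ao); rewrite e2; field.
  rewrite (ev_scale _ _ (cross_field_homog hX e e')).
  by rewrite mulf_neq0 ?kv // expf_neq0 // mulf_neq0 // invr_eq0.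
have cop : coprimep (\prod_(x <- xs) ('X - x%:P)) pi.
  rewrite big_seq; apply: (big_ind (fun P : {poly C} => coprimep P pi)) => [|P Q hP' hQ'|x].
  - exact: coprime1p.
  - by rewrite coprimepMl hP'.
  by case/mapP => v hv ->; rewrite coprimep_sym coprimep_XsubC; case/andP: (rootF v hv).
have dvF : \prod_(x <- xs) ('X - x%:P) * pi %| F.
  rewrite Gauss_dvdp // piF andbT; apply: uniq_roots_dvdp.
    by apply/allP => x /mapP[v hv ->]; case/andP: (rootF v hv).
  by rewrite uniq_rootsE.
have := dvdp_leq F0 dvF.
have prod0 : \prod_(x <- xs) ('X - x%:P) != 0 by rewrite monic_neq0 // monic_prod_XsubC.
have pi0 : pi != 0 by rewrite -size_poly_gt0 szpi.
rewrite size_mul // size_prod_XsubC szpi size_map addnS /= => h.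
(* The sizes give size vs + m <= (m + 1)^2. *)
move: szF h; move: (size F) (size vs) => N K szF h; clear -szF h.
by have := leq_trans h szF; rewrite -mulnn; nia.
Qed.

End SingularBound.

Section SingularList.
Variable C : numClosedFieldType.
Local Notation S := {mpoly C[3]}.
Implicit Types (psi p q r : S) (u v w o z : 'cV[C]_3).

Lemma mdir_comm u w p : mdir u (mdir w p) = mdir w (mdir u p).
Proof.
rewrite /mdir; transitivity (\sum_i \sum_j (u i 0 * w j 0) *: p^`M(j)^`M(i)).
  apply: eq_bigr => i _; rewrite (raddf_sum (mderiv i)) scaler_sumr; apply: eq_bigr => j _.
  by rewrite /= mderivZ scalerA.
rewrite exchange_sum; apply: eq_bigr => j _; rewrite (raddf_sum (mderiv j)) scaler_sumr; apply: eq_bigr => i _.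
by rewrite /= mderivZ scalerA mderiv_comm mulrC.
Qed.

Definition gform p v : S := \sum_i ev p^`M(i) v *: 'X_i.

Lemma ev_gform p v w : ev (gform p v) w = ev (mdir w p) v.
Proof.
rewrite /gform /mdir !sum3E !evD !evZ !evX.
by congr (_ + _ + _); exact: mulrC.
Qed.

Lemma gform_neq0 p v w : ev (mdir w p) v != 0 -> gform p v != 0.
Proof. by rewrite -ev_gform; apply: contraNneq => ->; rewrite ev0. Qed.

Variables (X : vfield C) (m : nat).
Hypothesis hX : forall i, X i \is m.-homog.

Definition singular_list (vs : seq 'cV[C]_3) :=
  [/\ all (fun v => v != 0) vs, noncollinear vs & forall v, v \in vs -> singular X v].

(** If every admissible list could be enlarged, one of length m^2 + m + 2 would exist, against the
    bound. *)
Lemma complete_singular_list : no_stationary_at_infinity X -> exists vs,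
  [/\ singular_list vs, (size vs <= m ^ 2 + m + 1)%N &
   forall v, v != 0 -> singular X v -> exists w c, w \in vs /\ v = c *: w].
Proof.
move=> h; have [e [e' [ind hinf ke']]] := good_basis hX h.
have bound vs : singular_list vs -> (size vs <= m ^ 2 + m + 1)%N.
  by move=> [v0 nc sing]; exact: (singular_bound hX ind hinf ke' v0 nc sing).
apply: boolp.contrapT => n; suff [vs [hvs szvs]] : exists vs, singular_list vs /\ size vs = (m ^ 2 + m + 1).+1.
  by have := bound vs hvs; rewrite szvs ltnn.
elim: (m ^ 2 + m + 1).+1 => [|k [vs [hvs szvs]]]; first by exists [::]; split=> //; split.
have [v [v0 sv nv]] : exists v, [/\ v != 0, singular X v & forall w c, w \in vs -> v != c *: w].
  apply: boolp.contrapT => h'; apply: n; exists vs; split=> // [|v v0 sv]; first exact: bound.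
  apply: boolp.contrapT => h''; apply: h'; exists v; split=> // w c hw.
  by apply/eqP => e1; apply: h''; exists w, c.
have [vs0 nc sing] := hvs; exists (v :: vs); split; last by rewrite /= szvs.
have nonc w : w \in vs -> exists t, det3 w v t != 0.
  move=> hw; apply: boolp.contrapT => h'.
  have [|c ec] := @det3_collinear C w v (allP vs0 w hw).
    move=> t; apply/eqP/negPn/negP => d; apply: h'; exists t.
    by rewrite det3_cycle det3_cycle.
  by have := nv w c hw; rewrite ec eqxx.
split=> /=; first by rewrite v0.
  move=> [|i] [|j] //=; rewrite ?ltnS => hi hj ij.
  - have [t d] := nonc _ (mem_nth 0 hj); exists t.
    by rewrite det3_swap oppr_eq0.
  - exact: nonc (mem_nth 0 hi).
  - exact: nc.
by move=> w; rewrite inE => /orP[/eqP ->|/sing].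
Qed.

End SingularList.

Section GoodChart.
Variable C : numClosedFieldType.
Local Notation S := {mpoly C[3]}.
Implicit Types (psi p q r : S) (u v w o z : 'cV[C]_3).
Variables (X : vfield C) (vs : seq 'cV[C]_3).
Hypothesis hvs : singular_list X vs.
Hypothesis complete : forall v, v != 0 -> singular X v -> exists w c, w \in vs /\ v = c *: w.

(** [chart_fiber] puts at most one singular point over each x, so that the order of a norm at x can
    be attributed to a single point. *)
Record good_chart psi o u z : Prop := GoodChart {
  chart_unit : ev psi o = 1;
  chart_basis : det3 o u z != 0;
  chart_infinity : forall v, v != 0 -> singular X v -> det3 o u v != 0;
  chart_fiber : forall x y y', singular X (pt o u z x y) -> singular X (pt o u z x y') -> y = y' }.

Lemma det3_pt o u z x y : det3 o u (pt o u z x y) = det3 o u z.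
Proof. by rewrite /det3 /pt !mxE; ring. Qed.

Lemma pt_neq0 o u z x y : det3 o u z != 0 -> pt o u z x y != 0.
Proof.
apply: contraNneq => e; rewrite -(det3_pt o u z x y) e /det3 !mxE.
by apply/eqP; ring.
Qed.

Lemma exists_good_chart d psi Q : psi \is d.+1.-homog -> psi != 0 -> Q != 0 ->
  exists o u z, good_chart psi o u z /\ ev Q u != 0.
Proof.
move=> hpsi psi0 Q0; have [vs0 nc sing] := hvs.
have [||o [u [z [hP hQ d0 dv dvv]]]] := @generic_chart C vs [:: psi] (fun=> Q) vs0 nc.
- by rewrite /= psi0.
- by [].
have po : ev psi o != 0 by apply: hP; rewrite inE.
(* Rescaling [o] by this root makes psi(o) = 1. *)
set t := (d.+1).-root (ev psi o)^-1.
have td : t ^+ d.+1 = (ev psi o)^-1 by rewrite rootCK.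
have t0 : t != 0.
  by apply/eqP => e; move: td; rewrite e expr0n /= => /esym/eqP; rewrite invr_eq0 (negPf po).
have dt v w : det3 (t *: o) v w = t * det3 o v w by rewrite /det3 !mxE; ring.
have dt' v w : det3 v w (t *: o) = t * det3 v w o by rewrite /det3 !mxE; ring.
have inf v : v != 0 -> singular X v -> det3 (t *: o) u v != 0.
  move=> v0 sv; have [w [c [hw e]]] := complete v0 sv.
  rewrite dt mulf_neq0 // e (_ : det3 o u (c *: w) = c * det3 o u w); last by rewrite /det3 !mxE; ring.
  by rewrite mulf_neq0 ?dv //; apply: contraNneq v0 => c0; rewrite e c0 scale0r.
have dtz : det3 (t *: o) u z != 0 by rewrite dt mulf_neq0.
exists (t *: o), u, z; split=> //; split=> //.
  by rewrite (ev_scale _ _ hpsi) td mulVf.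
move=> x y y'; set o' := t *: o; set P := pt _ _ _ x y; set P' := pt _ _ _ x y' => sP sP'.
have P0 : P != 0 by exact: pt_neq0.
have P'0 : P' != 0 by exact: pt_neq0.
have [w [c [hw e]]] := complete P0 sP; have [w' [c' [hw' e']]] := complete P'0 sP'.
have c0 : c != 0 by apply: contraNneq P0 => c0; rewrite e c0 scale0r.
have c'0 : c' != 0 by apply: contraNneq P'0 => c0'; rewrite e' c0' scale0r.
have dc : c * det3 o' u w = det3 o' u z.
  by rewrite -(det3_pt o' u z x y) -/P e /det3 !mxE; ring.
have dc' : c' * det3 o' u w' = det3 o' u z.
  by rewrite -(det3_pt o' u z x y') -/P' e' /det3 !mxE; ring.
have [i hi ew] := nthP 0 hw; have [j hj ew'] := nthP 0 hw'.
have [eij|nij] := eqVneq i j.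
  have eww : w = w' by rewrite -ew -ew' eij.
  have ecc : c = c'.
    have dw : det3 o' u w != 0 by apply: contraNneq dtz => dw; rewrite -dc dw mulr0.
    by apply: (mulIf dw); rewrite dc eww dc'.
  have : (y - y') *: o' = 0.
    have -> : (y - y') *: o' = P - P' by rewrite /P /P' /pt; apply/colP => k; rewrite !mxE; ring.
    by rewrite e e' eww ecc subrr.
  move/eqP; rewrite scaler_eq0 subr_eq0 => /orP[/eqP //|/eqP o'0].
  by case/negP: dtz; rewrite -/o' o'0 /det3 !mxE; apply/eqP; ring.
(* Two points of one fibre are collinear with [o], which was excluded for distinct members of
   [vs]. *)
have : det3 P P' o' = 0 by rewrite /P /P' /pt /det3 !mxE; ring.
rewrite e e' (_ : det3 _ _ _ = c * c' * (t * det3 w w' o)); last first.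
  by rewrite -dt' /det3 !mxE; ring.
have := dvv i j hi hj nij; rewrite ew ew' => h /eqP.
by rewrite !mulf_eq0 (negPf c0) (negPf c'0) (negPf t0) (negPf h).
Qed.

End GoodChart.

Lemma split_quadratic (R : comPzRingType) (c1 c2 A B D x y : R) :
  c1 * x + c2 * y + A * x ^+ 2 + B * x * y + D * y ^+ 2 =
  (c1 + A * x + B * y) * x + (c2 + 0 * x + D * y) * y.
Proof. by ring. Qed.

(** * Degrees of invariant curves *)

Section Node.
Variable C : numClosedFieldType.
Local Notation S := {mpoly C[3]}.
Implicit Types (psi p q r : S) (u v w o z : 'cV[C]_3).

Lemma det3_of_indep v (q1 q2 : 'cV[C]_3) : v != 0 -> lin_indep3 v q1 q2 -> det3 v q1 q2 != 0.
Proof.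
move=> v0 ind; have [w [w' d]] := exists_noncollinear v0; apply: contraNneq d => d.
have [a [b [c ew]]] := lin_indep3_span ind w; have [a' [b' [c' ew']]] := lin_indep3_span ind w'.
have -> : det3 v w w' = (b * c' - c * b') * det3 v q1 q2.
  by rewrite ew ew' /det3 !mxE; ring.
by rewrite d mulr0.
Qed.

Lemma ev_mdir3 a b c v (q1 q2 : 'cV[C]_3) p w : ev (mdir (a *: v + b *: q1 + c *: q2) p) w =
  a * ev (mdir v p) w + b * ev (mdir q1 p) w + c * ev (mdir q2 p) w.
Proof. by rewrite -[_ + b *: q1]scale1r !mdirD scale1r !evD !evZ. Qed.

Variables (psi : S) (n : nat) (P q1 q2 : 'cV[C]_3).
Hypothesis hpsi : psi \is n.+2.-homog.
Hypothesis P0 : P != 0.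
Hypothesis ind : lin_indep3 P q1 q2.
Hypothesis grad : forall w, ev (mdir w psi) P = 0.
Hypotheses (h11 : bilinear2 q1 q1 psi P = 0) (h22 : bilinear2 q2 q2 psi P = 0).
Hypothesis h12 : bilinear2 q1 q2 psi P != 0.

Let h := bilinear2 q1 q2 psi P.

(** By Euler's formula [P] lies in the kernel of the Hessian, and [q1], [q2] are isotropic, so only
    the mixed entry [h] remains. *)
Lemma hessian_coord a0 a1 a2 b0 b1 b2 :
  bilinear2 (a0 *: P + a1 *: q1 + a2 *: q2) (b0 *: P + b1 *: q1 + b2 *: q2) psi P
  = (a1 * b2 + a2 * b1) * h.
Proof.
have hP w : ev (mdir P (mdir w psi)) P = 0.
  by rewrite (euler_ev _ (mdir_homog w hpsi)) grad mulr0.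
have hP' w : ev (mdir w (mdir P psi)) P = 0 by rewrite mdir_comm.
have k11 : ev (mdir q1 (mdir q1 psi)) P = 0 := h11.
have k22 : ev (mdir q2 (mdir q2 psi)) P = 0 := h22.
have k12 : ev (mdir q1 (mdir q2 psi)) P = h by [].
have k21 : ev (mdir q2 (mdir q1 psi)) P = h by rewrite mdir_comm.
have inner w : ev (mdir w (mdir (b0 *: P + b1 *: q1 + b2 *: q2) psi)) P =
  b1 * ev (mdir w (mdir q1 psi)) P + b2 * ev (mdir w (mdir q2 psi)) P.
  rewrite mdir_comm ev_mdir3 hP mulr0 add0r.
  by rewrite [mdir q1 (mdir w psi)]mdir_comm [mdir q2 (mdir w psi)]mdir_comm.
rewrite /bilinear2 ev_mdir3 hP !inner k11 k12 k21 k22.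
by ring.
Qed.

Variables (o u z : 'cV[C]_3) (x0 y0 : C).
Hypothesis PE : P = pt o u z x0 y0.
Hypotheses (dz : det3 o u z != 0) (psio : ev psi o = 1).
Variable w : 'cV[C]_3.
Hypotheses (w1 : det3 P w q2 != 0) (w2 : det3 P q1 w != 0).
Hypothesis ow : ev (mdir w (mdir o psi)) P != 0.
Hypothesis uniq_zero : forall y, ev psi (pt o u z x0 y) = 0 -> y != y0 ->
  ev (mdir w psi) (pt o u z x0 y) != 0.

Lemma node_curve_zero : ev psi P = 0.
Proof.
have := euler_ev P hpsi; rewrite grad => /esym/eqP.
by rewrite mulf_eq0 pnatr_eq0 => /eqP.
Qed.

(** For [w] off both tangents of the node, the polar curve psi_w is smooth there with a tangent
    different from both, so it meets [psi] with multiplicity 2; [ow] says that its tangent is not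
    the vertical of the chart. *)
Lemma node_norm_order :
  ~~ (('X - x0%:P) ^+ 3 %| norm n.+1 (chart o u z psi) (chart o u z (mdir w psi))).
Proof.
have [mon sz] := chart_monic u z hpsi psio.
have [A [B [D [e1 e2 e3 e4]]]] := taylor2 o u z x0 y0 psi.
have [A' [B' [D' [f1 _ _ _]]]] := taylor2 o u z x0 y0 (mdir w psi).
rewrite -PE !grad node_curve_zero !polyC0 !mul0r !add0r in e1; rewrite -PE grad polyC0 add0r in f1.
rewrite -PE in e2 e3 e4.
apply: (@norm_le2_of_node C x0 y0 n.+1 _ _ mon sz _ A B D _ _ A' B' 0 D' _ _ e1 _ erefl erefl).
- by move=> y; rewrite !ev2_chart; exact: uniq_zero.
- by rewrite f1; exact: split_quadratic.
- by rewrite mdir_comm.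
have [a0 [a1 [a2 oE]]] := lin_indep3_span ind o.
have [b0 [b1 [b2 uE]]] := lin_indep3_span ind u.
have [c0 [c1 [c2 wE]]] := lin_indep3_span ind w.
have c10 : c1 != 0.
  by apply: contraNneq w1 => c10; rewrite wE c10 /det3 !mxE; apply/eqP; ring.
have c20 : c2 != 0.
  by apply: contraNneq w2 => c20; rewrite wE c20 /det3 !mxE; apply/eqP; ring.
have dl : b1 * a2 - a1 * b2 != 0.
  apply: contraNneq dz => dl; rewrite -(det3_pt o u z x0 y0) -PE.
  have -> : det3 o u P = (a1 * b2 - b1 * a2) * det3 P q1 q2 by rewrite oE uE /det3 !mxE; ring.
  by rewrite -opprB dl oppr0 mul0r.
have Huw : ev (mdir u (mdir w psi)) P = (b1 * c2 + b2 * c1) * h by rewrite uE wE; exact: hessian_coord.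
have How : ev (mdir o (mdir w psi)) P = (a1 * c2 + a2 * c1) * h by rewrite oE wE; exact: hessian_coord.
have Huu : ev (mdir u (mdir u psi)) P = (b1 * b2 + b2 * b1) * h by rewrite uE; exact: hessian_coord.
have Huo : ev (mdir u (mdir o psi)) P = (b1 * a2 + b2 * a1) * h by rewrite uE oE; exact: hessian_coord.
have Hoo : ev (mdir o (mdir o psi)) P = (a1 * a2 + a2 * a1) * h by rewrite oE; exact: hessian_coord.
have two : (2 : C) != 0 by rewrite pnatr_eq0.
suff : 2 * (ev2 D x0 y0 * ev (mdir u (mdir w psi)) P ^+ 2 -
  ev2 B x0 y0 * ev (mdir u (mdir w psi)) P * ev (mdir o (mdir w psi)) P +
  ev2 A x0 y0 * ev (mdir o (mdir w psi)) P ^+ 2) != 0 by rewrite mulf_eq0 (negPf two).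
have -> : 2 * (ev2 D x0 y0 * ev (mdir u (mdir w psi)) P ^+ 2 -
  ev2 B x0 y0 * ev (mdir u (mdir w psi)) P * ev (mdir o (mdir w psi)) P +
  ev2 A x0 y0 * ev (mdir o (mdir w psi)) P ^+ 2) =
  - 2 * (h ^+ 3 * (b1 * a2 - a1 * b2) ^+ 2 * c1 * c2).
  transitivity ((2 * ev2 D x0 y0) * ev (mdir u (mdir w psi)) P ^+ 2 -
    2 * ev2 B x0 y0 * ev (mdir u (mdir w psi)) P * ev (mdir o (mdir w psi)) P +
    (2 * ev2 A x0 y0) * ev (mdir o (mdir w psi)) P ^+ 2); first by ring.
  by rewrite e2 e3 e4 Huw How Huu Huo Hoo; ring.
by rewrite !mulf_neq0 ?expf_neq0 ?oppr_eq0.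
Qed.

Lemma node_norm_lower b : ev b P = 0 ->
  ('X - x0%:P) ^+ 2 %| norm n.+1 (chart o u z psi) (chart o u z b).
Proof.
move=> bP; have [mon sz] := chart_monic u z hpsi psio.
have [A [B [D [e1 _ _ _]]]] := taylor2 o u z x0 y0 psi.
have [A' [B' [D' [f1 _ _ _]]]] := taylor2 o u z x0 y0 b.
rewrite -PE !grad node_curve_zero !polyC0 !mul0r !add0r in e1; rewrite -PE bP polyC0 add0r in f1.
apply: (@norm_ge2_of_node C x0 y0 n _ _ A B D
  ((ev (mdir u b) P)%:P%:P + A' * ('X - x0%:P)%:P + B' * ('X - y0%:P%:P))
  ((ev (mdir o b) P)%:P%:P + 0 * ('X - x0%:P)%:P + D' * ('X - y0%:P%:P)) mon sz e1).
by rewrite f1; exact: split_quadratic.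
Qed.

End Node.

Section Invariants.
Variable C : numClosedFieldType.
Local Notation S := {mpoly C[3]}.
Implicit Types (psi p r : S) (u v w o z : 'cV[C]_3).

(** The order supplied by [D] pays for all of [B], so the order of [E] is left for [A]. *)
Lemma order_transfer (x : C) (A B D E : {poly C}) l k : A * B = D * E ->
  ~~ (('X - x%:P) ^+ l.+1 %| B) -> ('X - x%:P) ^+ l %| D -> ('X - x%:P) ^+ k %| E ->
  ('X - x%:P) ^+ k %| A.
Proof.
move=> e nB dD dE; have B0 : B != 0 by apply: contraNneq nB => ->; exact: dvdp0.
have X0 j : ('X - x%:P) ^+ j != 0 :> {poly C} by rewrite expf_neq0 // polyXsubC_eq0.
have [j [B' + BE]] := multiplicity_XsubC B x; rewrite B0 /= => nr.
have jl : (j <= l)%N.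
  by rewrite leqNgt; apply: contra nB => lj; rewrite BE dvdp_mull // dvdp_exp2l.
have /dvdpP[D' DE] : ('X - x%:P) ^+ j %| D by apply: dvdp_trans dD; rewrite dvdp_exp2l.
have {}e : A * B' = D' * E.
  by apply: (mulIf (X0 j)); rewrite -mulrA -BE e DE mulrAC.
by rewrite -(Gauss_dvdpl _ (coprimep_XsubC_exp k nr)) e dvdp_mull.
Qed.

Variables (X : vfield C) (m : nat).
Hypothesis hX : forall i, X i \is m.-homog.

Definition invariant_curve psi := [/\ mirreducible psi, mhomogeneous psi & semi_invariant X psi].

Hypothesis node : forall v, v != 0 -> singular X v ->
  exists q1 q2 br, [/\ lin_indep3 v q1 q2,
    forall psi, invariant_curve psi -> ev psi v = 0 -> node_type v q1 q2 br psi
  & forall b g h, g != 0 -> h != 0 -> mcoprime g h -> br b g -> br b h -> False].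

Lemma singular_of_grad psi v : invariant_curve psi -> v != 0 -> ev psi v = 0 ->
  (forall w, ev (mdir w psi) v = 0) -> singular X v.
Proof. by move=> [irr hpsi inv]; exact: singular_point_of_curve. Qed.

Section OneCurve.
Variables (psi : S) (n : nat) (o u z : 'cV[C]_3).
Hypotheses (inv : invariant_curve psi) (chartP : good_chart X psi o u z).

Local Notation N d b := (norm d (chart o u z psi) (chart o u z b)).

Lemma norm_proportional d (b b' c c' q : S) : psi \is d.+1.-homog ->
  b * c' - b' * c = q * psi -> N d b * N d c' = N d b' * N d c.
Proof.
move=> hd e; have [mon sz] := chart_monic u z hd (chart_unit chartP).
have bc : b * c' = b' * c + psi * q by rewrite [psi * q]mulrC -e addrC subrK.
rewrite -[LHS]normM -[RHS]normM -[X in norm _ _ X = _]chartM -[X in _ = norm _ _ X]chartM.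
by rewrite bc chartD [chart o u z (psi * q)]chartM (norm_mod mon sz).
Qed.

Hypothesis hpsi : psi \is n.+2.-homog.
Variable b : 'cV[C]_3 -> S.
Hypothesis rel : forall w w', exists q, b w * mdir w' psi - b w' * mdir w psi = q * psi.
Hypothesis bnode : forall v w, v != 0 -> singular X v ->
  (forall w', ev (mdir w' psi) v = 0) -> ev (b w) v = 0.

(** The ratio b_w / psi_w does not depend on [w] along the curve, so each x0 may use its own [w]:
    one for which psi_w has no zero over x0, or, over a node, one for which the norm of psi_w has
    order at most 2, while that of b_w has order at least 2 by [bnode]. *)
Lemma gradient_norm_dvd w0 : N n.+1 (mdir w0 psi) != 0 -> N n.+1 (mdir w0 psi) %| N n.+1 (b w0).
Proof.
move=> N0; have d0 := chart_basis chartP; have psio := chart_unit chartP.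
have [mon sz] := chart_monic u z hpsi psio.
have relN w : N n.+1 (b w0) * N n.+1 (mdir w psi) = N n.+1 (b w) * N n.+1 (mdir w0 psi).
  by have [q e] := rel w0 w; exact: norm_proportional e.
apply: (dvdp_local N0) => x0 k dk; have [rs szr rsE] := fiber_roots mon sz x0.
have mem_rs y : (y \in rs) = (ev psi (pt o u z x0 y) == 0).
  by rewrite -root_prod_XsubC -rsE /root fiberE ev2_chart.
have [[y0 [yz grad]]|ng] := boolp.EM (exists y0, ev psi (pt o u z x0 y0) = 0 /\
    forall w, ev (mdir w psi) (pt o u z x0 y0) = 0); last first.
  have [|w hw] := @common_nonzero_point C 3 [seq gform psi (pt o u z x0 y) | y <- rs].
    apply/allP => p /mapP[y yr ->]; apply/negP => /eqP g0; apply: ng; exists y.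
    split; first by apply/eqP; rewrite -mem_rs.
    by move=> w; rewrite -ev_gform g0 ev0.
  have nr : ~~ root (N n.+1 (mdir w psi)) x0.
    apply: (norm_neq0_at mon sz) => y; rewrite !ev2_chart => /eqP; rewrite -mem_rs => yr.
    by rewrite -ev_gform; apply: hw; exact: map_f.
  rewrite -(Gauss_dvdpl _ (coprimep_XsubC_exp k nr)) relN.
  exact: dvdp_mull.
set P := pt o u z x0 y0 in yz grad.
have P0 : P != 0 by exact: pt_neq0.
have sP : singular X P by exact: singular_of_grad inv P0 yz grad.
have [q1 [q2 [br [ind nt _]]]] := node P0 sP.
case: (nt psi inv yz) => [[_ g1 _]|[_ g2 _]|[_ _ h12 h11 h22]].
- case/negP: g1; apply/eqP; exact: grad.
- case/negP: g2; apply/eqP; exact: grad.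
have dP := det3_of_indep P0 ind.
(* The Hessian at the node is degenerate only along [P], and [o] is not proportional to [P]. *)
have ow : gform (mdir o psi) P != 0.
  have [a0 [a1 [a2 oE]]] := lin_indep3_span ind o.
  have Ho := hessian_coord hpsi grad h11 h22.
  have [a20|a20] := eqVneq a2 0; last first.
    apply: (@gform_neq0 _ _ _ (0 *: P + 1 *: q1 + 0 *: q2)); rewrite oE.
    by rewrite -/(bilinear2 _ _ _ _) Ho mul1r mul0r addr0 mulf_neq0.
  apply: (@gform_neq0 _ _ _ (0 *: P + 0 *: q1 + 1 *: q2)); rewrite oE.
  rewrite -/(bilinear2 _ _ _ _) Ho mul1r mul0r add0r mulf_neq0 //.
  apply: contraNneq d0 => a10; rewrite -(det3_pt o u z x0 y0) -/P oE a10 a20 /det3 !mxE.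
  by apply/eqP; ring.
have [|w hw] := @common_nonzero_point C 3 [:: cross_form q2 P, cross_form P q1, gform (mdir o psi) P
    & [seq gform psi (pt o u z x0 y) | y <- rs & y != y0]].
  apply/allP => p; rewrite !in_cons => /or4P[/eqP->|/eqP->|/eqP->|].
  - by apply: (@cross_form_neq0 _ q2 P q1); rewrite det3_cycle.
  - exact: cross_form_neq0 dP.
  - exact: ow.
  move=> /mapP[y]; rewrite mem_filter => /andP[ny yr] ->.
  apply/negP => /eqP g0; case/negP: ny; apply/eqP; apply: (chart_fiber chartP _ sP).
  apply: (singular_of_grad inv); first exact: pt_neq0.
    by apply/eqP; rewrite -mem_rs.
  by move=> w; rewrite -ev_gform g0 ev0.
have hw1 : det3 P w q2 != 0.
  by rewrite -det3_cycle -ev_cross_form; apply: hw; exact: mem_head.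
have hw2 : det3 P q1 w != 0.
  by rewrite -ev_cross_form; apply: hw; rewrite in_cons mem_head orbT.
have hw3 : ev (mdir w (mdir o psi)) P != 0.
  by rewrite -ev_gform; apply: hw; rewrite 2!in_cons mem_head !orbT.
have hw4 y : ev psi (pt o u z x0 y) = 0 -> y != y0 -> ev (mdir w psi) (pt o u z x0 y) != 0.
  move=> /eqP; rewrite -mem_rs => yr ny; rewrite -ev_gform; apply: hw.
  rewrite 3!in_cons; apply/orP; right; apply/orP; right; apply/orP; right.
  by apply/mapP; exists y; [rewrite mem_filter ny | exact: erefl].
have upper := node_norm_order hpsi ind grad h11 h22 h12 (erefl P) d0 psio hw1 hw2 hw3 hw4.
have lower := node_norm_lower hpsi grad (erefl P) psio (bnode w P0 sP grad).
exact: (order_transfer (relN w) upper lower dk).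
Qed.

End OneCurve.
End Invariants.

Section DegreeBound.
Variable C : numClosedFieldType.
Local Notation S := {mpoly C[3]}.
Implicit Types (psi p r : S) (u v w o z : 'cV[C]_3).

Variables (X : vfield C) (m : nat).
Hypothesis hX : forall i, X i \is m.-homog.
Hypothesis hne : no_stationary_at_infinity X.
Hypothesis node : forall v, v != 0 -> singular X v ->
  exists q1 q2 br, [/\ lin_indep3 v q1 q2,
    forall psi, invariant_curve X psi -> ev psi v = 0 -> node_type v q1 q2 br psi
  & forall b g h, g != 0 -> h != 0 -> mcoprime g h -> br b g -> br b h -> False].
Variable vs : seq 'cV[C]_3.
Hypothesis hvs : singular_list X vs.
Hypothesis complete : forall v, v != 0 -> singular X v -> exists w c, w \in vs /\ v = c *: w.

Lemma infinite_neq0 o u z y : det3 o u z != 0 -> y *: o + u != 0.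
Proof.
apply: contraNneq => e; have -> : u = - y *: o by apply/eqP; rewrite scaleNr -addr_eq0 addrC e.
by rewrite /det3 !mxE; apply/eqP; ring.
Qed.

Lemma infinite_nonsingular psi o u z y : good_chart X psi o u z -> ~ singular X (y *: o + u).
Proof.
move=> gc /(chart_infinity gc (infinite_neq0 y (chart_basis gc))).
by rewrite (_ : det3 _ _ _ = 0) ?eqxx // /det3 !mxE; ring.
Qed.

Lemma infinite_roots d psi o u z : psi \is d.+1.-homog -> ev psi o = 1 ->
  exists rs : seq C, size rs = d.+1 /\ forall y, (y \in rs) = (ev psi (y *: o + u) == 0).
Proof.
move=> hpsi psio; have [mon sz] := chart_monic z u hpsi psio.
have [rs szr rsE] := fiber_roots mon sz 0; exists rs; split=> // y.
by rewrite -root_prod_XsubC -rsE /root fiberE ev2_chart ptinf.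
Qed.

(** For fixed [v] the value of theta_w is a linear form in [w], so a general [w] keeps it nonzero at
    finitely many nonsingular points. *)
Lemma theta_form w v : ev (theta X w) v = ev (cross_form v (vfeval X v)) w.
Proof. by rewrite ev_theta ev_cross_form det3_cycle. Qed.

Lemma theta_form_neq0 v : v != 0 -> ~ singular X v -> cross_form v (vfeval X v) != 0.
Proof.
move=> v0 ns; apply/eqP => e; apply: ns; apply: singular_of_theta => // w.
by rewrite theta_form e ev0.
Qed.

Lemma grad_form_neq0 psi v : invariant_curve X psi -> v != 0 -> ev psi v = 0 -> ~ singular X v ->
  gform psi v != 0.
Proof.
move=> inv v0 pv ns; apply/eqP => e; apply: ns; apply: (singular_of_grad inv v0 pv) => w.
by rewrite -ev_gform e ev0.
Qed.

Lemma generic_direction d psi o u z : invariant_curve X psi -> psi \is d.+1.-homog ->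
  good_chart X psi o u z -> exists w, forall y, ev psi (y *: o + u) = 0 ->
  ev (mdir w psi) (y *: o + u) != 0 /\ ev (theta X w) (y *: o + u) != 0.
Proof.
move=> inv hpsi gc; have [rs [_ mem_rs]] := infinite_roots u z hpsi (chart_unit gc).
have [|w hw] := @common_nonzero_point C 3 ([seq gform psi (y *: o + u) | y <- rs]
    ++ [seq cross_form (y *: o + u) (vfeval X (y *: o + u)) | y <- rs]).
  apply/allP => p; rewrite mem_cat => /orP[] /mapP[y yr ->].
    apply: (grad_form_neq0 inv (infinite_neq0 y (chart_basis gc))).
      by apply/eqP; rewrite -mem_rs.
    exact: infinite_nonsingular gc.
  apply: (theta_form_neq0 (infinite_neq0 y (chart_basis gc))).
  exact: infinite_nonsingular gc.
exists w => y /eqP; rewrite -mem_rs => yr; split.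
  by rewrite -ev_gform; apply: hw; rewrite mem_cat (map_f (fun y => gform psi (y *: o + u)) yr).
rewrite theta_form; apply: hw; rewrite mem_cat.
by rewrite (map_f (fun y => cross_form (y *: o + u) (vfeval X (y *: o + u))) yr) orbT.
Qed.

Lemma not_all_theta0 : ~ (forall w, theta X w = 0).
Proof.
have [e [e' [_ _ ke']]] := good_basis hX hne => h.
by case/negP: ke'; rewrite -ev_theta h ev0.
Qed.

Lemma irreducible_not_mdvd psi r : mirreducible psi -> mcoprime psi r -> ~ mdvd psi r.
Proof.
move=> irr cop d; have : (msize psi <= 1)%N by apply: cop => //; exists 1; rewrite mulr1.
by rewrite leqNgt irr.1.
Qed.

Lemma small_coprime d psi r : mirreducible psi -> psi \is d.+1.-homog -> r \is d.-homog ->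
  r != 0 -> mcoprime psi r.
Proof.
move=> irr hpsi hr r0; apply: irreducible_coprime_small => //.
by rewrite (msize_hom hr r0) (msize_hom hpsi (mirreducible_neq0 irr)).
Qed.

(* If d >= m + 2, put b_w = g theta_w - c psi_w with deg g = d - m - 2. At the level of
   norms b_w0 is divisible by psi_w0, and c is chosen so that b_w0 has one zero at infinity
   on psi = 0 that psi_w0 does not have; by degrees b_w0 is then a multiple of psi. *)
Lemma invariant_degree d psi : invariant_curve X psi -> psi \is d.-homog -> (d <= m.+1)%N.
Proof.
move=> inv; have [irr _ si] := inv; rewrite leqNgt => hd; apply/negP => lt.
have [n [dn mn]] : exists n, d = n.+2 /\ (m <= n)%N by exists d.-2; lia.
subst d; have psi0 := mirreducible_neq0 irr.
have one0 : (1 : S) != 0 by exact: oner_neq0.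
have [o [u [z [gc _]]]] := exists_good_chart hvs complete hd psi0 one0.
have psio := chart_unit gc; have d0 := chart_basis gc.
have [w0 hw0] := generic_direction inv hd gc.
have [rs [szr mem_rs]] := infinite_roots u z hd psio.
have [y1 y1r] : exists y, y \in rs.
  by case: rs szr {mem_rs} => // y rs _; exists y; exact: mem_head.
have z1 : ev psi (y1 *: o + u) = 0 by apply/eqP; rewrite -mem_rs.
set v1 := y1 *: o + u in z1.
have [g0 _] := hw0 y1 z1; rewrite -/v1 in g0.
pose g : S := 'X_0 ^+ (n - m); pose c := ev g v1 * ev (theta X w0) v1 / ev (mdir w0 psi) v1.
pose b w := g * theta X w - c *: mdir w psi.
have hg : g \is (n - m).-homog.
  rewrite /g; elim: (n - m)%N => [|k IH]; first by rewrite expr0 dhomog1.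
  by rewrite exprS; exact: dhomogM (var_homog C 0) IH.
have hpsiw w : mdir w psi \is n.+1.-homog by exact: mdir_homog.
have hb w : b w \is n.+1.-homog.
  rewrite rpredB ?rpredZ //.
  by have := dhomogM hg (theta_homog w hX); rewrite addnS subnK.
have rel w w' : exists q, b w * mdir w' psi - b w' * mdir w psi = q * psi.
  have [q e] := theta_mdir w w' hd si; exists (g * q).
  rewrite -mulrA -e /b -!mul_mpolyC; ring.
have bnode v w : v != 0 -> singular X v -> (forall w', ev (mdir w' psi) v = 0) -> ev (b w) v = 0.
  by move=> _ sv gr; rewrite /b evB evM evZ gr (theta_of_singular _ sv) !mulr0 subrr.
have p00 : mdir w0 psi != 0 by apply: contraNneq g0 => ->; rewrite ev0.
have cop := small_coprime irr hd (hpsiw w0) p00.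
have N0 := norm_coprime_neq0 d0 hd (hpsiw w0) psio cop.
have sz0 := size_norm_eq z hd (hpsiw w0) psio (fun y py => (hw0 y py).1).
have dv := gradient_norm_dvd node inv gc hd rel bnode N0.
have bv1 : ev (b w0) v1 = 0 by rewrite /b evB evM evZ /c divfK // subrr.
have szb := size_norm_lt z hd (hb w0) psio z1 bv1.
have bw00 : b w0 = 0.
  apply/eqP/negPn/negP => bw0; have copb := small_coprime irr hd (hb w0) bw0.
  have Nb0 := norm_coprime_neq0 d0 hd (hb w0) psio copb.
  by have := leq_trans (dvdp_leq Nb0 dv) szb; rewrite sz0 ltnn.
(* With b_w0 = 0 the relation makes [psi] divide the product of b_w and psi_w0; both have smaller
   degree than [psi], so b_w must be 0. *)
have bw w : b w = 0.
  apply/eqP/negPn/negP => bw; have [q] := rel w w0; rewrite bw00 mul0r subr0 => e.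
  have [|/(irreducible_not_mdvd irr cop)//] := irreducible_euclid irr (ex_intro _ q (etrans e (mulrC _ _))).
  exact: irreducible_not_mdvd irr (small_coprime irr hd (hb w) bw).
(* Evaluate at [o] in the direction [o]: theta_o(o) = 0, while psi_o(o) is the degree of [psi] by
   Euler's formula. Then g theta_w = 0 for all [w], which is impossible. *)
have c0 : c = 0.
  have := congr1 (fun p => ev p o) (bw o); rewrite /b evB evM evZ ev0 ev_theta (euler_ev _ hd) psio.
  have -> : det3 o o (vfeval X o) = 0 by rewrite /det3; ring.
  rewrite mulr0 sub0r mulr1 => /eqP; rewrite oppr_eq0 mulf_eq0 pnatr_eq0 orbF.
  by move/eqP.
apply: not_all_theta0 => w; have := bw w; rewrite /b c0 scale0r subr0 => /eqP.
rewrite mulf_eq0 => /orP[|/eqP //]; rewrite expf_eq0 => /andP[_ /eqP X00].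
have := congr1 (fun p => ev p (const_mx 1)) X00; rewrite evX ev0 mxE => /eqP.
by rewrite oner_eq0.
Qed.

(* Without singular points theta_w0 would divide psi_w0 at the level of norms, and
   d (m + 1) <= d (d - 1) contradicts the degree bound. *)
Lemma invariant_singular_point psi : invariant_curve X psi ->
  exists v, [/\ v != 0, singular X v & ev psi v = 0].
Proof.
move=> inv; have [irr hh si] := inv; have [d hd] := irreducible_degree irr hh.
have dm := invariant_degree inv hd.
apply: boolp.contrapT => ns.
have nsing v : v != 0 -> ev psi v = 0 -> ~ singular X v by move=> v0 pv sv; apply: ns; exists v.
have one0 : (1 : S) != 0 by exact: oner_neq0.
have [o [u [z [gc _]]]] := exists_good_chart hvs complete hd (mirreducible_neq0 irr) one0.
have psio := chart_unit gc; have d0 := chart_basis gc; have [mon sz] := chart_monic u z hd psio.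
have [w0 hw0] := generic_direction inv hd gc.
have [rs [szr mem_rs]] := infinite_roots u z hd psio.
have [y1 y1r] : exists y, y \in rs.
  by case: rs szr {mem_rs} => // y rs _; exists y; exact: mem_head.
have z1 : ev psi (y1 *: o + u) = 0 by apply/eqP; rewrite -mem_rs.
have p00 : mdir w0 psi != 0 by apply: contraNneq (hw0 y1 z1).1 => ->; rewrite ev0.
have hpsiw w : mdir w psi \is d.-homog by exact: mdir_homog.
have cop := small_coprime irr hd (hpsiw w0) p00.
have N0 := norm_coprime_neq0 d0 hd (hpsiw w0) psio cop.
have szt := size_norm_eq z hd (theta_homog w0 hX) psio (fun y py => (hw0 y py).2).
have [szp _] := norm_chart_coef u z hd (hpsiw w0) psio.
have Nt0 : norm d (chart o u z psi) (chart o u z (theta X w0)) != 0.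
  by rewrite -size_poly_gt0 szt.
have dv : norm d (chart o u z psi) (chart o u z (theta X w0)) %|
          norm d (chart o u z psi) (chart o u z (mdir w0 psi)).
  apply: (dvdp_local Nt0) => x0 k dk; have [rs0 szr0 rsE] := fiber_roots mon sz x0.
  have mem_rs0 y : (y \in rs0) = (ev psi (pt o u z x0 y) == 0).
    by rewrite -root_prod_XsubC -rsE /root fiberE ev2_chart.
  have [|w hw] := @common_nonzero_point C 3
      [seq cross_form (pt o u z x0 y) (vfeval X (pt o u z x0 y)) | y <- rs0].
    apply/allP => p /mapP[y yr ->]; apply: theta_form_neq0; first exact: pt_neq0.
    by apply: nsing; [exact: pt_neq0 | apply/eqP; rewrite -mem_rs0].
  have nr : ~~ root (norm d (chart o u z psi) (chart o u z (theta X w))) x0.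
    apply: (norm_neq0_at mon sz) => y; rewrite !ev2_chart => /eqP; rewrite -mem_rs0 => yr.
    rewrite theta_form; apply: hw.
    exact: (map_f (fun y => cross_form (pt o u z x0 y) (vfeval X (pt o u z x0 y)))).
  have [q e] := theta_mdir w w0 hd si.
  have relN := norm_proportional gc hd e.
  rewrite -(Gauss_dvdpr _ (coprimep_XsubC_exp k nr)) relN.
  exact: (dvdp_mulr _ dk).
have := leq_trans (dvdp_leq N0 dv) szp; rewrite szt ltnS leq_pmul2l // => h.
by move: dm h; clear; lia.
Qed.

End DegreeBound.

Lemma uniq_of_simple_roots (F : fieldType) (rs : seq F) :
  (forall x, x \in rs -> ~~ (('X - x%:P) ^+ 2 %| \prod_(z <- rs) ('X - z%:P))) -> uniq rs.
Proof.
elim: rs => // z rs IH h /=; apply/andP; split.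
  apply/negP => zr; case/negP: (h z (mem_head _ _)).
  by rewrite big_cons (big_rem z zr) /= mulrA -expr2 dvdp_mulr.
apply: IH => x xr; apply: contra (h x _); last by rewrite in_cons xr orbT.
by rewrite big_cons; exact: dvdp_mull.
Qed.

(** * Intersections of two invariant curves *)

Section Meeting.
Variable C : numClosedFieldType.
Local Notation S := {mpoly C[3]}.
Implicit Types (psi phi p r : S) (u v w o z : 'cV[C]_3).

Variables (X : vfield C) (m : nat).
Hypothesis hX : forall i, X i \is m.-homog.
Hypothesis node : forall v, v != 0 -> singular X v ->
  exists q1 q2 br, [/\ lin_indep3 v q1 q2,
    forall psi, invariant_curve X psi -> ev psi v = 0 -> node_type v q1 q2 br psi
  & forall b g h, g != 0 -> h != 0 -> mcoprime g h -> br b g -> br b h -> False].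
Variable vs : seq 'cV[C]_3.
Hypothesis hvs : singular_list X vs.
Hypothesis complete : forall v, v != 0 -> singular X v -> exists w c, w \in vs /\ v = c *: w.

Lemma meet_singular psi phi v : invariant_curve X psi -> invariant_curve X phi -> mcoprime psi phi ->
  v != 0 -> ev psi v = 0 -> ev phi v = 0 -> singular X v.
Proof.
move=> [irr h si] [_ h' si'] cop v0; exact: coprime_meet_singular (mirreducible_neq0 irr) h h' si si' cop v0.
Qed.

(** Each label of [br] is taken by at most one of the two curves, so neither is a node and their
    smooth types differ; one product of the determinant is then nonzero and the other is 0. *)
Lemma transversal_meeting psi phi v : invariant_curve X psi -> invariant_curve X phi ->
  mcoprime psi phi -> v != 0 -> ev psi v = 0 -> ev phi v = 0 ->
  exists q1 q2 : 'cV[C]_3, lin_indep3 v q1 q2 /\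
  ev (mdir q1 psi) v * ev (mdir q2 phi) v - ev (mdir q2 psi) v * ev (mdir q1 phi) v != 0.
Proof.
move=> inv inv' cop v0 pv pv'; have sv := meet_singular inv inv' cop v0 pv pv'.
have [q1 [q2 [br [ind nt disj]]]] := node v0 sv; exists q1, q2; split=> //.
have [[irr _ _] [irr' _ _]] := (inv, inv').
have dj b : br b psi -> br b phi -> False.
  exact: disj (mirreducible_neq0 irr) (mirreducible_neq0 irr') cop.
case: (nt psi inv pv) => [[t1 a1 a2]|[t1 a1 a2]|[[t1 t2] _ _ _ _]];
  case: (nt phi inv' pv') => [[s1 b1 b2]|[s1 b1 b2]|[[s1 s2] _ _ _ _]];
  try by [case: (dj true) | case: (dj false)].
- by rewrite a2 mul0r subr0 mulf_neq0.
- by rewrite a2 mul0r sub0r oppr_eq0 mulf_neq0.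
Qed.

(** The norm has degree d e and, by transversality, only simple roots. Different roots come from
    different singular lines, each represented in [vs]. *)
Lemma meeting_count d e psi phi : invariant_curve X psi -> invariant_curve X phi ->
  mcoprime psi phi -> psi \is d.-homog -> phi \is e.-homog ->
  (d * e <= count (fun v => (ev psi v == 0%R) && (ev phi v == 0%R)) vs)%N.
Proof.
move=> inv inv' cop; have [irr hh si] := inv; have [d' hd'] := irreducible_degree irr hh.
have psi0 := mirreducible_neq0 irr.
move=> hd he; have ed : d = d'.+1.
  by have := msize_hom hd psi0; rewrite (msize_hom hd' psi0) => -[].
(* [Q] keeps [u] off the tangents of [psi] at its smooth singular points of the field, so that psi_u
   is nonzero there, as [norm_le1_of_transversal] requires. *)
subst d; pose Q : S := \prod_(v <- vs) (if gform psi v == 0 then 1 else gform psi v).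
have Q0 : Q != 0.
  rewrite prodf_seq_neq0; apply/allP => v _ /=; case: (gform psi v =P 0) => [_|/eqP //].
  exact: oner_neq0.
have [o [u [z [gc Qu]]]] := exists_good_chart hvs complete hd psi0 Q0.
have uv v : v \in vs -> gform psi v != 0 -> ev (mdir u psi) v != 0.
  move=> hv g0; move: Qu; rewrite /Q (big_rem v hv) /= (negPf g0) evM mulf_eq0 negb_or.
  by rewrite ev_gform => /andP[].
have psio := chart_unit gc; have d0 := chart_basis gc; have [mon sz] := chart_monic u z hd psio.
set a := chart o u z psi in mon sz; set b := chart o u z phi.
have F0 : norm d' a b != 0 by exact: norm_coprime_neq0 d0 hd he psio cop.
have common x y : ev psi (pt o u z x y) = 0 -> ev phi (pt o u z x y) = 0 -> singular X (pt o u z x y).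
  by apply: meet_singular inv inv' cop _; exact: pt_neq0.
have szF : size (norm d' a b) = (d'.+1 * e).+1.
  apply: size_norm_eq => // y py; apply/negP => /eqP py'.
  apply: (infinite_nonsingular (y := y) gc).
  exact: (meet_singular inv inv' cop (infinite_neq0 y d0)).
have [rs FE] := closed_field_poly_normal (norm d' a b).
have lc0 : lead_coef (norm d' a b) != 0 by rewrite lead_coef_eq0.
have szrs : size rs = (d'.+1 * e)%N.
  by move: szF; rewrite FE size_scale // size_prod_XsubC => -[].
have root_rs x : x \in rs -> (norm d' a b).[x] = 0.
  by move=> xr; apply/eqP; rewrite FE -/(root _ _) rootZ // root_prod_XsubC.
have point x : x \in rs -> exists y, ev psi (pt o u z x y) = 0 /\ ev phi (pt o u z x y) = 0.
  move=> xr; have [y py py'] := common_root mon sz (root_rs x xr).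
  by exists y; rewrite -!ev2_chart.
have urs : uniq rs.
  apply: uniq_of_simple_roots => x0 xr; have [y0 [py py']] := point x0 xr.
  rewrite -(dvdpZr _ _ lc0) -FE; set P := pt o u z x0 y0 in py py'.
  have P0 : P != 0 by exact: pt_neq0.
  have [q1 [q2 [ind dt]]] := transversal_meeting inv inv' cop P0 py py'.
  have [a0 [a1 [a2 oE]]] := lin_indep3_span ind o.
  have [b0 [b1 [b2 uE]]] := lin_indep3_span ind u.
  have euP r k : r \is k.-homog -> ev r P = 0 -> ev (mdir P r) P = 0.
    by move=> hr rP; rewrite (euler_ev _ hr) rP mulr0.
  have dl : b1 * a2 - a1 * b2 != 0.
    apply: contraNneq d0 => dl; rewrite -(det3_pt o u z x0 y0) -/P.
    have -> : det3 o u P = (a1 * b2 - b1 * a2) * det3 P q1 q2 by rewrite oE uE /det3 !mxE; ring.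
    by rewrite -opprB dl oppr0 mul0r.
  have upsi : ev (mdir u psi) P != 0.
    have [w [c [hw Pw]]] := complete P0 (common x0 y0 py py').
    have c0 : c != 0 by apply: contraNneq P0 => c0; rewrite Pw c0 scale0r.
    rewrite Pw (ev_scale _ _ (mdir_homog u hd)) mulf_neq0 ?expf_neq0 //; apply: uv => //.
    have nz q : ev (mdir q psi) P != 0 -> gform psi w != 0.
      rewrite Pw (ev_scale _ _ (mdir_homog q hd)) mulf_eq0 negb_or => /andP[_]; exact: gform_neq0.
    have [z1|] := eqVneq (ev (mdir q1 psi) P) 0; last exact: nz.
    have [z2|] := eqVneq (ev (mdir q2 psi) P) 0; last exact: nz.
    by case/negP: dt; rewrite z1 z2 !mul0r subrr.
  have [A [B [D [e1 _ _ _]]]] := taylor2 o u z x0 y0 psi.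
  have [A' [B' [D' [f1 _ _ _]]]] := taylor2 o u z x0 y0 phi.
  rewrite -/P py !polyC0 add0r split_quadratic in e1.
  rewrite -/P py' !polyC0 add0r split_quadratic in f1.
  have e2 c (G H : {poly {poly C}}) : ev2 (c%:P%:P + G * ('X - x0%:P)%:P + H * ('X - y0%:P%:P)) x0 y0 = c.
    by rewrite !ev2D !ev2M ev2x ev2y !mulr0 !addr0 ev2C hornerC.
  apply: (norm_le1_of_transversal mon sz _ e1 f1); rewrite ?e2 //.
    move=> t; rewrite /a /b !ev2_chart => pt0 nt; apply/negP => /eqP pt1; case/negP: nt; apply/eqP.
    exact: (chart_fiber gc (common _ _ pt0 pt1) (common _ _ py py')).
  rewrite uE oE !ev_mdir3 (euP _ _ hd py) (euP _ _ he py') !mulr0 !add0r -subr_eq0.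
  have -> : (b1 * ev (mdir q1 psi) P + b2 * ev (mdir q2 psi) P) *
    (a1 * ev (mdir q1 phi) P + a2 * ev (mdir q2 phi) P) -
    (a1 * ev (mdir q1 psi) P + a2 * ev (mdir q2 psi) P) *
    (b1 * ev (mdir q1 phi) P + b2 * ev (mdir q2 phi) P) =
    (b1 * a2 - a1 * b2) * (ev (mdir q1 psi) P * ev (mdir q2 phi) P - ev (mdir q2 psi) P * ev (mdir q1 phi) P).
    by move: (ev _ P) (ev _ P) (ev _ P) (ev _ P) => *; ring.
  exact: mulf_neq0.
have H x : exists v, x \in rs -> [/\ v \in vs, ev psi v = 0, ev phi v = 0
    & exists c y, pt o u z x y = c *: v].
  have [xr|] := boolP (x \in rs); last by exists 0.
  have [y [py py']] := point x xr; have P0 := pt_neq0 x y d0.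
  have [w [c [hw Pw]]] := complete P0 (common x y py py').
  have c0 : c != 0 by apply: contraNneq P0 => c0; rewrite Pw c0 scale0r.
  have back r k : r \is k.-homog -> ev r (pt o u z x y) = 0 -> ev r w = 0.
    by move=> hr; rewrite Pw (ev_scale _ _ hr) => /eqP; rewrite mulf_eq0 expf_eq0 (negPf c0) andbF => /eqP.
  by exists w => _; split; [| exact: back hd py | exact: back he py' | exists c, y].
have [h hh'] := boolp.choice H.
rewrite -szrs -size_filter -(size_map h); apply: uniq_leq_size; last first.
  move=> v /mapP[x xr ->]; have [hv p1 p2 _] := hh' x xr.
  by rewrite mem_filter p1 p2 !eqxx.
(* If two roots gave the same member of [vs], their points would be proportional; det(o, u, .) makes
   the factors equal and det(o, ., z) the roots. *)
rewrite map_inj_in_uniq // => x x' xr xr' exx'.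
have [_ _ _ [c [y ey]]] := hh' x xr; have [_ _ _ [c' [y' ey']]] := hh' x' xr'.
have dw : det3 o u (h x) != 0.
  apply: contraNneq d0 => dw; rewrite -(det3_pt o u z x y) ey.
  have -> : det3 o u (c *: h x) = c * det3 o u (h x) by rewrite /det3 !mxE; ring.
  by rewrite dw mulr0.
have ecc : c = c'.
  apply: (mulIf dw); transitivity (det3 o u (pt o u z x y)); first by rewrite ey /det3 !mxE; ring.
  by rewrite det3_pt -(det3_pt o u z x' y') ey' exx' /det3 !mxE; ring.
apply: (mulIf d0); transitivity (det3 o (pt o u z x y) z); first by rewrite /pt /det3 !mxE; ring.
by rewrite ey ecc exx' -ey' /pt /det3 !mxE; ring.
Qed.

End Meeting.

Lemma sum_ord_lt n j : (\sum_(i < n) ((i < j)%N : nat) = minn n j)%N.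
Proof.
elim: n => [|n IH]; first by rewrite big_ord0 min0n.
by rewrite big_ord_recr /= IH; case: (ltnP n j) => h; lia.
Qed.

(** * Counting invariant curves *)

Section Counting.
Variable C : numClosedFieldType.
Local Notation S := {mpoly C[3]}.
Implicit Types (psi phi p r : S) (u v w o z : 'cV[C]_3).

Variables (X : vfield C) (m : nat).
Hypothesis hX : forall i, X i \is m.-homog.
Hypothesis hne : no_stationary_at_infinity X.
Hypothesis node : forall v, v != 0 -> singular X v ->
  exists q1 q2 br, [/\ lin_indep3 v q1 q2,
    forall psi, invariant_curve X psi -> ev psi v = 0 -> node_type v q1 q2 br psi
  & forall b g h, g != 0 -> h != 0 -> mcoprime g h -> br b g -> br b h -> False].
Variable vs : seq 'cV[C]_3.
Hypothesis hvs : singular_list X vs.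
Hypothesis complete : forall v, v != 0 -> singular X v -> exists w c, w \in vs /\ v = c *: w.

Lemma irreducible_coprime_or_proportional psi phi : mirreducible psi -> mirreducible phi ->
  mcoprime psi phi \/ exists2 c, c != 0 & phi = c *: psi.
Proof.
move=> irr irr'; have [[r e]|nd] := boolp.EM (mdvd psi phi); last first.
  by left; exact: irreducible_coprime.
right; have [|/msize_le1P[c rc]] := irr'.2 _ _ e; first by rewrite leqNgt irr.1.
have phiE : phi = c *: psi by rewrite e rc mulrC mul_mpolyC.
exists c => //; apply: contraNneq (mirreducible_neq0 irr') => c0.
by rewrite phiE c0 scale0r.
Qed.

Lemma singular_member psi : invariant_curve X psi -> exists v, v \in vs /\ ev psi v = 0.
Proof.
move=> inv; have [v [v0 sv pv]] := invariant_singular_point hX hne node hvs complete inv.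
have [w [c [hw vw]]] := complete v0 sv; exists w; split=> //.
have [_ [d hd] _] := inv; move: pv; rewrite vw (ev_scale _ _ hd) => /eqP.
rewrite mulf_eq0 expf_eq0 => /orP[/andP[_ /eqP c0]|/eqP //].
by case/negP: v0; rewrite vw c0 scale0r.
Qed.

Definition nonproportional (s : seq S) := forall i j : nat, (i < size s)%N -> (j < size s)%N ->
  i <> j -> ~ (exists c : C, nth 0 s i = c *: nth 0 s j).

Lemma nonproportional_coprime s i j : (forall psi, psi \in s -> invariant_curve X psi) ->
  nonproportional s -> (i < size s)%N -> (j < size s)%N -> i <> j ->
  mcoprime (nth 0 s i) (nth 0 s j).
Proof.
move=> inv np hi hj ij; have [irr _ _] := inv _ (mem_nth 0 hi); have [irr' _ _] := inv _ (mem_nth 0 hj).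
have [//|[c _ e]] := irreducible_coprime_or_proportional irr irr'.
by case: (np j i hj hi (fun e => ij (esym e))); exists c.
Qed.

Lemma branches : exists br : 'cV[C]_3 -> bool -> S -> Prop, forall v, v \in vs ->
  (forall psi, invariant_curve X psi -> ev psi v = 0 -> exists b, br v b psi) /\
  (forall b g h, g != 0 -> h != 0 -> mcoprime g h -> br v b g -> br v b h -> False).
Proof.
have [vs0 _ sing] := hvs.
suff H v : exists br : bool -> S -> Prop, v \in vs ->
  (forall psi, invariant_curve X psi -> ev psi v = 0 -> exists b, br b psi) /\
  (forall b g h, g != 0 -> h != 0 -> mcoprime g h -> br b g -> br b h -> False).
  by have [br hbr] := boolp.choice H; exists br.
have [hv|] := boolP (v \in vs); last by exists (fun _ _ => True).
have [q1 [q2 [br [_ nt disj]]]] := node (allP vs0 v hv) (sing v hv).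
exists br => _; split=> // psi inv pv; case: (nt psi inv pv) => [[t _ _]|[t _ _]|[[t _] _ _ _ _]].
- by exists true.
- by exists false.
- by exists true.
Qed.

(** Each curve is sent to a singular point on it together with a label of [br] there; coprime curves
    get different pairs. *)
Lemma invariant_list_bound s : (forall psi, psi \in s -> invariant_curve X psi) ->
  nonproportional s -> (size s <= 2 * size vs)%N.
Proof.
move=> inv np; have [br hbr] := branches.
have H psi : exists vb : 'cV[C]_3 * bool, psi \in s -> vb.1 \in vs /\ br vb.1 vb.2 psi.
  have [hs|] := boolP (psi \in s); last by exists (0, true).
  have [v [hv pv]] := singular_member (inv psi hs).
  by have [b hb] := (hbr v hv).1 psi (inv psi hs) pv; exists (v, b).
have [f hf] := boolp.choice H.
have uf : uniq (map f s).
  apply/(uniqP (0, true)) => i j; rewrite !inE !size_map => hi hj.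
  rewrite !(nth_map 0) // => e; apply: boolp.contrapT => ij.
  have [hv bi] := hf _ (mem_nth 0 hi); have [_ bj] := hf _ (mem_nth 0 hj); rewrite -e in bj.
  have [[irr _ _] [irr' _ _]] := (inv _ (mem_nth 0 hi), inv _ (mem_nth 0 hj)).
  apply: ((hbr _ hv).2 _ _ _ (mirreducible_neq0 irr) (mirreducible_neq0 irr') _ bi bj).
  exact: nonproportional_coprime.
have sub : {subset map f s <= [seq (v, b) | b <- [:: true; false], v <- vs]}.
  move=> vb /mapP[psi hs ->]; have [hv _] := hf psi hs.
  by apply/allpairsP; exists ((f psi).2, (f psi).1); split=> //=; [case: (f psi).2 | case: (f psi)].
by have := uniq_leq_size uf sub; rewrite size_map size_allpairs.
Qed.

Lemma complete_invariant_list : exists s : seq S,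
  [/\ forall psi, psi \in s -> invariant_curve X psi, nonproportional s &
   forall psi, invariant_curve X psi -> exists2 phi, phi \in s & exists c : C, psi = c *: phi].
Proof.
apply: boolp.contrapT => n.
suff [s [inv np szs]] : exists s : seq S, [/\ forall psi, psi \in s -> invariant_curve X psi,
    nonproportional s & size s = (2 * size vs).+1].
  by have := invariant_list_bound inv np; rewrite szs ltnn.
elim: (2 * size vs).+1 => [|k [s [inv np szs]]]; first by exists [::].
have [psi [ip nps]] : exists psi, invariant_curve X psi /\ forall phi c, phi \in s -> psi <> c *: phi.
  apply: boolp.contrapT => h; apply: n; exists s; split=> // psi ip.
  apply: boolp.contrapT => h'; apply: h; exists psi; split=> // phi c hphi e.
  by apply: h'; exists phi => //; exists c.
have nps' phi c : phi \in s -> phi <> c *: psi.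
  move=> hphi e; have [irr _ _] := inv phi hphi; apply: (nps phi c^-1 hphi).
  have c0 : c != 0 by apply: contraNneq (mirreducible_neq0 irr) => c0; rewrite e c0 scale0r.
  by rewrite e scalerA mulVf // scale1r.
exists (psi :: s); split; last by rewrite /= szs.
  by move=> phi; rewrite inE => /orP[/eqP ->|/inv].
move=> [|i] [|j] //=; rewrite ?ltnS => hi hj ij [c e].
- exact: nps (mem_nth 0 hj) e.
- exact: nps' (mem_nth 0 hi) e.
- by apply: (np i j hi hj) => [ij'|]; [apply: ij; rewrite ij' | exists c].
Qed.

(** Double counting of pairs of curves with a common member of [vs]: each pair has at least as many
    as the product of its degrees, and each member belongs to at most one pair, since two labels
    leave no room for a third curve. *)
Lemma degree_pairs_bound s : (forall psi, psi \in s -> invariant_curve X psi) ->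
  nonproportional s ->
  (\sum_(i < size s) \sum_(j < size s | (i < j)%N)
     tdeg (nth 0%R s i) * tdeg (nth 0%R s j) <= size vs)%N.
Proof.
move=> inv np; pose Z (v : 'cV[C]_3) (i : 'I_(size s)) := ev (nth 0 s i) v == 0.
apply: (@leq_trans (\sum_(i < size s) \sum_(j < size s | (i < j)%N) \sum_(v <- vs) (Z v i && Z v j))).
  apply: leq_sum => i _; apply: leq_sum => j ij.
  have [ii ij'] := (inv _ (mem_nth 0 (ltn_ord i)), inv _ (mem_nth 0 (ltn_ord j))).
  have [irr [d hd] _] := ii; have [irr' [e he] _] := ij'.
  rewrite /tdeg (msize_hom hd (mirreducible_neq0 irr)) (msize_hom he (mirreducible_neq0 irr')) /=.
  have nij : (i : nat) <> j by move=> e'; rewrite e' ltnn in ij.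
  have cop := nonproportional_coprime inv np (ltn_ord i) (ltn_ord j) nij.
  by have := meeting_count node hvs complete ii ij' cop hd he; rewrite -sum1_count big_mkcond.
under eq_bigr do rewrite exchange_big /=.
have -> : size vs = (\sum_(v <- vs) 1)%N by rewrite sum1_size.
rewrite exchange_big /= big_seq [X in (_ <= X)%N]big_seq.
have [br hbr] := branches; apply: leq_sum => v hv.
rewrite pair_big_dep /= -big_mkcondr /= sum1_card.
apply/card_le1_eqP => -[i j] [i' j']; rewrite !unfold_in /= => /and3P[ij zi zj] /and3P[ij' zi' zj'].
have three (a b c : 'I_(size s)) : a != b -> a != c -> b != c -> Z v a -> Z v b -> Z v c -> False.
  move=> nab nac nbc za zb zc; have [h1 h2] := hbr v hv.
  have B (k : 'I_(size s)) : Z v k -> exists b, br v b (nth 0 s k).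
    by move=> /eqP zk; apply: h1 => //; exact: inv (mem_nth 0 (ltn_ord k)).
  have D (k l : 'I_(size s)) t : k != l -> br v t (nth 0 s k) -> br v t (nth 0 s l) -> False.
    move=> kl; have [[irr _ _] [irr' _ _]] := (inv _ (mem_nth 0 (ltn_ord k)), inv _ (mem_nth 0 (ltn_ord l))).
    apply: h2; [exact: mirreducible_neq0 | exact: mirreducible_neq0 |].
    by apply: nonproportional_coprime => // /val_inj e; rewrite e eqxx in kl.
  have [t ta] := B a za; have [t' tb] := B b zb; have [t'' tc] := B c zc.
  have [e|n1] := eqVneq t t'; first by apply: (D a b t) => //; rewrite e.
  have [e|n2] := eqVneq t t''; first by apply: (D a c t) => //; rewrite e.
  apply: (D b c t') => //; suff -> : t' = t'' by [].
  by case: t t' t'' n1 n2 {ta tb tc} => -[] [].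
have nlt (a b : 'I_(size s)) : (a < b)%N -> a != b by move=> lt; apply: contraTneq lt => ->; rewrite ltnn.
have [ei|ni] := eqVneq i i'.
  have [ej|nj] := eqVneq j j'; first by rewrite ei ej.
  case: (three i j j' (nlt _ _ ij) _ nj zi zj zj'); rewrite ei; exact: nlt.
have [e1|n1] := eqVneq i j'.
  have n2 : i' != j by apply: nlt; rewrite (ltn_trans ij') // -e1.
  by case: (three i i' j ni (nlt _ _ ij) n2 zi zi' zj).
by case: (three i i' j' ni n1 (nlt _ _ ij') zi zi' zj').
Qed.

Lemma pairs_le_degree_sum s : (forall psi, psi \in s -> invariant_curve X psi) ->
  ((size s * (size s).-1)./2 <= \sum_(i < size s) \sum_(j < size s | (i < j)%N)
     tdeg (nth 0%R s i) * tdeg (nth 0%R s j))%N.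
Proof.
move=> inv; have deg1 (k : 'I_(size s)) : (0 < tdeg (nth 0%R s k))%N.
  have [irr _ _] := inv _ (mem_nth 0 (ltn_ord k)).
  by rewrite /tdeg; have := irr.1; case: (msize _) => [|[]].
apply: (@leq_trans (\sum_(i < size s) \sum_(j < size s | (i < j)%N) 1)); last first.
  by apply: leq_sum => i _; apply: leq_sum => j _; rewrite muln_gt0 !deg1.
rewrite -bin2 -(bin2_sum (size s)) big_mkord.
rewrite [X in (_ <= X)%N](eq_bigr (fun i : 'I_(size s) => \sum_(j < size s) ((i < j)%N : nat))); last first.
  by move=> i _; rewrite [LHS]big_mkcond; apply: eq_bigr => j _; case: ltnP.
rewrite [X in (_ <= X)%N]exchange_big /=; apply: leq_sum => j _.
by rewrite sum_ord_lt (minn_idPr (ltnW (ltn_ord j))).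
Qed.

End Counting.

(** * From the highest form back to the inhomogeneous field *)

Section ClosedField.
Variable C : numClosedFieldType.
Local Notation S := {mpoly C[3]}.
Local Notation hom k := (pihomog mdeg k).

Lemma infinite_fiber (T : eqType) (vs : seq T) (f : nat -> T) : (forall k, f k \in vs) ->
  exists2 v, v \in vs & forall N, exists2 k, (N < k)%N & f k = v.
Proof.
move=> fvs; apply: boolp.contrapT => n.
have H v : exists N, v \in vs -> forall k, (N < k)%N -> f k <> v.
  have [hv|] := boolP (v \in vs); last by exists 0%N.
  apply: boolp.contrapT => h; apply: n; exists v => // N.
  apply: boolp.contrapT => h'; apply: h; exists N => _ k Nk fk; apply: h'.
  by exists k.
have [N hN] := boolp.choice H; pose M := (\max_(v <- vs) N v).+1.
apply: (hN (f M) (fvs M) M) => //; rewrite ltnS.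
exact: (leq_bigmax_seq _ (fvs M)).
Qed.

Variables (f : vfield C) (m : nat).
Hypothesis hf : vf_degree f m.
Hypothesis hne : no_stationary_at_infinity (vhpart m f).
Hypothesis E : propertyE f m.

Lemma vhpart_homog i : vhpart m f i \is m.-homog.
Proof. by rewrite /vhpart hpartE; exact: pihomogP. Qed.

Lemma singular_node v : v != 0 -> singular (vhpart m f) v ->
  exists q1 q2 br, [/\ lin_indep3 v q1 q2,
    forall psi, invariant_curve (vhpart m f) psi -> ev psi v = 0 -> node_type v q1 q2 br psi
  & forall b g h, g != 0 -> h != 0 -> mcoprime g h -> br b g -> br b h -> False].
Proof.
move=> v0 [c vc]; have [q1 [q2 [br [ind nt disj]]]] := node_package hf.1 E v0 vc.
by exists q1, q2, br; split=> // psi [irr hh si]; exact: nt.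
Qed.

Lemma top_invariant_factor g : semi_invariant f g -> exists psi,
  invariant_curve (vhpart m f) psi /\ mdvd psi (hom (msize g).-1 g).
Proof.
move=> sg; have [lt top] := semi_invariant_top hf.1 sg.
have [psi [q [irr hh e]]] := irreducible_factor (pihomogP _ _ g) lt.
have g0 : hom (msize g).-1 g != 0 by apply: top_neq0; exact: semi_invariant_neq0 sg.
exists psi; split; last by exists q.
by split=> //; apply: irreducible_Xder_factor irr _ g0 top; exists q.
Qed.

Lemma coprime_sequence_absurd (g : nat -> S) : (forall k, semi_invariant f (g k)) ->
  (forall k l, k <> l -> mcoprime (g k) (g l)) -> False.
Proof.
move=> sg cop; have [vs [hvs _ complete]] := complete_singular_list vhpart_homog hne.
have H k : exists v, v \in vs /\ ev (hom (msize (g k)).-1 (g k)) v = 0.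
  have [psi [inv [q ->]]] := top_invariant_factor (sg k).
  have [v [hv pv]] := singular_member vhpart_homog hne singular_node hvs complete inv.
  by exists v; rewrite evM pv mul0r.
have [phi hphi] := boolp.choice H.
have [v hv inf] := infinite_fiber (fun k => (hphi k).1).
have H' N : exists k, (N < k)%N /\ phi k = v by have [k ? ?] := inf N; exists k.
(* [sel] is an increasing sequence of indices for which the highest forms all vanish at [v];
   starting the iteration at i + 1 ensures that every index is a value of [nxt]. *)
have [nxt hnxt] := boolp.choice H'; pose sel i := iter i.+1 nxt 0%N.
have selS i : (sel i < sel i.+1)%N by exact: (hnxt _).1.
have mono : {homo sel : i j / (i < j)%N} := homo_ltn ltn_trans selS.
have [vs0 _ sing] := hvs; have v0 := allP vs0 v hv; have [c vc] := sing v hv.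
apply: (three_coprime_absurd (g := fun i => g (sel i)) hf.1 E v0 vc) => [i|i j ij|i _].
- exact: sg.
- by apply: cop; case: (ltngtP i j) ij => // /mono lt _ e; rewrite e ltnn in lt.
- by have [_] := hphi (sel i); rewrite (hnxt (iter i nxt 0%N)).2.
Qed.

End ClosedField.

Theorem theorem4p3 (R : realType) (f : vfield R[i]) (m : nat) :
  vf_degree f m ->
  no_stationary_at_infinity (vhpart m f) ->
  propertyE f m ->
  (* (a) *)
  (forall psi : {mpoly R[i][3]},
      mirreducible psi -> mhomogeneous psi ->
      semi_invariant (vhpart m f) psi ->
      (tdeg psi <= m.+1)%N) /\
  (* (b) *)
  (exists s : seq {mpoly R[i][3]},
      (forall psi, psi \in s ->
         [/\ mirreducible psi, mhomogeneous psi &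
             semi_invariant (vhpart m f) psi]) /\
      (forall i j : nat, (i < size s)%N -> (j < size s)%N -> i <> j ->
         ~ (exists c : R[i], nth 0 s i = c *: nth 0 s j)) /\
      (forall psi : {mpoly R[i][3]},
         mirreducible psi -> mhomogeneous psi ->
         semi_invariant (vhpart m f) psi ->
         exists2 phi, phi \in s & exists c : R[i], psi = c *: phi) /\
      ((2 <= size s)%N ->
         (\sum_(i < size s) \sum_(j < size s | (i < j)%N)
             tdeg (nth 0%R s i) * tdeg (nth 0%R s j) <= m ^ 2 + m + 1)%N) /\
      ((size s * (size s).-1)./2 <= m ^ 2 + m + 1)%N) /\
  (* (c) *)
  ~ (exists g : nat -> {mpoly R[i][3]},
        (forall k, mirreducible (g k) /\ semi_invariant f (g k)) /\
        (forall k l, k <> l -> mcoprime (g k) (g l))).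
Proof.
move=> hf hne E; have hX := vhpart_homog f m.
have [vs [hvs szvs complete]] := complete_singular_list hX hne.
have node := singular_node hf E.
split; last split.
- move=> psi irr hh si; have [d hd] := hh.
  rewrite /tdeg (msize_hom hd (mirreducible_neq0 irr)).
  exact: (invariant_degree hX hne node hvs complete (And3 irr hh si) hd).
- have [s [inv np cpl]] := complete_invariant_list hX hne node hvs complete.
  have le := leq_trans (degree_pairs_bound node hvs complete inv np) szvs.
  exists s; split; first exact: inv.
  split; first exact: np.
  split; first by move=> psi irr hh si; exact: cpl (And3 irr hh si).
  split; first by move=> _; exact: le.
  exact: leq_trans (pairs_le_degree_sum inv) le.
- move=> [g [hg cop]]; apply: (coprime_sequence_absurd hf hne E _ cop) => k.
  exact: (hg k).2.
Qed.
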